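(* Let $t_+\ge 0$, $f\in C([t_+,\infty)\times\mathbb R^n,\mathbb R^n)$, $\frac{\partial f}{\partial x}\in C([t_+,\infty)\times\mathbb R^n,\mathrm L(\mathbb R^n))$, $A,B\in C^1([t_+,\infty),\mathrm L(\mathbb R^n))$, let the pencil $\lambda A(t)+B(t)$ be regular for each $t\ge t_+$ and suppose there are functions $C_1,C_2\colon[t_+,\infty)\to(0,\infty)$ with $C_2\in C^1([t_+,\infty),(0,\infty))$ such that for each $t\in[t_+,\infty)$, $\|(\lambda A(t)+B(t))^{-1}\|\le C_1(t)$ for all $\lambda$ with $|\lambda|\ge C_2(t)$. With the notation $P_j,Q_j,X_j,Y_j,G,L_{t_+},\Phi$ of the context, suppose: (1) EITHER both of the following hold: (1a) for each $t\in[t_+,\infty)$ and each $x_{p_1}\in X_1(t)$ there exists a unique $x_{p_2}\in X_2(t)$ such that $(t,x_{p_1}+x_{p_2})\in L_{t_+}$; (1b) for each $t_*\in[t_+,\infty)$, $x_{p_1}^*\in X_1(t_* )$, $x_{p_2}^*\in X_2(t_* )$ with $(t_*,x_{p_1}^*+x_{p_2}^* )\in L_{t_+}$, the operator $\Phi_{t_*,x_{p_1}^*}(x_{p_2}^* )\colon X_2(t_* )\to Y_2(t_* )$ is invertible; OR both of the following hold: (1a') for each $t\in[t_+,\infty)$ and each $x_{p_1}\in X_1(t)$ there exists $x_{p_2}\in X_2(t)$ such that $(t,x_{p_1}+x_{p_2})\in L_{t_+}$; (1b') for each $t_*\in[t_+,\infty)$, $x_{p_1}^*\in X_1(t_* )$,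 $x_{p_2}^1,x_{p_2}^2\in X_2(t_* )$ with $(t_*,x_{p_1}^*+x_{p_2}^i)\in L_{t_+}$, $i=1,2$, the operator function $\Phi_{t_*,x_{p_1}^*}\colon X_2(t_* )\to\mathrm L(X_2(t_* ),Y_2(t_* ))$ is basis invertible on the segment $[x_{p_2}^1,x_{p_2}^2]$. (2) There exist $k\in C([t_+,\infty),\mathbb R)$, $U\in C((0,\infty),(0,\infty))$, a number $R>0$ and a positive definite function $V\in C^1([t_+,\infty)\times U_R^c(0),\mathbb R)$, where $U_R^c(0)=\{z\in\mathbb R^n:\|z\|\ge R\}$, such that $\int_{v_0}^\infty \frac{dv}{U(v)}=\infty$ (for some constant $v_0>0$); $V(t,z)\to\infty$ as $\|z\|\to\infty$ uniformly in $t$ on each finite interval $[a,b)\subset[t_+,\infty)$; and for all $t\in[t_+,\infty)$, $x_{p_1}\in X_1(t)$, $x_{p_2}\in X_2(t)$ with $(t,x_{p_1}+x_{p_2})\in L_{t_+}$ and $\|x_{p_1}\|\ge R$, $$\frac{\partial V}{\partial t}(t,x_{p_1})+\Big(\frac{\partial V}{\partial z}(t,x_{p_1}),\,[P_1'(t)-G^{-1}(t)Q_1(t)(A'(t)+B(t))]x_{p_1}+G^{-1}(t)Q_1(t)f(t,x_{p_1}+x_{p_2})\Big)\le k(t)\,U\big(V(t,x_{p_1})\big).$$ Let $t_0\ge t_+$ and $T>t_0$. In addition, let the operator $\Phi_{t_*,P_1(t_* )z_*}(P_2(t_* )u_* )\colon X_2(t_* )\to Y_2(t_* )$ be invertible for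 each point $(t_*,P_1(t_* )z_*+P_2(t_* )u_* )\in[t_0,T]\times\mathbb R^n$. Let $A,B\in C^2([t_0,T],\mathrm L(\mathbb R^n))$, $C_2\in C^2([t_0,T],(0,\infty))$, $f\in C^1([t_0,T]\times\mathbb R^n,\mathbb R^n)$, and let $x_0\in\mathbb R^n$ be chosen so that $(t_0,x_0)\in L_{t_+}$. For $N\in\mathbb N$ put $h=(T-t_0)/N$, $t_i=t_0+ih$ ($i=0,\dots,N$). Then the method $$z_0=P_1(t_0)x_0,\qquad u_0=P_2(t_0)x_0,$$ $$z_{i+1}=\Big(I+h\big[P_1'(t_i)-G^{-1}(t_i)Q_1(t_i)[A'(t_i)+B(t_i)]\big]P_1(t_i)\Big)z_i+h\,G^{-1}(t_i)Q_1(t_i)f(t_i,x_i),$$ $$\begin{aligned}u_{i+1}=u_i-\Big[I-&G^{-1}(t_{i+1})Q_2(t_{i+1})\tfrac{\partial f}{\partial x}\big(t_{i+1},P_1(t_{i+1})z_{i+1}+P_2(t_{i+1})u_i\big)P_2(t_{i+1})\Big]^{-1}\\ &\times\Big[u_i-G^{-1}(t_{i+1})Q_2(t_{i+1})\big[f\big(t_{i+1},P_1(t_{i+1})z_{i+1}+P_2(t_{i+1})u_i\big)-A'(t_{i+1})P_1(t_{i+1})z_{i+1}\big]\Big],\end{aligned}$$ $$x_{i+1}=P_1(t_{i+1})z_{i+1}+P_2(t_{i+1})u_{i+1},\qquad i=0,\dots,N-1,$$ (where $I=I_{\mathbb R^n}$), which approximates on $[t_0,T]$ the initial value problem $\frac{d}{dt}[A(t)x(t)]+B(t)x(t)=f(t,x(t))$,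 $x(t_0)=x_0$, is convergent of order 1, that is, $$\max_{1\le i\le N}\|x(t_i)-x_i\|=O(h),\qquad h\to0,$$ where $x(t)$ is an exact solution of this initial value problem.
   Context: $\mathrm L(X,Y)$ is the space of (continuous) linear operators from $X$ to $Y$, $\mathrm L(X)=\mathrm L(X,X)$; $(\cdot,\cdot)$ is the inner product and $\|\cdot\|$ the norm on $\mathbb R^n$. The operators $A(t),B(t)$ may be noninvertible. Solution: a function $x\in C([t_0,t_1),\mathbb R^n)$ is a solution of $\frac{d}{dt}[A(t)x]+B(t)x=f(t,x)$ on $[t_0,t_1)$ if $A(t)x(t)$ is continuously differentiable on $[t_0,t_1)$ and $x$ satisfies the equation there; it solves the initial value problem if also $x(t_0)=x_0$. The exact solution considered is the global one, i.e. on $[t_0,\infty)$. Pencil: $\lambda A(t)+B(t)$ ($\lambda$ a complex parameter) is regular for a given $t$ if $(\lambda A(t)+B(t))^{-1}$ exists for some $\lambda$. Spectral projectors: for each $t\ge t_+$, $$P_1(t)=\frac1{2\pi \mathrm i}\oint_{|\lambda|=C_2(t)}(\lambda A(t)+B(t))^{-1}A(t)\,d\lambda,\quad Q_1(t)=\frac1{2\pi \mathrm i}\oint_{|\lambda|=C_2(t)}A(t)(\lambda A(t)+B(t))^{-1}\,d\lambda,$$ $P_2(t)=I_{\mathbb R^n}-P_1(t)$, $Q_2(t)=I_{\mathbb R^n}-Q_1(t)$. These are real projectors; $X_j(t)=P_j(t)\mathbb R^n$, $Y_j(t)=Q_j(t)\mathbb R^n$ ($j=1,2$), so $\mathbb R^n=X_1(t)\dot+X_2(t)=Y_1(t)\dot+Y_2(t)$,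 and $A(t),B(t)$ map $X_j(t)$ into $Y_j(t)$. The operator $G(t)=A(t)+B(t)P_2(t)\in\mathrm L(\mathbb R^n)$ is invertible and $G(t)X_j(t)=Y_j(t)$. The operator functions $P_j,Q_j,G,G^{-1}$ have the same smoothness in $t$ as $A,B,C_2$; primes denote $d/dt$. Consistency manifold: $$L_{t_+}=\{(t,x)\in[t_+,\infty)\times\mathbb R^n: Q_2(t)[A'(t)P_1(t)x+B(t)x-f(t,x)]=0\}.$$ Operator function $\Phi$: for $t_*\in[t_+,\infty)$, $x_{p_1}^*\in X_1(t_* )$, $x_{p_2}\in X_2(t_* )$, $$\Phi_{t_*,x_{p_1}^*}(x_{p_2})=\Big[\frac{\partial}{\partial x}\big[Q_2(t_* )f(t_*,x_{p_1}^*+x_{p_2})\big]-B(t_* )\Big]P_2(t_* )\colon X_2(t_* )\to Y_2(t_* ).$$ Basis invertibility: an additive resolution of the identity in an $s$-dimensional space $Z$ is a system of $s$ projectors $\Theta_k\in \mathrm L(Z)$ with $\Theta_i\Theta_j=\delta_{ij}\Theta_i$ and $\sum_{k=1}^s\Theta_k=I_Z$. For $s$-dimensional spaces $W,Z$ and $D\subset W$, an operator function $\Phi\colon D\to\mathrm L(W,Z)$ is basis invertible on an interval (segment) $J\subset D$ if for some additive resolution of the identity $\{\Theta_k\}_{k=1}^s$ in $Z$ and for any set $\{w^k\}_{k=1}^s\subset J$ the operator $\sum_{k=1}^s\Theta_k\Phi(w^k)\in\mathrm L(W,Z)$ is invertible. Positive definite function: $V$ on $[t_+,\infty)\times U_R^c(0)$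 is positive definite in the usual (Lyapunov) sense, i.e. $V(t,z)\ge W(z)$ for some continuous function $W$ with $W(z)>0$ for $z\in U_R^c(0)$. *)

(* Defs.v *)
From HB Require Import structures.
From mathcomp Require Import all_boot all_order all_algebra complex.
From mathcomp Require Import all_classical all_reals all_analysis.

Set Implicit Arguments.
Unset Strict Implicit.
Unset Printing Implicit Defensive.

Import Order.TTheory GRing.Theory Num.Theory.
Import numFieldNormedType.Exports.

Local Open Scope classical_set_scope.
Local Open Scope ring_scope.

(* R^n is the type 'cV[R]_n of column vectors, and L(R^n) is 'M[R]_n.  The
   library's norm on matrices is the sup norm; it is only used for the topology
   (continuity, limits).  The norm of the text is the Euclidean one, enorm. *)
Section Euclidean.
Variables (R : realType) (n : nat).

Definition inner (x y : 'cV[R]_n) : R := \sum_i x i 0 * y i 0.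

Definition enorm (x : 'cV[R]_n) : R := Num.sqrt (inner x x).

Definition cenorm (x : 'cV[R[i]]_n) : R :=
  Num.sqrt (\sum_i Normc.normc (x i 0) ^+ 2).

Definition copnorm (M : 'M[R[i]]_n) : R :=
  sup [set cenorm (M *m x) | x in [set x : 'cV[R[i]]_n | cenorm x <= 1]].

End Euclidean.

(* Smoothness on sets with boundary: derivatives at boundary points are limits
   of difference quotients within the set, i.e. one-sided derivatives at the
   endpoints of an interval.  Functions are total, but these notions only see
   their values on the set. *)
Section Smoothness.
Variables (R : realType) (n : nat).

Section OneVariable.
Variables (W : normedModType R) (J : set R) (g : R -> W).

Definition dquot (t s : R) : W := (s - t)^-1 *: (g s - g t).

Definition derivable_on (t : R) : Prop := cvg (dquot t @ within J t^').

Definition deriv_on (t : R) : W := lim (dquot t @ within J t^').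

Definition C1_on : Prop :=
  (forall t, J t -> derivable_on t) /\ {within J, continuous deriv_on}.

End OneVariable.

Definition C2_on (W : normedModType R) (J : set R) (g : R -> W) : Prop :=
  C1_on J g /\ C1_on J (deriv_on J g).

(* The matrix of the Frechet derivative; the library's jacobian is for row
   vectors. *)
Definition jac (g : 'cV[R]_n -> 'cV[R]_n) (x : 'cV[R]_n) : 'M[R]_n :=
  \matrix_(i, j) ('d g x (delta_mx j 0)) i 0.

Definition has_jac_on (J : set R) (f : R -> 'cV[R]_n -> 'cV[R]_n) : Prop :=
  (forall t x, J t -> differentiable (f t) x) /\
  {within J `*` setT, continuous (fun p : R * 'cV[R]_n => jac (f p.1) p.2)}.

Definition C1_tx (J : set R) (f : R -> 'cV[R]_n -> 'cV[R]_n) : Prop :=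
  [/\ {within J `*` setT, continuous (fun p : R * 'cV[R]_n => f p.1 p.2)},
      forall t x, J t -> derivable_on J (f ^~ x) t,
      {within J `*` setT,
        continuous (fun p : R * 'cV[R]_n => deriv_on J (f ^~ p.2) p.1)} &
      has_jac_on J f].

Definition is_grad_on (D : set 'cV[R]_n) (g : 'cV[R]_n -> R)
    (z w : 'cV[R]_n) : Prop :=
  forall e : R, 0 < e ->
    \forall y \near within D (nbhs z),
      `|g y - g z - inner w (y - z)| <= e * enorm (y - z).

(* Only used for D the complement of an open ball, where the gradient relative
   to D is unique at every point of D, including the bounding sphere. *)
Definition grad_on (D : set 'cV[R]_n) (g : 'cV[R]_n -> R) (z : 'cV[R]_n) :
  'cV[R]_n := xget 0 (is_grad_on D g z).

Definition C1_tz (J : set R) (D : set 'cV[R]_n) (V : R -> 'cV[R]_n -> R) :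
    Prop :=
  [/\ {within J `*` D, continuous (fun p : R * 'cV[R]_n => V p.1 p.2)},
      forall t z, J t -> D z -> derivable_on J (V ^~ z) t,
      forall t z, J t -> D z -> exists w, is_grad_on D (V t) z w,
      {within J `*` D,
        continuous (fun p : R * 'cV[R]_n => deriv_on J (V ^~ p.2) p.1)} &
      {within J `*` D,
        continuous (fun p : R * 'cV[R]_n => grad_on D (V p.1) p.2)}].

End Smoothness.

Section BasisInvertibility.
Variables (R : realType) (n : nat).
Implicit Types W Z J : set 'cV[R]_n.

Definition range_mx (M : 'M[R]_n) : set 'cV[R]_n :=
  range (fun x : 'cV[R]_n => M *m x).

(* An operator between subspaces W and Z of R^n is given by an n x n matrix
   mapping W into Z; only its restriction to W is relevant. *)
Definition invertible_between W Z (M : 'M[R]_n) : Prop :=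
  set_bij W Z (fun x => M *m x).

Definition additive_resolution (s : nat) Z (Theta : 'I_s -> 'M[R]_n) : Prop :=
  [/\ forall k z, Z z -> Z (Theta k *m z),
      forall i j z, Z z ->
        Theta i *m (Theta j *m z) = if i == j then Theta i *m z else 0 &
      forall z, Z z -> \sum_k Theta k *m z = z].

(* s is meant to be the common dimension of W and Z. *)
Definition basis_invertible (s : nat) W Z (F : 'cV[R]_n -> 'M[R]_n) J : Prop :=
  exists Theta : 'I_s -> 'M[R]_n, additive_resolution Z Theta /\
    forall w : 'I_s -> 'cV[R]_n, (forall k, J (w k)) ->
      invertible_between W Z (\sum_k Theta k *m F (w k)).

Definition segment (x y : 'cV[R]_n) : set 'cV[R]_n :=
  [set (1 - a) *: x + a *: y | a in `[0, 1]].

End BasisInvertibility.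

(* Contour integral of F over the positively oriented circle |lambda| = r,
   parametrized by lambda = r e^(i theta). *)
Definition circle_integral (R : realType) (r : R) (F : R[i] -> R[i]) : R[i] :=
  let g (theta : R) : R[i] :=
    let lambda := Complex (r * cos theta) (r * sin theta) in
    F lambda * ('i%C * lambda) in
  Complex
    (\int[lebesgue_measure]_(theta in `[0, 2 * pi]) complex.Re (g theta))
    (\int[lebesgue_measure]_(theta in `[0, 2 * pi]) complex.Im (g theta)).

Section Pencil.
Variables (R : realType) (n : nat) (A B : R -> 'M[R]_n) (C2 : R -> R).

Definition cmx (M : 'M[R]_n) : 'M[R[i]]_n := map_mx (fun a : R => a%:C%C) M.

Definition pencil (t : R) (lambda : R[i]) : 'M[R[i]]_n :=
  lambda *: cmx (A t) + cmx (B t).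

Definition regular_pencil (t : R) : Prop :=
  exists lambda : R[i], pencil t lambda \in unitmx.

Definition contour_mx (t : R) (F : R[i] -> 'M[R[i]]_n) : 'M[R[i]]_n :=
  (2 * pi%:C%C * 'i%C)^-1 *:
    \matrix_(j, k) circle_integral (C2 t) (fun lambda => F lambda j k).

(* The contour integrals are matrices with real entries; Re makes them
   matrices over R. *)
Definition P1 (t : R) : 'M[R]_n :=
  map_mx (@complex.Re R)
    (contour_mx t (fun lambda => invmx (pencil t lambda) *m cmx (A t))).

Definition Q1 (t : R) : 'M[R]_n :=
  map_mx (@complex.Re R)
    (contour_mx t (fun lambda => cmx (A t) *m invmx (pencil t lambda))).

Definition P2 (t : R) : 'M[R]_n := 1%:M - P1 t.
Definition Q2 (t : R) : 'M[R]_n := 1%:M - Q1 t.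

Definition X1 (t : R) : set 'cV[R]_n := range_mx (P1 t).
Definition X2 (t : R) : set 'cV[R]_n := range_mx (P2 t).
Definition Y2 (t : R) : set 'cV[R]_n := range_mx (Q2 t).

Definition G (t : R) : 'M[R]_n := A t + B t *m P2 t.
Definition Ginv (t : R) : 'M[R]_n := invmx (G t).

Section Equation.
Variables (tp : R) (f : R -> 'cV[R]_n -> 'cV[R]_n).

Definition dA (t : R) : 'M[R]_n := deriv_on `[tp, +oo[ A t.
Definition dP1 (t : R) : 'M[R]_n := deriv_on `[tp, +oo[ P1 t.

Definition Lmanifold : set (R * 'cV[R]_n) :=
  [set p | tp <= p.1 /\
    Q2 p.1 *m (dA p.1 *m P1 p.1 *m p.2 + B p.1 *m p.2 - f p.1 p.2) = 0].

Definition Phi (t : R) (xp1 xp2 : 'cV[R]_n) : 'M[R]_n :=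
  (jac (fun x => Q2 t *m f t x) (xp1 + xp2) - B t) *m P2 t.

Definition solves_IVP (J : set R) (t0 : R) (x0 : 'cV[R]_n)
    (x : R -> 'cV[R]_n) : Prop :=
  [/\ {within J, continuous x},
      C1_on J (fun t => A t *m x t),
      forall t, J t ->
        deriv_on J (fun s => A s *m x s) t + B t *m x t = f t (x t) &
      x t0 = x0].

(* One step from t to t' = t + h for the triple (z, u, x). *)
Definition method_step (h t t' : R)
    (zux : 'cV[R]_n * 'cV[R]_n * 'cV[R]_n) : 'cV[R]_n * 'cV[R]_n * 'cV[R]_n :=
  let: (z, u, x) := zux in
  let z' :=
    (1%:M + h *: ((dP1 t - Ginv t *m Q1 t *m (dA t + B t)) *m P1 t)) *m z +
    h *: (Ginv t *m Q1 t *m f t x) in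
  let y := P1 t' *m z' + P2 t' *m u in
  let u' :=
    u - invmx (1%:M - Ginv t' *m Q2 t' *m jac (f t') y *m P2 t') *m
        (u - Ginv t' *m Q2 t' *m (f t' y - dA t' *m P1 t' *m z')) in
  (z', u', P1 t' *m z' + P2 t' *m u').

Variables (t0 T : R) (x0 : 'cV[R]_n).

Definition stepsize (N : nat) : R := (T - t0) / N%:R.

Definition node (N i : nat) : R := t0 + i%:R * stepsize N.

Fixpoint method (N i : nat) : 'cV[R]_n * 'cV[R]_n * 'cV[R]_n :=
  if i is j.+1 then
    method_step (stepsize N) (node N j) (node N j.+1) (method N j)
  else (P1 t0 *m x0, P2 t0 *m x0, x0).

Definition approx_sol (N i : nat) : 'cV[R]_n := (method N i).2.

End Equation.
End Pencil.

(* Main.v *)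
(* For fixed t put S(l) = (l A + B)^-1.  The mean of S over the circle |l| = r does
   not depend on r >= C2(t), because d/dr of it is the integral of a derivative in
   the angle.  Letting r tend to infinity, the mean P of S satisfies A P = P A = 0,
   and averaging the resolvent identity gives P B P = P and, for the mean H of
   l S(l), H B P = P B H = 0; also A H + B P = H A + P B = 1.  Hence P1 = H A,
   P2 = P B, Q1 = A H, Q2 = B P and G^-1 = P + H, so that G^-1 Q1 = H and
   G^-1 Q2 = P.  These identities express P(t) - P(s) and H(t) - H(s) through
   A(t) - A(s) and B(t) - B(s), so that local boundedness of P and H, which comes
   from the contour integrals, already yields the smoothness of the projectors.

   The solution splits as x = z + u with z = P1 x and
   u = P (f(t, z + u) - A' z), and z obeys the differential equation discretized by
   the scheme up to O(h^2).  The operator 1 - P (df/dx) P2 inverted in the Newton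
   step is invertible by the hypothesis on Phi, with an inverse bounded in a tube
   around the trajectory.  One Newton step there multiplies the error in u by at
   most 1/2, up to the error in z and O(h), and a discrete Gronwall argument
   concludes. *)

Require Import Defs.
From HB Require Import structures.
From mathcomp Require Import all_boot all_order all_algebra complex.
From mathcomp Require Import all_classical all_reals all_analysis.
From mathcomp Require Import ring lra.

Set Implicit Arguments.
Unset Strict Implicit.
Unset Printing Implicit Defensive.

Import Order.TTheory GRing.Theory Num.Theory.
Import numFieldNormedType.Exports.

Local Open Scope classical_set_scope.
Local Open Scope ring_scope.

(** Two gaps in the data shape the argument. [C1] is an arbitrary positive function, so its value at
    one time says nothing about nearby times: the bound at [s] has to be carried to a neighbouring
    [t] by perturbing inverses ([Pinf_Hinf_local_bound]). And [x] is merely continuous, only [A x]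
    being differentiable, whereas order 1 needs local errors O(h^2). The component [z = H (A x)] is
    Lipschitz because [A x] is; for [u] the Lipschitz bound comes from the constraint, by examining
    a Newton step at time [t] that starts from [u s] ([u_lip]). The identity used there also
    controls the numerical Newton step, so no implicit function theorem is invoked. The error in [u]
    is halved by a step while the error in [z] grows by a factor 1 + O(h), hence a Gronwall lemma
    for two coupled sequences. All step estimates hold only in a tube, so the same induction must
    keep the iterates inside it. On the complex side, holomorphy enters only as a quadratic
    remainder bound, uniform outside a disc, which replaces Cauchy's theorem. *)

Section EntrywiseNorm.
Variable K : numDomainType.

(** The entrywise 1-norm is submultiplicative for rectangular products as well, and it makes sense
    over [R] and over [R[i]] alike; over [R[i]] its values are nonnegative complex numbers. *)
Definition nrm m n (M : 'M[K]_(m, n)) : K := \sum_i \sum_j `|M i j|.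

Lemma nrm_ge0 m n (M : 'M[K]_(m, n)) : 0 <= nrm M.
Proof. by apply: sumr_ge0 => i _; apply: sumr_ge0. Qed.

Lemma nrm0 m n : nrm (0 : 'M[K]_(m, n)) = 0.
Proof. by rewrite /nrm big1// => i _; rewrite big1// => j _; rewrite mxE normr0. Qed.

Lemma nrm_entry m n (M : 'M[K]_(m, n)) i j : `|M i j| <= nrm M.
Proof.
rewrite /nrm (bigD1 i)//= (bigD1 j)//= -addrA lerDl addr_ge0 ?sumr_ge0//.
by move=> k _; rewrite sumr_ge0.
Qed.

Lemma nrm0_eq0 m n (M : 'M[K]_(m, n)) : nrm M <= 0 -> M = 0.
Proof.
move=> M0; apply/matrixP => i j; rewrite mxE; apply/eqP.
by rewrite -normr_le0 (le_trans _ M0)// nrm_entry.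
Qed.

Lemma nrmD m n (M N : 'M[K]_(m, n)) : nrm (M + N) <= nrm M + nrm N.
Proof.
rewrite /nrm -big_split/= ler_sum// => i _; rewrite -big_split/= ler_sum// => j _.
by rewrite mxE ler_normD.
Qed.

Lemma nrmN m n (M : 'M[K]_(m, n)) : nrm (- M) = nrm M.
Proof. by apply: eq_bigr => i _; apply: eq_bigr => j _; rewrite mxE normrN. Qed.

Lemma nrmB m n (M N : 'M[K]_(m, n)) : nrm (M - N) <= nrm M + nrm N.
Proof. by rewrite -(nrmN N) nrmD. Qed.

Lemma nrmBC m n (M N : 'M[K]_(m, n)) : nrm (M - N) = nrm (N - M).
Proof. by rewrite -nrmN opprB. Qed.

Lemma nrmZ m n a (M : 'M[K]_(m, n)) : nrm (a *: M) = `|a| * nrm M.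
Proof.
rewrite /nrm mulr_sumr; apply: eq_bigr => i _; rewrite mulr_sumr.
by apply: eq_bigr => j _; rewrite mxE normrM.
Qed.

Lemma nrmM m n p (M : 'M[K]_(m, n)) (N : 'M[K]_(n, p)) :
  nrm (M *m N) <= nrm M * nrm N.
Proof.
rewrite /nrm mulr_suml ler_sum// => i _; rewrite mulr_suml.
apply: (@le_trans _ _ (\sum_j \sum_k `|M i j| * `|N j k|)).
  rewrite exchange_big/= ler_sum// => k _; rewrite mxE.
  by rewrite (le_trans (ler_norm_sum _ _ _))// ler_sum// => j _; rewrite normrM.
rewrite ler_sum// => j _; rewrite -mulr_sumr ler_wpM2l//.
rewrite (bigD1 j)//= lerDl sumr_ge0// => k _.
by rewrite sumr_ge0.
Qed.

End EntrywiseNorm.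

(** * Complex-valued integrals over the angle of a circle *)

Section Circle.
Variable R : realType.
Local Notation C := R[i].
Local Notation Re := (@complex.Re R).
Local Notation Im := (@complex.Im R).
Local Notation mu := (@lebesgue_measure R).
Local Notation I02 := (`[0, 2 * pi]%classic : set R).
Implicit Types (g : R -> C) (F D : C -> C).

Definition circ (r theta : R) : C := Complex (r * cos theta) (r * sin theta).

Definition ccont g :=
  continuous (Re \o g) /\ continuous (Im \o g).

(** [circle_integral] is this integral applied to [F lambda * ('i * lambda)]. Separating the
    integrand from the differential leaves plain integrals over the angle. *)
Definition cint g : C := Complex
  (\int[mu]_(theta in I02) Re (g theta))
  (\int[mu]_(theta in I02) Im (g theta)).

Lemma cReD (x y : C) : Re (x + y) = Re x + Re y.
Proof. by case: x; case: y. Qed.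

Lemma cImD (x y : C) : Im (x + y) = Im x + Im y.
Proof. by case: x; case: y. Qed.

Lemma cReM (x y : C) : Re (x * y) =
  Re x * Re y - Im x * Im y.
Proof. by case: x; case: y. Qed.

Lemma cImM (x y : C) : Im (x * y) =
  Re x * Im y + Im x * Re y.
Proof. by case: x => a b; case: y. Qed.

Lemma normc_ge_absRe (x : C) : `|Re x| <= Normc.normc x.
Proof. by case: x => a b /=; rewrite -sqrtr_sqr ler_wsqrtr// lerDl sqr_ge0. Qed.

Lemma normc_ge_absIm (x : C) : `|Im x| <= Normc.normc x.
Proof. by case: x => a b /=; rewrite -sqrtr_sqr ler_wsqrtr// lerDr sqr_ge0. Qed.

Lemma normc_le_ReIm (x : C) :
  Normc.normc x <= `|Re x| + `|Im x|.
Proof.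
case: x => a b /=; rewrite -[leRHS]ger0_norm ?addr_ge0// -sqrtr_sqr.
rewrite ler_wsqrtr// sqrrD !real_normK ?num_real//.
by rewrite addrAC lerDl mulrn_wge0// mulr_ge0.
Qed.

Lemma normr_normc (x : C) : `|x| = (Normc.normc x)%:C%C.
Proof. by case: x. Qed.

Lemma lec_normc (x k : C) : `|x| <= k -> Normc.normc x <= Re k.
Proof. by rewrite normr_normc; case: k => a b /andP[]. Qed.

Lemma normc_circ r theta : 0 <= r -> Normc.normc (circ r theta) = r.
Proof.
move=> r0; rewrite /= !exprMn -mulrDr cos2Dsin2 mulr1 sqrtr_sqr ger0_norm//.
Qed.

Lemma pi2_gt0 : 0 < 2 * pi :> R.
Proof. by rewrite mulr_gt0// pi_gt0. Qed.

Lemma cont_integrable (f : R -> R) : continuous f ->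
  mu.-integrable I02 (EFin \o f).
Proof.
move=> cf; apply: continuous_compact_integrable; first exact: segment_compact.
exact: continuous_subspaceT.
Qed.

Lemma ccont_cst (c : C) : ccont (cst c).
Proof. by split; apply: cst_continuous. Qed.

Lemma ccontD g h : ccont g -> ccont h -> ccont (fun x => g x + h x).
Proof.
move=> [g1 g2] [h1 h2]; split => x.
  rewrite (_ : _ \o _ = (fun x => Re (g x) + Re (h x))).
    by apply: cvgD; [exact: g1|exact: h1].
  by apply/funext => y /=; rewrite cReD.
rewrite (_ : _ \o _ = (fun x => Im (g x) + Im (h x))).
  by apply: cvgD; [exact: g2|exact: h2].
by apply/funext => y /=; rewrite cImD.
Qed.

Lemma ccontM g h : ccont g -> ccont h -> ccont (fun x => g x * h x).
Proof.
move=> [g1 g2] [h1 h2]; split => x.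
  rewrite (_ : _ \o _ = (fun x => Re (g x) * Re (h x) -
     Im (g x) * Im (h x))).
    by apply: cvgB; apply: cvgM;
      [exact: g1|exact: h1|exact: g2|exact: h2].
  by apply/funext => y /=; rewrite cReM.
rewrite (_ : _ \o _ = (fun x => Re (g x) * Im (h x) +
   Im (g x) * Re (h x))).
  by apply: cvgD; apply: cvgM; [exact: g1|exact: h2|exact: g2|exact: h1].
by apply/funext => y /=; rewrite cImM.
Qed.

Lemma ccontN g : ccont g -> ccont (fun x => - g x).
Proof.
move=> cg; under eq_fun do rewrite -mulN1r.
exact: ccontM (ccont_cst _) cg.
Qed.

Lemma ccont_sum (I : Type) (s : seq I) (g : I -> R -> C) :
  (forall i, ccont (g i)) -> ccont (fun x => \sum_(i <- s) g i x).
Proof.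
move=> cg; elim: s => [|a s IH].
  under eq_fun do rewrite big_nil; exact: ccont_cst.
under eq_fun do rewrite big_cons; exact: ccontD.
Qed.

Lemma ccont_circ r : ccont (circ r).
Proof.
split => x; apply: cvgM; try exact: cvg_cst.
  exact: continuous_cos.
exact: continuous_sin.
Qed.

Lemma cintD g h : ccont g -> ccont h ->
  cint (fun x => g x + h x) = cint g + cint h.
Proof.
move=> [g1 g2] [h1 h2]; rewrite /cint; apply/eqP; rewrite eq_complex/=.
under eq_Rintegral do rewrite cReD.
rewrite RintegralD//; [|exact: cont_integrable..].
rewrite eqxx/=; under eq_Rintegral do rewrite cImD.
by rewrite RintegralD//; [exact: cont_integrable..].
Qed.

Lemma cintZ g c : ccont g -> cint (fun x => c * g x) = c * cint g.
Proof.
move=> [g1 g2]; rewrite /cint; case: c => a b; apply/eqP; rewrite eq_complex/=.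
have i1 := cont_integrable g1; have i2 := cont_integrable g2.
have cZ (f : R -> R) (k : R) : continuous f -> continuous (fun x => k * f x).
  by move=> cf x; apply: cvgM; [exact: cvg_cst|exact: cf].
under eq_Rintegral do rewrite cReM.
rewrite RintegralB//; [|by apply: cont_integrable; exact: (cZ _ _ g1)|
  by apply: cont_integrable; exact: (cZ _ _ g2)].
rewrite !RintegralZl//= eqxx/=.
under eq_Rintegral do rewrite cImM.
rewrite RintegralD//; [|by apply: cont_integrable; exact: (cZ _ _ g2)|
  by apply: cont_integrable; exact: (cZ _ _ g1)].
by rewrite !RintegralZl.
Qed.

Lemma cint_cst c : cint (cst c) = (2 * pi)%:C%C * c.
Proof.
rewrite /cint !Rintegral_cst//= lebesgue_measure_itv/= lte_fin pi2_gt0/=.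
apply/eqP; rewrite eq_complex cReM cImM/= subr0 !mul0r subr0 addr0.
by rewrite ![_ * (2 * pi)]mulrC !eqxx.
Qed.

Lemma cint_sum (I : Type) (s : seq I) (g : I -> R -> C) :
  (forall i, ccont (g i)) ->
  cint (fun x => \sum_(i <- s) g i x) = \sum_(i <- s) cint (g i).
Proof.
move=> cg; elim: s => [|a s IH].
  under eq_fun do rewrite big_nil; rewrite big_nil.
  by rewrite (_ : (fun=> 0) = cst 0)// cint_cst mulr0.
under eq_fun do rewrite big_cons; rewrite big_cons -IH cintD//.
exact: ccont_sum.
Qed.

(** The factor [4 * pi] instead of [2 * pi] comes from estimating the real and the imaginary part
    separately. *)
Lemma cint_bound g (k : R) : ccont g ->
  (forall x, Normc.normc (g x) <= k) ->
  Normc.normc (cint g) <= 4 * pi * k.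
Proof.
move=> [g1 g2] gk; rewrite (le_trans (normc_le_ReIm _))//=.
have bnd (f : R -> R) : continuous f -> (forall x, `|f x| <= k) ->
    `|\int[mu]_(x in I02) f x| <= 2 * pi * k.
  move=> cf fk; have fi := cont_integrable cf.
  rewrite (le_trans (le_normr_Rintegral _ fi))//.
  apply: (@le_trans _ _ (\int[mu]_(x in I02) k)).
    apply: le_Rintegral => //.
    - apply: cont_integrable => x; apply: cvg_norm; exact: cf.
    - by apply: cont_integrable; exact: cst_continuous.
  by rewrite Rintegral_cst//= lebesgue_measure_itv/= lte_fin pi2_gt0/= subr0 mulrC.
have -> : 4 * pi * k = 2 * pi * k + 2 * pi * k by ring.
rewrite lerD// bnd// => x.
  by rewrite (le_trans (normc_ge_absRe _)).
by rewrite (le_trans (normc_ge_absIm _)).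
Qed.

End Circle.

(** * Mean value estimates and quadratic remainders *)

Section MeanValue.
Variable R : realType.

Lemma mean_value_bound (f df : R -> R) (a b c k : R) : a <= b ->
  (forall x, x \in `]a, b[%R -> is_derive x 1 f (df x)) ->
  {within `[a, b], continuous f} ->
  (forall x, x \in `]a, b[%R -> `|df x - c| <= k) ->
  `|f b - f a - c * (b - a)| <= k * (b - a).
Proof.
rewrite le_eqVlt => /predU1P[<- _ _ _|ab fd fc fk].
  by rewrite !subrr !mulr0 subrr normr0.
have [x xab ->] := MVT ab fd fc.
rewrite -mulrBl normrM (gtr0_norm (x := b - a)) ?subr_gt0//.
by rewrite ler_wpM2r ?subr_ge0 ?(ltW ab)//; exact: fk.
Qed.

Lemma mean_value_bound_glob (f df : R -> R) (c k s t : R) :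
  (forall x : R, is_derive x 1 f (df x)) ->
  (forall x, `|x - t| <= `|s - t| -> `|df x - c| <= k) ->
  `|f s - f t - (s - t) * c| <= k * `|s - t|.
Proof.
move=> fd fk.
have fc : continuous f.
  by move=> x; apply/differentiable_continuous/derivable1_diffP; have [] := fd x.
have [st|ts] := leP s t; last first.
  rewrite (ger0_norm (x := s - t)) ?subr_ge0 ?(ltW ts)// [_ * c]mulrC.
  apply: (mean_value_bound (ltW ts) (df := df)) => // [|x].
    exact: continuous_subspaceT.
  rewrite in_itv/= => /andP[tx xs]; apply: fk.
  by rewrite !gtr0_norm ?subr_gt0// ltW// ltrD2r.
rewrite (ler0_norm (x := s - t)) ?subr_le0// opprB.
rewrite -normrN; have -> : - (f s - f t - (s - t) * c) = f t - f s - c * (t - s).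
  by ring.
apply: (mean_value_bound st (df := df)) => // [|x].
  exact: continuous_subspaceT.
rewrite in_itv/= => /andP[sx xt]; apply: fk.
by rewrite !ler0_norm ?subr_le0 ?(ltW xt)// lerN2 lerD2r ltW.
Qed.

Lemma cos_lip (s t : R) : `|cos s - cos t| <= `|s - t|.
Proof.
have := @mean_value_bound_glob (@cos R) (fun x => - sin x) 0 1 s t.
rewrite mulr0 subr0 mul1r; apply=> x _.
by rewrite subr0 normrN ler_norml sin_geN1 sin_le1.
Qed.

Lemma sin_lip (s t : R) : `|sin s - sin t| <= `|s - t|.
Proof.
have := @mean_value_bound_glob (@sin R) (@cos R) 0 1 s t.
rewrite mulr0 subr0 mul1r; apply=> x _.
by rewrite subr0 ler_norml cos_geN1 cos_le1.
Qed.

Lemma cos_taylor (s t : R) :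
  `|cos s - cos t - (s - t) * (- sin t)| <= `|s - t| * `|s - t|.
Proof.
apply: (@mean_value_bound_glob _ (fun x => - sin x)) => x xs.
by rewrite -normrN opprD !opprK (le_trans (sin_lip _ _)).
Qed.

Lemma sin_taylor (s t : R) :
  `|sin s - sin t - (s - t) * cos t| <= `|s - t| * `|s - t|.
Proof.
apply: (@mean_value_bound_glob _ (@cos R)) => x xs.
by rewrite (le_trans (cos_lip _ _)).
Qed.

(** Divided by the increment, a quadratic remainder still tends to 0. The resolvent estimates come
    in this explicit form. *)
Lemma is_derive_quad (f : R -> R) (t d k : R) :
  (forall s, `|f s - f t - (s - t) * d| <= k * `|s - t| ^+ 2) ->
  is_derive t 1 f d.
Proof.
move=> H.
have k0 : 0 <= `|k| + 1 by rewrite addr_ge0.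
have lim : (fun h => h^-1 *: ((f \o shift t) (h *: 1) - f t)) @ 0^' --> d.
  apply/cvgrPdist_le => e e0; near=> h.
  have h0 : h != 0 by near: h; exact: nbhs_dnbhs_neq.
  rewrite /= scaler1 -normrN opprB.
  have -> : h^-1 * (f (h + t) - f t) - d =
    h^-1 * (f (h + t) - f t - (h + t - t) * d) by field.
  rewrite normrM normfV; have := H (h + t); rewrite addrK => H1.
  rewrite ler_pdivrMl ?normr_gt0// (le_trans H1)// expr2 mulrA.
  rewrite [leRHS]mulrC ler_wpM2r//.
  have : `|h| <= e / (`|k| + 1).
    near: h; apply: dnbhs0_le; by rewrite divr_gt0// ltr_wpDl.
  rewrite ler_pdivlMr ?ltr_wpDl// => hk; rewrite (le_trans _ hk)// mulrC.
  by rewrite ler_wpM2l// (le_trans (ler_norm _))// lerDl.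
split; first by apply/cvg_ex; exists d.
by rewrite /derive; apply/cvg_lim.
Unshelve. all: by end_near. Qed.

(** Cutting the way from [s] to [r] into [N + 1] equal pieces bounds the total increment by
    [k |r - s|^2 / (N + 1)], which is arbitrarily small. This replaces a derivative with respect to
    the radius. *)
Lemma quadratic_increments_cst (g : R -> R) (c k : R) :
  (forall r s, c <= r -> c <= s -> `|g r - g s| <= k * `|r - s| ^+ 2) ->
  forall r s, c <= r -> c <= s -> g r = g s.
Proof.
move=> H r s cr cs; apply/eqP; rewrite -subr_eq0 -normr_le0; apply/ler_addgt0Pr => e e0.
rewrite add0r.
pose p N i := s + i%:R * ((r - s) / N.+1%:R).
have pc N i : (i <= N.+1)%N -> c <= p N i.
  move=> iN; rewrite /p.
  have -> : s + i%:R * ((r - s) / N.+1%:R) =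
    (1 - i%:R / N.+1%:R) * s + i%:R / N.+1%:R * r by field.
  have i1 : i%:R / N.+1%:R <= 1 :> R by rewrite ler_pdivrMr ?ltr0Sn// mul1r ler_nat.
  have i0 : 0 <= i%:R / N.+1%:R :> R by rewrite divr_ge0.
  have -> : c = (1 - i%:R / N.+1%:R) * c + i%:R / N.+1%:R * c by ring.
  by rewrite lerD// ler_wpM2l// subr_ge0.
have tel N i : (i <= N.+1)%N -> `|g (p N i) - g s| <=
    i%:R * (k * (`|r - s| / N.+1%:R) ^+ 2).
  elim: i => [_|i IH iN]; first by rewrite /p !mul0r addr0 subrr normr0.
  rewrite -(subrK (g (p N i)) (g (p N i.+1))) -addrA (le_trans (ler_normD _ _))//.
  rewrite -[in leRHS]natr1 mulrDl mul1r [leRHS]addrC lerD// ?IH// 1?ltnW//.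
  rewrite (le_trans (H _ _ _ _)) ?pc// 1?ltnW//.
  have -> : p N i.+1 - p N i = (r - s) / N.+1%:R by rewrite /p -natr1; ring.
  by rewrite normrM normfV normr_nat.
have [N hN] : exists N : nat, `|k * `|r - s| ^+ 2| / e <= N.+1%:R.
  exists (Num.truncn (`|k * `|r - s| ^+ 2| / e)).
  by rewrite ltW// truncnS_gt.
have := tel N N.+1 (leqnn _).
have -> : p N N.+1 = r by rewrite /p mulrC divfK ?pnatr_eq0// addrC subrK.
move=> /le_trans; apply.
have -> : N.+1%:R * (k * (`|r - s| / N.+1%:R) ^+ 2) = k * `|r - s| ^+ 2 / N.+1%:R.
  by field.
rewrite ler_pdivrMr ?ltr0Sn// (le_trans (ler_norm _))// [leRHS]mulrC -ler_pdivrMr//.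
Qed.

End MeanValue.

(** * Means of rational matrix functions over circles *)

Section CircleMeans.
Variable R : realType.
Local Notation C := R[i].
Local Notation Re := (@complex.Re R).
Local Notation Im := (@complex.Im R).
Local Notation mu := (@lebesgue_measure R).
Local Notation normc := (@Normc.normc R).

Lemma normc_ge0 (x : C) : 0 <= normc x.
Proof. by rewrite (le_trans _ (normc_ge_absRe x)). Qed.

Lemma mul_realc (a : R) (x : C) : a%:C%C * x = Complex (a * Re x) (a * Im x).
Proof. by case: x => b d; apply/eqP; rewrite eq_complex cReM cImM/= !mul0r subr0 addr0 !eqxx. Qed.

Lemma mul_iC (x : C) : 'i%C * x = Complex (- Im x) (Re x).
Proof. by case: x => b d; apply/eqP; rewrite eq_complex cReM cImM/= !mul0r !mul1r sub0r add0r !eqxx. Qed.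

Lemma normc_realc (a : R) : normc (a%:C%C) = `|a|.
Proof. by rewrite /= expr0n/= addr0 sqrtr_sqr. Qed.

Lemma circ_lip (r s t : R) : 0 <= r ->
  normc (circ r s - circ r t) <= 2 * r * `|s - t|.
Proof.
move=> r0; rewrite (le_trans (normc_le_ReIm _))//= -!mulrBr !normrM !(ger0_norm r0).
have -> : 2 * r * `|s - t| = r * `|s - t| + r * `|s - t| by ring.
by rewrite lerD// ler_wpM2l// ?cos_lip ?sin_lip.
Qed.

Lemma circ_taylor (r s t : R) : 0 <= r ->
  normc (circ r s - circ r t - (s - t)%:C%C * ('i%C * circ r t)) <=
  2 * r * `|s - t| ^+ 2.
Proof.
move=> r0; rewrite mul_iC mul_realc (le_trans (normc_le_ReIm _))//=.
have -> : r * cos s - r * cos t - (s - t) * - (r * sin t) =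
  r * (cos s - cos t - (s - t) * - sin t) by ring.
have -> : r * sin s - r * sin t - (s - t) * (r * cos t) =
  r * (sin s - sin t - (s - t) * cos t) by ring.
rewrite !normrM (ger0_norm r0).
have -> : 2 * r * `|s - t| ^+ 2 = r * `|s - t| ^+ 2 + r * `|s - t| ^+ 2 by ring.
by rewrite lerD// ler_wpM2l// expr2 ?cos_taylor ?sin_taylor.
Qed.

Section Derivative.
Variables (F D : C -> C) (c k : R).
Hypothesis c_gt0 : 0 < c.
Hypothesis k_ge0 : 0 <= k.
Hypothesis FD : forall l m, c <= normc l -> c <= normc m ->
  normc (F l - F m - (l - m) * D m) <= k * normc (l - m) ^+ 2.
Hypothesis F_cont : forall r, c <= r -> ccont (F \o circ r).
Hypothesis D_cont : forall r, c <= r -> ccont (D \o circ r).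

(** Chain rule with remainder: [FD] makes [D] the complex derivative of [F] outside a disc, and the
    angular derivative of [circ r] is ['i * circ r]. The first summand of the constant is the
    remainder of [F], the second that of the circle. *)
Lemma circ_deriv (r s t : R) : c <= r ->
  normc (F (circ r s) - F (circ r t) -
    (s - t)%:C%C * ('i%C * circ r t * D (circ r t))) <=
  (k * (2 * r) ^+ 2 + 2 * r * normc (D (circ r t))) * `|s - t| ^+ 2.
Proof.
move=> cr; have r0 : 0 <= r by rewrite (le_trans _ cr) ?(ltW c_gt0).
have -> : F (circ r s) - F (circ r t) - (s - t)%:C%C * ('i%C * circ r t * D (circ r t)) =
  (F (circ r s) - F (circ r t) - (circ r s - circ r t) * D (circ r t)) +
  (circ r s - circ r t - (s - t)%:C%C * ('i%C * circ r t)) * D (circ r t) by ring.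
rewrite (le_trans (le_normcD _ _))// [leRHS]mulrDl lerD//.
  rewrite (le_trans (FD _ _)) ?normc_circ// -mulrA ler_wpM2l// -exprMn.
  by rewrite lerXn2r ?nnegrE ?normc_ge0 ?circ_lip// !mulr_ge0.
rewrite Normc.normcM mulrAC ler_wpM2r ?normc_ge0//.
exact: circ_taylor.
Qed.

(** The integrand is the angular derivative of [F] along a closed curve, so the fundamental theorem
    of calculus, applied to real and imaginary parts, gives 0. *)
Lemma cint_circ_deriv (r : R) : c <= r ->
  cint (fun th => 'i%C * circ r th * D (circ r th)) = 0.
Proof.
move=> cr; have [F1 F2] := F_cont cr.
have cG : ccont (fun th => 'i%C * circ r th * D (circ r th)).
  by apply: ccontM (D_cont cr); apply: ccontM (ccont_cst _) (ccont_circ _).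
have [G1 G2] := cG.
have FTC (f g : R -> R) : continuous f -> continuous g ->
    (forall t : R, is_derive t 1 f (g t)) -> f (2 * pi) = f 0 ->
    \int[mu]_(x in `[0, 2 * pi]) g x = 0.
  move=> fc gc fg f0; rewrite /Rintegral (@continuous_FTC2 _ _ f).
  - by rewrite f0 -EFinB subrr.
  - exact: pi2_gt0.
  - exact: continuous_subspaceT.
  - split; first by move=> x _; have [] := fg x.
      exact/cvg_at_right_filter/fc.
    exact/cvg_at_left_filter/fc.
  - by move=> x _; rewrite derive1E; have [] := fg x.
have per : circ r (2 * pi) = circ r 0.
  by rewrite /circ mulr_natl cos2pi sin2pi cos0 sin0.
apply/eqP; rewrite eq_complex; apply/andP; split; apply/eqP.
  apply: (FTC (Re \o (F \o circ r)) _ F1 G1); last by rewrite /= per.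
  move=> t; apply: is_derive_quad => s.
  apply: le_trans (circ_deriv s t cr).
  rewrite (le_trans _ (normc_ge_absRe _))// mul_realc.
  by rewrite !cReD !(raddfN Re).
apply: (FTC (Im \o (F \o circ r)) _ F2 G2); last by rewrite /= per.
move=> t; apply: is_derive_quad => s.
apply: le_trans (circ_deriv s t cr).
rewrite (le_trans _ (normc_ge_absIm _))// mul_realc.
by rewrite !cImD !(raddfN Im).
Qed.

(** The integral changes with the radius only to second order, so [quadratic_increments_cst] applies
    and nothing is differentiated under the integral sign. *)
Lemma cint_circ_cst (r s : R) : c <= r -> c <= s ->
  cint (F \o circ r) = cint (F \o circ s).
Proof.
move=> cr cs.
suff H : forall r s, c <= r -> c <= s ->
    normc (cint (F \o circ r) - cint (F \o circ s)) <= 4 * pi * k * `|r - s| ^+ 2.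
  apply/eqP; rewrite eq_complex; apply/andP; split; apply/eqP.
    apply: (@quadratic_increments_cst _ (fun r => Re (cint (F \o circ r))) c (4 * pi * k)) cr cs.
    move=> a b ca cb; rewrite (le_trans _ (H a b ca cb))//.
    by rewrite (le_trans _ (normc_ge_absRe _))// cReD (raddfN Re).
  apply: (@quadratic_increments_cst _ (fun r => Im (cint (F \o circ r))) c (4 * pi * k)) cr cs.
  move=> a b ca cb; rewrite (le_trans _ (H a b ca cb))//.
  by rewrite (le_trans _ (normc_ge_absIm _))// cImD (raddfN Im).
move=> {cr cs} {}r {}s cr cs.
have r0 : 0 <= r by rewrite (le_trans _ cr) ?(ltW c_gt0).
have s0 : 0 < s by rewrite (lt_le_trans c_gt0).
have circE th : circ r th - circ s th = ((r - s) / s)%:C%C * circ s th.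
  rewrite mul_realc/= /circ; apply/eqP; rewrite eq_complex/=.
  have sn0 := lt0r_neq0 s0.
  by apply/andP; split; apply/eqP; field.
pose E th := F (circ r th) - F (circ s th) - (circ r th - circ s th) * D (circ s th).
have cE : ccont E.
  apply: ccontD; first by apply: ccontD (F_cont cr) _; apply: ccontN; exact: F_cont.
  apply: ccontN; apply: ccontM (D_cont cs).
  by apply: ccontD (ccont_circ r) _; apply: ccontN; exact: ccont_circ.
have cG : ccont (fun th => 'i%C * circ s th * D (circ s th)).
  by apply: ccontM (D_cont cs); apply: ccontM (ccont_cst _) (ccont_circ _).
(* The displacement [circ r - circ s] is a real multiple of [circ s], so the linear term is a
   constant multiple of the angular derivative, whose integral vanishes. The factor [- 'i] cancels
   the ['i] of that derivative. *)
have -> : cint (F \o circ r) = cint (fun th => F (circ s th) + (E th +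
    (- 'i%C * ((r - s) / s)%:C%C) * ('i%C * circ s th * D (circ s th)))).
  congr cint; apply/funext => th /=; rewrite /E circE.
  have i2 : 'i%C * 'i%C = -1 :> C by rewrite -expr2 sqr_i.
  have -> : - 'i%C * ((r - s) / s)%:C%C * ('i%C * circ s th * D (circ s th)) =
   - ('i%C * 'i%C) * (((r - s) / s)%:C%C * circ s th * D (circ s th)) by ring.
  by rewrite i2; ring.
rewrite cintD; [|exact: F_cont|]; last first.
  by apply: ccontD cE _; exact: ccontM (ccont_cst _) cG.
rewrite addrC addKr cintD//; last exact: ccontM (ccont_cst _) cG.
rewrite cintZ// cint_circ_deriv// mulr0 addr0.
have -> : 4 * pi * k * `|r - s| ^+ 2 = 4 * pi * (k * `|r - s| ^+ 2) by ring.
apply: cint_bound => // th.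
rewrite /E (le_trans (FD _ _)) ?normc_circ ?(ltW s0)// ler_wpM2l//.
rewrite circE Normc.normcM normc_circ ?(ltW s0)// normc_realc normrM normfV.
by rewrite (gtr0_norm s0) divfK ?gt_eqF.
Qed.

End Derivative.

End CircleMeans.

(** * The algebra of the first two coefficients of the resolvent at infinity *)

Section SpectralPair.
Variables (F : comNzRingType) (n : nat).
Implicit Types A B P H : 'M[F]_n.

(* Writing [S l = (l A + B)^-1] for a pencil of index at most one,
   [P] is the limit of [S l] at infinity and [H] is the residue of [S] there,
   i.e. [S l = P + l^-1 H + O (l^-2)]. *)
Definition spectral_pair A B P H : Prop :=
  [/\ A *m P = 0, P *m A = 0, A *m H + B *m P = 1%:M, H *m A + P *m B = 1%:M &
   [/\ P *m B *m P = P, H *m B *m P = 0 & P *m B *m H = 0]].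

(** Inserting [A H' + B P' = 1] on the right of [P] and [H A + P B = 1] on the left of [P'] turns
    both into [P B P']. The same insertions then turn [H] and [H'] into [H A H']. *)
Lemma spectral_pair_unique A B P H P' H' :
  spectral_pair A B P H -> spectral_pair A B P' H' -> P = P' /\ H = H'.
Proof.
move=> [AP PA AHBP HAPB [PBP HBP PBH]] [AP' PA' AHBP' HAPB' [PBP' HBP' PBH']].
have PP : P = P'.
  rewrite -[LHS]mulmx1 -AHBP' mulmxDr !mulmxA PA mul0mx add0r.
  rewrite -[RHS]mul1mx -HAPB mulmxDl -!mulmxA AP' mulmx0 add0r.
  by rewrite mulmxA.
split=> //; rewrite -[LHS]mulmx1 -AHBP' mulmxDr !mulmxA -PP HBP addr0.
have {}PBH' : P *m B *m H' = 0 by rewrite PP.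
by rewrite -[RHS]mul1mx -HAPB mulmxDl PBH' addr0.
Qed.

End SpectralPair.

Section MatrixMeans.
Variables (R : realType) (n : nat).
Local Notation C := R[i].
Local Notation normc := (@Normc.normc R).
Implicit Types M N : R -> 'M[C]_n.

Definition mcont M := forall i j, ccont (fun th => M th i j).

Definition mavg M : 'M[C]_n :=
  \matrix_(i, j) (((2 * pi)^-1)%:C%C * cint (fun th => M th i j)).

Lemma mavgE M i j :
  mavg M i j = ((2 * pi)^-1)%:C%C * cint (fun th => M th i j).
Proof. by rewrite mxE. Qed.

Lemma mcont_cst (X : 'M[C]_n) : mcont (fun=> X).
Proof. by move=> i j; exact: ccont_cst. Qed.

Lemma mcontZ g M : ccont g -> mcont M -> mcont (fun th => g th *: M th).
Proof.
by move=> cg cM i j; under eq_fun do rewrite mxE; exact: ccontM.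
Qed.

Lemma mcontM M N : mcont M -> mcont N -> mcont (fun th => M th *m N th).
Proof.
move=> cM cN i j; under eq_fun do rewrite mxE.
by apply: ccont_sum => k; exact: ccontM.
Qed.

Lemma mavgD M N : mcont M -> mcont N ->
  mavg (fun th => M th + N th) = mavg M + mavg N.
Proof.
move=> cM cN; apply/matrixP => i j; rewrite !mxE.
under eq_fun do rewrite mxE.
by rewrite cintD// mulrDr.
Qed.

Lemma mavgZ (a : C) M : mcont M -> mavg (fun th => a *: M th) = a *: mavg M.
Proof.
move=> cM; apply/matrixP => i j; rewrite !mxE.
under eq_fun do rewrite mxE.
by rewrite cintZ// mulrCA.
Qed.

Lemma mavgN M : mcont M -> mavg (fun th => - M th) = - mavg M.
Proof.
by move=> cM; under eq_fun do rewrite -scaleN1r; rewrite mavgZ// scaleN1r.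
Qed.

Lemma mavg_mull (X : 'M[C]_n) M : mcont M ->
  mavg (fun th => X *m M th) = X *m mavg M.
Proof.
move=> cM; apply/matrixP => i j; rewrite !mxE.
under eq_fun do rewrite mxE.
rewrite cint_sum; last by move=> k; exact: ccontM (ccont_cst _) (cM _ _).
rewrite mulr_sumr; apply: eq_bigr => k _; rewrite cintZ// mxE mulrCA//.
Qed.

Lemma mavg_mulr (X : 'M[C]_n) M : mcont M ->
  mavg (fun th => M th *m X) = mavg M *m X.
Proof.
move=> cM; apply/matrixP => i j; rewrite !mxE.
under eq_fun do rewrite mxE.
under eq_fun => th do under eq_bigr do rewrite mulrC.
rewrite cint_sum; last by move=> k; exact: ccontM (ccont_cst _) (cM _ _).
rewrite mulr_sumr; apply: eq_bigr => k _; rewrite cintZ// mxE mulrCA mulrC//.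
Qed.

Lemma mavg_cst (X : 'M[C]_n) : mavg (fun=> X) = X.
Proof.
apply/matrixP => i j; rewrite !mxE cint_cst mulrA -rmorphM/= mulVf ?mul1r//.
by rewrite gt_eqF// pi2_gt0.
Qed.

(** [cint_circ_deriv] for the identity, whose derivative is 1 and whose remainder is 0. *)
Lemma mavg_circ (r : R) (X : 'M[C]_n) : 0 < r ->
  mavg (fun th => circ r th *: X) = 0.
Proof.
move=> r0; apply/matrixP => i j; rewrite !mxE.
under eq_fun do rewrite mxE mulrC.
rewrite cintZ; last exact: ccont_circ.
have H : cint (circ r) = 0.
  have : cint (fun th => 'i%C * circ r th * cst 1 (circ r th)) = 0.
    apply: (@cint_circ_deriv R id (cst 1) r 0) => // [l m _ _|s _|s _].
    - by rewrite mulr1 subrr Normc.normc0 mul0r.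
    - exact: ccont_circ.
    - exact: ccont_cst.
  under eq_fun do rewrite /= mulr1.
  rewrite cintZ; last exact: ccont_circ.
  by move=> /eqP; rewrite mulf_eq0 eq_complex/= oner_eq0 andbF => /eqP.
by rewrite H !mulr0.
Qed.

Lemma mavg_bound (M : R -> 'M[C]_n) (k : R) i j : mcont M ->
  (forall th, normc (M th i j) <= k) -> normc (mavg M i j) <= 2 * k.
Proof.
move=> cM Mk; rewrite mxE Normc.normcM normc_realc.
rewrite ger0_norm ?invr_ge0 ?(ltW (pi2_gt0 R))//.
rewrite ler_pdivrMl ?pi2_gt0// (le_trans (cint_bound _ Mk))//.
by have -> : 4 * pi * k = 2 * pi * (2 * k) by ring.
Qed.

End MatrixMeans.

(** * Averages of the resolvent over large circles *)

Section Resolvent.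
Variables (R : realType) (n : nat) (A B : 'M[R[i]]_n) (c : R) (k : R[i]).
Variable S : R[i] -> 'M[R[i]]_n.
Local Notation C := R[i].
Local Notation normc := (@Normc.normc R).
Hypothesis c_gt0 : 0 < c.
Hypothesis mulVS : forall l, c <= normc l -> (l *: A + B) *m S l = 1%:M.
Hypothesis mulSV : forall l, c <= normc l -> S l *m (l *: A + B) = 1%:M.
Hypothesis S_bound : forall l, c <= normc l -> nrm (S l) <= k.

Let P := mavg (fun th => S (circ c th)).
Let H := mavg (fun th => circ c th *: S (circ c th)).

Lemma resolvent_identity l m : c <= normc l -> c <= normc m ->
  S l - S m = (m - l) *: (S l *m A *m S m).
Proof.
move=> cl cm.
have -> : S l - S m = S l *m ((m *: A + B) - (l *: A + B)) *m S m.
  rewrite mulmxBr mulmxBl -mulmxA (mulVS cm) mulmx1.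
  by rewrite (mulSV cl) mul1mx.
by rewrite opprD addrACA subrr addr0 -scalerBl -scalemxAr -scalemxAl.
Qed.

Let k_ge0 : 0 <= k.
Proof.
apply: le_trans (nrm_ge0 (S c%:C%C)) (S_bound _).
by rewrite normc_realc gtr0_norm.
Qed.

Let circ_ge r th : c <= r -> c <= normc (circ r th).
Proof. by move=> cr; rewrite normc_circ// (le_trans _ cr)// ltW. Qed.

Let S_lip l m : c <= normc l -> c <= normc m ->
  nrm (S l - S m) <= `|l - m| * (k * nrm A * k).
Proof.
move=> cl cm; rewrite resolvent_identity// nrmZ distrC ler_wpM2l//.
rewrite (le_trans (nrmM _ _))// ler_pM ?nrm_ge0 ?S_bound//.
by rewrite (le_trans (nrmM _ _))// ler_wpM2r ?nrm_ge0 ?S_bound.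
Qed.

(** By the resolvent identity a bounded resolvent is Lipschitz in [l], and [circ r] is Lipschitz in
    the angle. *)
Lemma mcont_resolvent r : c <= r -> mcont (fun th => S (circ r th)).
Proof.
move=> cr i j; have r0 : 0 <= r by rewrite (le_trans _ cr) ?ltW.
pose K := complex.Re (k * nrm A * k) * (2 * r).
have lip s t : normc (S (circ r s) i j - S (circ r t) i j) <= K * `|s - t|.
  have : `|S (circ r s) i j - S (circ r t) i j| <=
      `|circ r s - circ r t| * (k * nrm A * k).
    have := nrm_entry (S (circ r s) - S (circ r t)) i j; rewrite !mxE => /le_trans; apply.
    by rewrite S_lip// circ_ge.
  move=> /lec_normc/le_trans; apply; rewrite normr_normc mul_realc/= mulrC /K -[leRHS]mulrA.
  apply: ler_wpM2l; last exact: circ_lip.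
  have : 0 <= k * nrm A * k by rewrite !mulr_ge0 ?nrm_ge0.
  by case: (k * nrm A * k) => a b /andP[].
have contL (f : R -> R) : (forall s t, `|f s - f t| <= K * `|s - t|) -> continuous f.
  move=> fL x; apply/cvgrPdist_le => e e0; near=> y.
  rewrite (le_trans (fL _ _))//.
  have : `|x - y| <= e / (`|K| + 1).
    by near: y; apply: cvgr_dist_le => //; rewrite divr_gt0// ltr_wpDl.
  rewrite ler_pdivlMr ?ltr_wpDl// => /(le_trans _); apply.
  by rewrite mulrC ler_wpM2l// (le_trans (ler_norm _))// lerDl.
split; apply: contL => s t; apply: le_trans (lip s t).
  by rewrite (le_trans _ (normc_ge_absRe _))// cReD (raddfN (@complex.Re R)).
by rewrite (le_trans _ (normc_ge_absIm _))// cImD (raddfN (@complex.Im R)).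
Unshelve. all: by end_near. Qed.

Let SC := mcont_resolvent (lexx c).

(** The derivative of [S] is [- S A S]. Using the resolvent identity twice, the remainder is
    [(l - m)^2 S(l) A S(m) A S(m)], which gives the constant [K]. *)
Lemma mavg_resolvent_cst r : c <= r -> mavg (fun th => S (circ r th)) = P.
Proof.
move=> cr; apply/matrixP => i j.
rewrite !mavgE; congr (_ * _).
pose D l := - (S l *m A *m S l).
pose K := k * nrm A * (k * nrm A * k).
have K0 : 0 <= K by rewrite !mulr_ge0 ?nrm_ge0.
apply: (@cint_circ_cst R (fun l => S l i j) (fun l => D l i j) c (complex.Re K)) => //.
- by case: (K) K0 => a b /andP[].
- move=> l m cl cm.
  have E : S l - S m - (l - m) *: D m =
      ((l - m) ^+ 2) *: (S l *m A *m (S m *m A *m S m)).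
    have YX : S m - S l = (l - m) *: (S l *m A *m S m).
      by rewrite -opprB resolvent_identity// -scaleNr opprB.
    rewrite /D scalerN opprK resolvent_identity// -[m - l]opprB scaleNr addrC.
    by rewrite -scalerBr -!mulmxBl YX -!scalemxAl scalerA expr2 !mulmxA.
  have : `|S l i j - S m i j - (l - m) * D m i j| <= `|l - m| ^+ 2 * K.
    have := nrm_entry (S l - S m - (l - m) *: D m) i j; rewrite !mxE => /le_trans; apply.
    rewrite E nrmZ normrX ler_wpM2l ?exprn_ge0// /K.
    rewrite (le_trans (nrmM _ _))// ler_pM ?nrm_ge0//.
      by rewrite (le_trans (nrmM _ _))// ler_wpM2r ?nrm_ge0 ?S_bound.
    rewrite (le_trans (nrmM _ _))// ler_pM ?nrm_ge0 ?S_bound//.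
    by rewrite (le_trans (nrmM _ _))// ler_wpM2r ?nrm_ge0 ?S_bound.
  move=> /lec_normc/le_trans; apply.
  by rewrite normr_normc -rmorphXn/= mul_realc/= mulrC.
- by move=> s cs; exact: mcont_resolvent.
- move=> s cs; rewrite /D /comp; under eq_fun do rewrite mxE.
  apply: ccontN; apply: (mcontM (mcontM _ _)); try exact: mcont_resolvent.
  exact: mcont_cst.
Qed.

Lemma small_mx_eq0 (X : 'M[C]_n) (K : R) :
  (forall r, c <= r -> forall i j, normc (X i j) <= K / r) -> X = 0.
Proof.
move=> XK; apply/matrixP => i j; rewrite mxE; apply: Normc.eq0_normc.
apply/eqP; rewrite eq_le normc_ge0 andbT; apply/ler_addgt0Pr => e e0; rewrite add0r.
pose r := Num.max c (`|K| / e).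
have r0 : 0 < r by rewrite lt_max c_gt0.
rewrite (le_trans (XK r _ i j)) ?le_max ?lexx// ler_pdivrMr//.
rewrite (le_trans (ler_norm _))// mulrC -ler_pdivrMr//.
by rewrite le_max lexx orbT.
Qed.

(** On the circle of radius [r] the integrand is at most [K / r], while its mean is the same for
    every [r]. *)
Lemma mavg_decay (F : C -> 'M[C]_n) (K : C) (X : 'M[C]_n) :
  (forall r, c <= r -> mcont (fun th => F (circ r th))) ->
  (forall r, c <= r -> mavg (fun th => F (circ r th)) = X) ->
  (forall l, c <= normc l -> nrm (l *: F l) <= K) -> X = 0.
Proof.
move=> Fc FX FK; apply: (@small_mx_eq0 _ (2 * complex.Re K)) => r cr i j.
have r0 : 0 < r by rewrite (lt_le_trans c_gt0).
rewrite -(FX _ cr) -mulrA; apply: mavg_bound => [|th]; first exact: Fc.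
rewrite ler_pdivlMr//.
have := le_trans (nrm_entry _ i j) (FK _ (circ_ge th cr)).
rewrite mxE => /lec_normc; rewrite Normc.normcM normc_circ ?(ltW r0)//.
by rewrite mulrC.
Qed.

Lemma resolvent_spectral_pair : spectral_pair A B P H.
Proof.
have circZ : mcont (fun th => circ c th *: S (circ c th)).
  exact: mcontZ (ccont_circ _) SC.
(* The right-hand side is bounded, so [A *m S l] decays like the inverse of [l]; this is what
   [mavg_decay] needs. *)
have ASK l : c <= normc l -> l *: (A *m S l) = 1%:M - B *m S l.
  move=> cl; rewrite -(mulVS cl) mulmxDl -scalemxAl addrK//.
have SAK l : c <= normc l -> l *: (S l *m A) = 1%:M - S l *m B.
  move=> cl; rewrite -(mulSV cl) mulmxDr -scalemxAr addrK//.
have AP : A *m P = 0.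
  apply: (@mavg_decay (fun l => A *m S l) (nrm (1%:M : 'M[C]_n) + nrm B * k)).
  - by move=> r cr; apply: mcontM; [exact: mcont_cst|exact: mcont_resolvent].
  - move=> r cr; rewrite mavg_mull; first by rewrite mavg_resolvent_cst.
    exact: mcont_resolvent.
  - move=> l cl; rewrite ASK// (le_trans (nrmB _ _))// lerD2l.
    by rewrite (le_trans (nrmM _ _))// ler_wpM2l ?nrm_ge0 ?S_bound.
have PA : P *m A = 0.
  apply: (@mavg_decay (fun l => S l *m A) (nrm (1%:M : 'M[C]_n) + k * nrm B)).
  - by move=> r cr; apply: mcontM; [exact: mcont_resolvent|exact: mcont_cst].
  - move=> r cr; rewrite mavg_mulr; first by rewrite mavg_resolvent_cst.
    exact: mcont_resolvent.
  - move=> l cl; rewrite SAK// (le_trans (nrmB _ _))// lerD2l.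
    by rewrite (le_trans (nrmM _ _))// ler_wpM2r ?nrm_ge0 ?S_bound.
have AHBP : A *m H + B *m P = 1%:M.
  rewrite -!mavg_mull// -mavgD; last 2 first.
  - exact: mcontM (mcont_cst _) circZ.
  - exact: mcontM (mcont_cst _) SC.
  rewrite -[RHS]mavg_cst; congr mavg; apply/funext => th.
  by rewrite -scalemxAr ASK ?circ_ge// subrK.
have HAPB : H *m A + P *m B = 1%:M.
  rewrite -!mavg_mulr// -mavgD; last 2 first.
  - exact: mcontM circZ (mcont_cst _).
  - exact: mcontM SC (mcont_cst _).
  rewrite -[RHS]mavg_cst; congr mavg; apply/funext => th.
  by rewrite -scalemxAl SAK ?circ_ge// subrK.
(* Average the resolvent identity over one of its two arguments. *)
have SBP l : c <= normc l -> S l *m B *m P = P.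
  move=> cl.
  have : mavg (fun th => S l - S (circ c th)) =
      mavg (fun th => S l *m A *m (circ c th *: S (circ c th)) -
                      (l *: (S l *m A)) *m S (circ c th)).
    congr mavg; apply/funext => th.
    by rewrite resolvent_identity ?circ_ge// scalerBl -scalemxAr -!scalemxAl.
  rewrite mavgD; [|exact: mcont_cst|by move=> i j; under eq_fun do rewrite mxE; exact: ccontN].
  rewrite mavgD; last 2 first.
  - exact: mcontM (mcont_cst _) circZ.
  - under eq_fun do rewrite -mulNmx; exact: mcontM (mcont_cst _) SC.
  rewrite mavg_cst mavgN// -/P mavgN; last exact: mcontM (mcont_cst _) SC.
  rewrite !mavg_mull// -/H -/P -scalemxAl -(mulmxA _ A P) AP !mulmx0 scaler0 subr0.
  (* Since [A P = 0], [E] reads [S l - P = S l A H], to be compared with [S l = S l (A H + B P)]. *)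
  move=> E; apply: (addrI (S l *m A *m H)).
  by rewrite -[in LHS]mulmxA -[S l *m B *m P]mulmxA -mulmxDr AHBP mulmx1 -E subrK.
have PBS l : c <= normc l -> P *m B *m S l = P.
  move=> cl.
  have : mavg (fun th => S (circ c th) - S l) =
      mavg (fun th => S (circ c th) *m (l *: (A *m S l)) -
                      (circ c th *: S (circ c th)) *m (A *m S l)).
    congr mavg; apply/funext => th.
    by rewrite resolvent_identity ?circ_ge// scalerBl -scalemxAr -!scalemxAl !mulmxA.
  rewrite mavgD; [|exact: SC|exact: mcont_cst].
  rewrite mavgD; last 2 first.
  - exact: mcontM SC (mcont_cst _).
  - under eq_fun do rewrite -mulmxN; exact: mcontM circZ (mcont_cst _).
  rewrite mavg_cst mavgN; last exact: mcontM circZ (mcont_cst _).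
  rewrite !mavg_mulr// -/H -/P -scalemxAr (mulmxA P) PA mul0mx scaler0 sub0r.
  move/eqP; rewrite subr_eq => /eqP E; apply: (addrI (H *m (A *m S l))).
  rewrite mulmxA -mulmxDl HAPB mul1mx.
  by rewrite [in RHS]E !mulmxA addrA subrr add0r.
split=> //; split.
- rewrite -mavg_mull// -[RHS]mavg_cst; congr mavg; apply/funext => th.
  by rewrite PBS// circ_ge.
(* Multiplying [SBP] by the point of the circle before averaging leaves the mean of a multiple of
   [P] that rotates once, which is 0. The next item does the same with [PBS]. *)
- rewrite -!mavg_mulr//; last exact: mcontM circZ (mcont_cst _).
  rewrite -(mavg_circ P c_gt0); congr mavg; apply/funext => th.
  by rewrite -!scalemxAl SBP// circ_ge.
- rewrite -mavg_mull// -(mavg_circ P c_gt0); congr mavg; apply/funext => th.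
  by rewrite -scalemxAr PBS// circ_ge.
Qed.

End Resolvent.

Section InverseBound.
Variable K : numFieldType.

(** In [Y = X + Y (M - N) X] the last term is at most [nrm Y / 2] and is absorbed on the left. Both
    inverses are given, so no Neumann series is summed. *)
Lemma nrm_inverse_perturb n (M N X Y : 'M[K]_n) :
  M *m X = 1%:M -> Y *m N = 1%:M -> nrm (M - N) * nrm X <= 2^-1 ->
  nrm Y <= 2 * nrm X.
Proof.
move=> MX YN small.
have E : Y = X + Y *m (M - N) *m X.
  by rewrite mulmxBr mulmxBl -mulmxA MX YN mulmx1 mul1mx addrC subrK.
have : nrm Y <= nrm X + nrm Y * 2^-1.
  rewrite {1}E (le_trans (nrmD _ _))// lerD2l (le_trans (nrmM _ _))//.
  rewrite (le_trans (ler_wpM2r (nrm_ge0 _) (nrmM _ _)))// -mulrA.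
  by rewrite ler_wpM2l ?nrm_ge0.
rewrite -lerBlDr -[X in X - _]mulr1 -mulrBr (_ : 1 - 2^-1 = 2^-1); last by field.
by rewrite ler_pdivrMr// mulrC.
Qed.

End InverseBound.

(** * The real matrices [Pinf] and [Hinf] attached to the pencil *)

Section PencilAtInfinity.
Variables (R : realType) (n : nat).
Local Notation C := R[i].
Local Notation normc := (@Normc.normc R).
Local Notation Re := (@complex.Re R).

Lemma nrm_cmx (M : 'M[R]_n) : nrm (cmx M) = (nrm M)%:C%C.
Proof.
rewrite /nrm rmorph_sum/=; apply: eq_bigr => i _; rewrite rmorph_sum/=.
by apply: eq_bigr => j _; rewrite mxE normr_normc normc_realc.
Qed.

Lemma cenorm_le (x : 'cV[C]_n) (k : R) : (forall i, normc (x i 0) <= k) ->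
  cenorm x <= Num.sqrt (n%:R * k ^+ 2).
Proof.
move=> xk; rewrite /cenorm ler_wsqrtr// mulr_natl -[X in _ *+ X]card_ord -sumr_const.
by rewrite ler_sum// => i _; rewrite lerXn2r ?nnegrE ?normc_ge0// (le_trans (normc_ge0 _) (xk i)).
Qed.

Lemma normc_le_cenorm (x : 'cV[C]_n) i : normc (x i 0) <= cenorm x.
Proof.
rewrite -[leLHS]ger0_norm ?normc_ge0// -sqrtr_sqr /cenorm ler_wsqrtr//.
by rewrite (bigD1 i)//= lerDl sumr_ge0// => j _; rewrite sqr_ge0.
Qed.

Lemma normc_sum (I : Type) (s : seq I) (F : I -> C) :
  normc (\sum_(i <- s) F i) <= \sum_(i <- s) normc (F i).
Proof.
elim: s => [|a s IH]; first by rewrite !big_nil (Normc.normc0 R).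
by rewrite !big_cons (le_trans (le_normcD _ _))// lerD2l.
Qed.

Lemma cenorm_delta j : cenorm (delta_mx j 0 : 'cV[C]_n) <= 1.
Proof.
have n1 : normc 1 = 1 by exact: Normc.normc1.
have n0 : normc 0 = 0 by exact: Normc.normc0.
rewrite /cenorm (bigD1 j)//= mxE !eqxx n1 expr1n big1 ?addr0 ?sqrtr1//.
by move=> i ij; rewrite mxE (negPf ij) n0 expr0n.
Qed.

(** An entry is a coordinate of the image of a unit vector. Since [copnorm] is a real [sup], which
    is meaningful only for sets bounded above, boundedness of the set is proved too. *)
Lemma normc_le_copnorm (M : 'M[C]_n) i j : normc (M i j) <= copnorm M.
Proof.
have -> : M i j = (M *m delta_mx j 0 : 'cV[C]_n) i 0.
  rewrite mxE (bigD1 j)//= mxE !eqxx mulr1 big1 ?addr0// => k kj.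
  by rewrite mxE (negPf kj)/= mulr0.
apply: (le_trans (normc_le_cenorm _ i)); apply: ub_le_sup; last first.
  by exists (delta_mx j 0) => //; exact: cenorm_delta.
exists (Num.sqrt (n%:R * Re (nrm M) ^+ 2)) => _ [x x1 <-].
apply: cenorm_le => k; rewrite mxE (le_trans (normc_sum _ _))//.
apply: (@le_trans _ _ (\sum_l normc (M k l))).
  apply: ler_sum => l _; rewrite Normc.normcM ler_piMr ?normc_ge0//.
  by rewrite (le_trans (normc_le_cenorm _ _)).
have : \sum_l `|M k l| <= nrm M.
  by rewrite /nrm [leRHS](bigD1 k)//= lerDl sumr_ge0// => a _; rewrite sumr_ge0.
under eq_bigr do rewrite normr_normc.
by rewrite -rmorph_sum/=; case: (nrm M) => a b /andP[].
Qed.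

Lemma nrm_entries_le m p (M : 'M[R]_(m, p)) (k : R) :
  (forall i j, `|M i j| <= k) -> nrm M <= (m * p)%:R * k.
Proof.
move=> Mk; rewrite /nrm (le_trans (_ : _ <= \sum_(i < m) \sum_(j < p) k))//.
  by rewrite ler_sum// => i _; rewrite ler_sum.
by rewrite !sumr_const !card_ord -mulrnA mulr_natl mulnC.
Qed.

Lemma nrm_centries_le (M : 'M[C]_n) (k : R) :
  (forall i j, normc (M i j) <= k) -> nrm M <= ((n * n)%:R * k)%:C%C.
Proof.
move=> Mk; rewrite /nrm (le_trans (_ : _ <= \sum_(i < n) \sum_(j < n) k%:C%C))//.
  by rewrite ler_sum// => i _; rewrite ler_sum// => j _; rewrite normr_normc lecR.
by rewrite !sumr_const !card_ord -mulrnA -rmorphMn/= mulr_natl.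
Qed.

Variables (A B : R -> 'M[R]_n) (C2 : R -> R).
Local Notation S t := (fun l => invmx (pencil A B t l)).

(** For a real pencil the contour means turn out to be real ([real_means]), so taking the real part
    loses nothing. *)
Definition Pinf (t : R) : 'M[R]_n :=
  map_mx Re (mavg (fun th => S t (circ (C2 t) th))).

Definition Hinf (t : R) : 'M[R]_n :=
  map_mx Re (mavg (fun th => circ (C2 t) th *: S t (circ (C2 t) th))).

Section FixedTime.
Variables (t k : R).
Hypothesis C2_gt0 : 0 < C2 t.
Hypothesis S_bound : forall l, C2 t <= normc l ->
  pencil A B t l \in unitmx /\ nrm (S t l) <= k%:C%C.

Let SC : mcont (fun th => S t (circ (C2 t) th)).
Proof.
apply: (@mcont_resolvent R n (cmx (A t)) (cmx (B t)) (C2 t) k%:C%C (S t)) => //.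
- by move=> l /S_bound[u _]; exact: mulmxV.
- by move=> l /S_bound[u _]; exact: mulVmx.
- by move=> l /S_bound[].
Qed.

Let circSC : mcont (fun th => circ (C2 t) th *: S t (circ (C2 t) th)).
Proof. exact: mcontZ (ccont_circ _) SC. Qed.

Let cpair : spectral_pair (cmx (A t)) (cmx (B t))
  (mavg (fun th => S t (circ (C2 t) th)))
  (mavg (fun th => circ (C2 t) th *: S t (circ (C2 t) th))).
Proof.
apply: (@resolvent_spectral_pair R n _ _ _ k%:C%C) => //.
- by move=> l /S_bound[u _]; exact: mulmxV.
- by move=> l /S_bound[u _]; exact: mulVmx.
- by move=> l /S_bound[].
Qed.

(* The complex conjugate of a spectral pair of a real pencil is again one, so by
   uniqueness the contour means are real. *)
Let real_means :
  cmx (Pinf t) = mavg (fun th => S t (circ (C2 t) th)) /\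
  cmx (Hinf t) = mavg (fun th => circ (C2 t) th *: S t (circ (C2 t) th)).
Proof.
have [AP PA AHBP HAPB [PBP HBP PBH]] := cpair.
rewrite /Pinf /Hinf; move: AP PA AHBP HAPB PBP HBP PBH (cpair).
set P := mavg _; set H := mavg (fun th => _ *: _).
move=> AP PA AHBP HAPB PBP HBP PBH PH.
pose cj := map_mx (@conjc R) : 'M[C]_n -> 'M[C]_n.
have cjr (M : 'M[R]_n) : cj (cmx M) = cmx M.
  by apply/matrixP => i j; rewrite !mxE; apply/eqP; rewrite eq_complex/= oppr0 !eqxx.
have cjM (M N : 'M[C]_n) : cj (M *m N) = cj M *m cj N by exact: map_mxM.
have cjD (M N : 'M[C]_n) : cj (M + N) = cj M + cj N by exact: map_mxD.
have cj0 : cj 0 = 0 by exact: map_mx0.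
have cj1 : cj 1%:M = 1%:M by exact: map_mx1.
have PH' : spectral_pair (cmx (A t)) (cmx (B t)) (cj P) (cj H).
  split; last split.
  - by rewrite -{1}(cjr (A t)) -cjM AP.
  - by rewrite -{1}(cjr (A t)) -cjM PA.
  - by rewrite -{1}(cjr (A t)) -{1}(cjr (B t)) -!cjM -cjD AHBP.
  - by rewrite -{1}(cjr (A t)) -{1}(cjr (B t)) -!cjM -cjD HAPB.
  - by rewrite -{1}(cjr (B t)) -!cjM PBP.
  - by rewrite -{1}(cjr (B t)) -!cjM HBP.
  - by rewrite -{1}(cjr (B t)) -!cjM PBH.
have [EP EH] := spectral_pair_unique PH' PH.
have real (M : 'M[C]_n) : cj M = M -> cmx (map_mx Re M) = M.
  move=> /matrixP cM; apply/matrixP => i j; have := cM i j; rewrite !mxE.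
  case: (M i j) => a b [] /eqP; rewrite -subr_eq0 -opprD oppr_eq0 -mulr2n.
  by rewrite mulrn_eq0/= => /eqP ->.
by split; apply: real.
Qed.

Lemma Pinf_Hinf_spectral_pair : spectral_pair (A t) (B t) (Pinf t) (Hinf t).
Proof.
have := cpair; have [<- <-] := real_means.
have inj (M N : 'M[R]_n) : cmx M = cmx N -> M = N.
  by move=> /matrixP MN; apply/matrixP => i j; have := MN i j; rewrite !mxE => -[].
have cM (M N : 'M[R]_n) : cmx (M *m N) = cmx M *m cmx N by exact: map_mxM.
have cD (M N : 'M[R]_n) : cmx (M + N) = cmx M + cmx N by exact: map_mxD.
have c0 : cmx (0 : 'M[R]_n) = 0 by exact: map_mx0.
have c1 : cmx (1%:M : 'M[R]_n) = 1%:M by exact: map_mx1.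
rewrite /spectral_pair -!cM -!cD -c0 -c1.
by move=> [/inj ? /inj ? /inj ? /inj ? [/inj ? /inj ? /inj ?]]; split.
Qed.

(** On the circle [d lambda = 'i lambda d theta], and the ['i] cancels against that of the
    prefactor: a contour integral of [F] is the mean of [lambda F]. *)
Lemma contour_mxE (F : C -> 'M[C]_n) : mcont (fun th => F (circ (C2 t) th)) ->
  contour_mx C2 t F = mavg (fun th => circ (C2 t) th *: F (circ (C2 t) th)).
Proof.
move=> cF; apply/matrixP => i j; rewrite mavgE !mxE.
have -> : circle_integral (C2 t) (fun l => F l i j) =
    cint (fun th => 'i%C * (circ (C2 t) th *: F (circ (C2 t) th)) i j).
  have mC (x y z : C) : x * (y * z) = y * (z * x) by ring.
  by congr cint; apply/funext => th; rewrite mxE; exact: mC.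
rewrite cintZ; last exact: mcontZ (ccont_circ _) cF i j.
rewrite mulrA; congr (_ * _).
have i0 : 'i%C != 0 :> C by rewrite eq_complex/= oner_eq0 andbF.
have p0 : 2 * pi%:C%C != 0 :> C.
  by rewrite mulf_neq0// ?pnatr_eq0// eq_complex/= gt_eqF// pi_gt0.
rewrite invfM divfK// rmorphV ?unitfE ?gt_eqF ?pi2_gt0//.
by rewrite rmorphM rmorph_nat.
Qed.

Lemma P1E : P1 A B C2 t = Hinf t *m A t.
Proof.
have [_ HE] := real_means.
have -> : Hinf t *m A t = map_mx Re (cmx (Hinf t *m A t)).
  by apply/matrixP => i j; rewrite !mxE.
have -> : cmx (Hinf t *m A t) = cmx (Hinf t) *m cmx (A t) by exact: map_mxM.
rewrite HE -mavg_mulr// /P1 contour_mxE; last exact: mcontM SC (mcont_cst _).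
by congr (map_mx _ (mavg _)); apply/funext => th; rewrite scalemxAl.
Qed.

Lemma Q1E : Q1 A B C2 t = A t *m Hinf t.
Proof.
have [_ HE] := real_means.
have -> : A t *m Hinf t = map_mx Re (cmx (A t *m Hinf t)).
  by apply/matrixP => i j; rewrite !mxE.
have -> : cmx (A t *m Hinf t) = cmx (A t) *m cmx (Hinf t) by exact: map_mxM.
rewrite HE -mavg_mull// /Q1 contour_mxE; last exact: mcontM (mcont_cst _) SC.
by congr (map_mx _ (mavg _)); apply/funext => th; rewrite scalemxAr.
Qed.

Lemma P2E : P2 A B C2 t = Pinf t *m B t.
Proof.
have [_ _ _ E _] := Pinf_Hinf_spectral_pair.
by rewrite /P2 P1E -E addrC addKr.
Qed.

Lemma Q2E : Q2 A B C2 t = B t *m Pinf t.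
Proof.
have [_ _ E _ _] := Pinf_Hinf_spectral_pair.
by rewrite /Q2 Q1E -E addrC addKr.
Qed.

Lemma GinvE : Ginv A B C2 t = Pinf t + Hinf t.
Proof.
have [AP PA AHBP HAPB [PBP HBP PBH]] := Pinf_Hinf_spectral_pair.
rewrite /Ginv /G P2E; set M := _ + _.
have LM : (Pinf t + Hinf t) *m M = 1%:M.
  rewrite mulmxDl !mulmxDr !mulmxA PA add0r PBP.
  by rewrite HBP mul0mx addr0 addrC HAPB.
have [_ uM] := mulmx1_unit LM.
by rewrite -[LHS]mul1mx -LM -mulmxA mulmxV// mulmx1.
Qed.

Lemma nrm_Pinf_Hinf_le (a : R) :
  (forall th, nrm (S t (circ (C2 t) th)) <= a%:C%C) ->
  nrm (Pinf t) <= (n * n)%:R * (2 * a) /\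
  nrm (Hinf t) <= (n * n)%:R * (2 * (C2 t * a)).
Proof.
move=> Sa; split; apply: nrm_entries_le => i j; rewrite mxE;
  apply: (le_trans (normc_ge_absRe _)); apply: mavg_bound => // th.
  by have := le_trans (nrm_entry _ i j) (Sa th) => /lec_normc.
rewrite mxE Normc.normcM normc_circ ?(ltW C2_gt0)// ler_wpM2l ?(ltW C2_gt0)//.
by have := le_trans (nrm_entry _ i j) (Sa th) => /lec_normc.
Qed.

End FixedTime.

(** The conclusion involves [k] only, not [k']: the bound at time [t] is replaced by [2 k] through
    [nrm_inverse_perturb]. The two circles have different radii, so the pencils are compared at
    equal angles, where they differ by a unit multiple of the increment of [C2 A] plus the increment
    of [B]. *)
Lemma Pinf_Hinf_local_bound (s t k k' : R) : 0 < C2 s -> 0 < C2 t ->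
  (forall l, C2 s <= normc l ->
     pencil A B s l \in unitmx /\ nrm (S s l) <= k%:C%C) ->
  (forall l, C2 t <= normc l ->
     pencil A B t l \in unitmx /\ nrm (S t l) <= k'%:C%C) ->
  (nrm (C2 t *: A t - C2 s *: A s) + nrm (B t - B s)) * k <= 2^-1 ->
  nrm (Pinf t) <= (n * n)%:R * (2 * (2 * k)) /\
  nrm (Hinf t) <= (n * n)%:R * (2 * (C2 t * (2 * k))).
Proof.
move=> s0 t0 Ss St small; apply: (nrm_Pinf_Hinf_le t0 St) => th.
have /Ss[us bs] : C2 s <= normc (circ (C2 s) th) by rewrite normc_circ ?(ltW s0).
have /St[ut _] : C2 t <= normc (circ (C2 t) th) by rewrite normc_circ ?(ltW t0).
apply: (le_trans (nrm_inverse_perturb (mulmxV us) (mulVmx ut) _)); last first.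
  by rewrite rmorphM rmorph_nat ler_wpM2l.
have E : pencil A B s (circ (C2 s) th) - pencil A B t (circ (C2 t) th) =
    circ 1 th *: cmx (C2 s *: A s - C2 t *: A t) + cmx (B s - B t).
  have circE r : circ r th = circ 1 th * r%:C%C.
    by rewrite mulrC mul_realc /circ/= !mul1r.
  rewrite /pencil circE (circE (C2 t)).
  apply/matrixP => i j; rewrite !mxE !(rmorphB, rmorphM)/=; ring.
have C1 : `|circ 1 th| = 1 :> C by rewrite normr_normc normc_circ.
apply: (@le_trans _ _ ((nrm (C2 t *: A t - C2 s *: A s) + nrm (B t - B s))%:C%C * k%:C%C)).
  apply: ler_pM; rewrite ?nrm_ge0// E (le_trans (nrmD _ _))// nrmZ C1 mul1r.
  by rewrite !nrm_cmx -rmorphD/= lecR nrmBC [X in _ + X]nrmBC.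
rewrite -rmorphM (_ : 2^-1 = (2^-1)%:C%C) ?lecR//.
by rewrite rmorphV ?unitfE ?pnatr_eq0// rmorph_nat.
Qed.

End PencilAtInfinity.

(** * Calculus on intervals *)

Section Calculus.
Variable R : realType.

Lemma nrm_ge_norm m p (M : 'M[R]_(m, p)) : `|M| <= nrm M.
Proof.
rewrite -[leLHS]/(mx_norm M) mx_normrE; apply/bigmax_leP; split.
  exact: nrm_ge0.
by move=> i _; exact: nrm_entry.
Qed.

Lemma entry_le_norm m p (M : 'M[R]_(m, p)) i j : `|M i j| <= `|M|.
Proof.
rewrite -[leRHS]/(mx_norm M) mx_normrE.
by apply: (@le_bigmax _ _ _ 0 (fun ij => `|M ij.1 ij.2|) (i, j)).
Qed.

Lemma nrm_le_norm m p (M : 'M[R]_(m, p)) : nrm M <= (m * p)%:R * `|M|.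
Proof. by apply: nrm_entries_le => i j; exact: entry_le_norm. Qed.

Lemma within_eps_cont (W : normedModType R) (I : set R) (g : R -> W) :
  {within I, continuous g} -> forall s, I s -> forall e : R, 0 < e ->
  exists2 d : R, 0 < d & forall r, I r -> `|r - s| <= d -> `|g r - g s| <= e.
Proof.
move=> /subspace_continuousP gc s Is e e0.
have := gc s Is => /cvgrPdist_le/(_ _ e0).
rewrite /prop_near1 /within/= => -[d/= d0 H]; exists (d / 2); first by rewrite divr_gt0.
move=> r Ir rs; rewrite distrC; apply: H => //=.
by rewrite distrC (le_lt_trans rs)// ltr_pdivrMr// mulr2n mulrDr mulr1 ltrDl.
Qed.

Lemma within_prod_eps_cont (V W : normedModType R) (I : set R) (g : R * V -> W) :
  {within I `*` setT, continuous g} -> forall s y, I s -> forall e : R, 0 < e ->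
  exists2 d : R, 0 < d & forall r z, I r -> `|r - s| <= d -> `|z - y| <= d ->
    `|g (r, z) - g (s, y)| <= e.
Proof.
move=> /subspace_continuousP gc s y Is e e0.
have := gc (s, y) (conj Is Logic.I) => /cvgrPdist_le/(_ _ e0).
rewrite /prop_near1 /within/= => -[[U V']/= []].
move=> /nbhs_normP[d/= d0 H] /nbhs_normP[d'/= d'0 H'] UV.
exists (Num.min d d' / 2); first by rewrite divr_gt0// lt_min d0.
move=> r z Ir rs zy; rewrite distrC; apply: UV => //; split=> /=.
  apply: H => /=; rewrite distrC (le_lt_trans rs)// ltr_pdivrMr//.
  by rewrite gt_min mulr2n mulrDr mulr1 ltrDl d0.
apply: H' => /=; rewrite distrC (le_lt_trans zy)// ltr_pdivrMr//.
by rewrite gt_min !mulr_natr !mulr2n !ltrDl d'0 orbT.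
Qed.

(** The remainder form restricts to subsets and adds up without any discussion of limits;
    [has_deriv_on_eq] links it back to [deriv_on]. *)
Definition has_deriv (W : normedModType R) (J : set R) (g : R -> W) (t : R) (d : W) :=
  forall e : R, 0 < e -> exists2 a : R, 0 < a & forall s, J s -> `|s - t| <= a ->
    `|g s - g t - (s - t) *: d| <= e * `|s - t|.

Lemma derivable_on_has_deriv (W : normedModType R) (J : set R) (g : R -> W) t :
  derivable_on J g t -> has_deriv J g t (deriv_on J g t).
Proof.
move=> H e e0; move/cvgrPdist_le : H => /(_ _ e0).
rewrite /prop_near1 /within/= /dnbhs/= /within/= => -[d/= d0 H].
exists (d / 2); first by rewrite divr_gt0.
move=> s Js sd; have [->|st] := eqVneq s t; first by rewrite !subrr scale0r subr0 !normr0 mulr0.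
have st0 : s - t != 0 by rewrite subr_eq0.
have sb : `|t - s| < d.
  by rewrite distrC (le_lt_trans sd)// ltr_pdivrMr// mulr2n mulrDr mulr1 ltrDl.
have := H s sb st Js; rewrite distrC -[deriv_on _ _ _]/(lim _) => {}H.
rewrite -[g s - g t]scale1r -(mulfV st0) -scalerA -scalerBr normrZ mulrC.
by rewrite ler_wpM2r.
Qed.

Lemma has_deriv_cvg (W : normedModType R) (J : set R) (g : R -> W) t d :
  has_deriv J g t d -> dquot g t @ within J t^' --> d.
Proof.
move=> H; apply/cvgrPdist_le => e e0; have [a a0 Ha] := H e e0.
rewrite /prop_near1 /within/= /dnbhs/= /within/=; exists a => // s /= sa st Js.
have st0 : s - t != 0 by rewrite subr_eq0.
rewrite distrC /dquot -[d]scale1r -(mulVf st0) -scalerA -scalerBr normrZ normfV.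
by rewrite ler_pdivrMl ?normr_gt0// mulrC Ha// distrC ltW.
Qed.

Lemma has_deriv_subset (W : normedModType R) (I J : set R) (g : R -> W) t d :
  I `<=` J -> has_deriv J g t d -> has_deriv I g t d.
Proof.
move=> IJ H e /H[a a0 Ha]; exists a => // s /IJ; exact: Ha.
Qed.

(** Points of [J] close to [t] are found to its right, or to its left when [t = b]. Properness makes
    [deriv_on] a genuine limit at endpoints too. *)
Lemma within_dnbhs_proper (J : set R) (a b t : R) : a < b -> `[a, b] `<=` J ->
  a <= t <= b -> ProperFilter (within J t^').
Proof.
move=> ab IJ /andP[at_ tb]; apply: Build_ProperFilter_ex => P.
rewrite /within/= /dnbhs/= /within/= => -[d/= d0 H].
have [tb'|bt] := ltP t b.
  exists (t + Num.min (d / 2) (b - t)).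
  have m0 : 0 < Num.min (d / 2) (b - t) by rewrite lt_min divr_gt0//= subr_gt0.
  apply: H => /=.
  - rewrite opprD addNKr normrN gtr0_norm// gt_min ltr_pdivrMr//.
    by rewrite mulr2n mulrDr mulr1 ltrDl d0.
  - by rewrite -subr_eq0 addrAC subrr add0r gt_eqF.
  - apply: IJ; rewrite /= in_itv/= (le_trans at_) ?lerDl ?(ltW m0)//=.
    by rewrite -lerBrDl ge_min lexx orbT.
have {tb bt} tE : t = b by apply/eqP; rewrite eq_le tb.
exists (t - Num.min (d / 2) (t - a)).
have m0 : 0 < Num.min (d / 2) (t - a) by rewrite lt_min divr_gt0//= subr_gt0 tE.
apply: H => /=.
- rewrite opprD opprK addrA subrr add0r gtr0_norm// gt_min ltr_pdivrMr//.
  by rewrite mulr2n mulrDr mulr1 ltrDl d0.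
- by rewrite -subr_eq0 addrAC subrr add0r oppr_eq0 gt_eqF.
- apply: IJ; rewrite /= in_itv/= lerBrDl -lerBrDr ge_min.
  by rewrite lexx orbT/= -tE lerBlDr lerDl ltW.
Qed.

Lemma has_deriv_on_eq (W : normedModType R) (J : set R) (g : R -> W) (a b t : R) d :
  a < b -> `[a, b] `<=` J -> a <= t <= b -> has_deriv J g t d ->
  deriv_on J g t = d.
Proof.
move=> ab IJ tab H; have PF := within_dnbhs_proper ab IJ tab.
by apply: cvg_lim => //; exact: has_deriv_cvg.
Qed.

(** The mean value theorem holds for scalar functions, so it is applied to each entry; summing the
    entries produces the factor [m * p]. *)
Lemma has_deriv_mean_value m p (g dg : R -> 'M[R]_(m, p)) (c : 'M[R]_(m, p))
    (a b k : R) : a <= b ->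
  (forall t, a <= t <= b -> has_deriv `[a, b] g t (dg t)) ->
  (forall t, a <= t <= b -> nrm (dg t - c) <= k) ->
  nrm (g b - g a - (b - a) *: c) <= (m * p)%:R * (k * (b - a)).
Proof.
move=> ab gd gk; apply: nrm_entries_le => i j; rewrite !mxE [_ * c i j]mulrC.
pose f t := g t i j; pose df t := dg t i j.
have fd t : a <= t <= b -> forall e : R, 0 < e -> exists2 d : R, 0 < d &
    forall s, a <= s <= b -> `|s - t| <= d -> `|f s - f t - (s - t) * df t| <= e * `|s - t|.
  move=> tab e /(gd t tab)[d d0 H]; exists d => // s sab sd.
  apply: (le_trans _ (H s _ sd)); last by rewrite /= in_itv.
  by apply: le_trans (entry_le_norm _ i j); rewrite !mxE.
apply: (@mean_value_bound R f df) => //.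
- move=> x; rewrite in_itv/= => /andP[ax xb].
  have lim : (fun h => h^-1 *: ((f \o shift x) (h *: 1) - f x)) @ 0^' --> df x.
    apply/cvgrPdist_le => e e0.
    have xab : a <= x <= b by rewrite !ltW.
    have [d d0 H] := fd x xab e e0.
    near=> h.
    have h0 : h != 0 by near: h; exact: nbhs_dnbhs_neq.
    have hd : `|h| <= d by near: h; exact: dnbhs0_le.
    have hab : `|h| <= Num.min (x - a) (b - x).
      by near: h; apply: dnbhs0_le; rewrite lt_min !subr_gt0 ax.
    have /(H _) : a <= h + x <= b.
      move: hab; rewrite le_min => /andP[]; rewrite !ler_norml => /andP[h1 _] /andP[_ h2].
      by apply/andP; split; lra.
    rewrite addrK => /(_ hd) {}H.
    rewrite distrC /= scaler1.
    have -> : h^-1 *: (f (h + x) - f x) - df x = h^-1 * (f (h + x) - f x - h * df x).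
      by rewrite mulrBr mulKf.
    by rewrite normrM normfV ler_pdivrMl ?normr_gt0// [leRHS]mulrC.
  split; first by apply/cvg_ex; exists (df x).
  by rewrite /derive; apply/cvg_lim.
- apply/subspace_continuousP => x /=; rewrite in_itv/= => xab.
  apply/cvgrPdist_le => e e0; have [d d0 H] := fd x xab 1 ltr01.
  pose q := e / (1 + `|df x|).
  have q0 : 0 < q by rewrite divr_gt0// ltr_wpDr.
  rewrite /prop_near1 /within/=; exists (Num.min d q); first by rewrite /= lt_min d0.
  move=> s /=; rewrite lt_min distrC => /andP[sd sq]; rewrite in_itv/= => sab.
  rewrite distrC -[f s - f x](subrK ((s - x) * df x)) (le_trans (ler_normD _ _))//.
  rewrite (le_trans (lerD (H s sab (ltW sd)) (lexx _)))// normrM -[_ * `|df x|]mulrC -mulrDl.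
  by rewrite mulrC -ler_pdivlMr ?ltr_wpDr// ltW.
- move=> x; rewrite in_itv/= => /andP[ax xb].
  have xab : a <= x <= b by rewrite !ltW.
  by have := le_trans (nrm_entry _ i j) (gk x xab); rewrite !mxE.
Unshelve. all: by end_near. Qed.

(** Compactness in the form of a near-covering property, with the bound [M] going to infinity as
    parameter; [segment_uniform] is the same with a radius going to 0. *)
Lemma segment_bounded (a b : R) (g : R -> R) :
  (forall s, a <= s <= b -> exists M, exists2 d, 0 < d &
     forall r, a <= r <= b -> `|r - s| <= d -> g r <= M) ->
  exists M, forall s, a <= s <= b -> g s <= M.
Proof.
move=> H.
have /compact_near_coveringP/near_covering_withinP := @segment_compact R a b.
move=> /(_ R +oo (fun M s => g s <= M) _)[].
  move=> s /=; rewrite in_itv/= => /H[M [d d0 Hd]].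
  near=> r M'; rewrite in_itv/= => rab.
  apply: (@le_trans _ _ M); last by near: M'; apply: nbhs_pinfty_ge; exact: num_real.
  apply: Hd; first by [].
  rewrite distrC; near: r.
  by exists d => // r /= /ltW.
move=> M [_ /(_ (M + 1))]; rewrite ltrDl => /(_ ltr01) HM.
by exists (M + 1) => s sab; apply: HM; rewrite /= in_itv.
Unshelve. all: by end_near. Qed.

Lemma segment_uniform (a b : R) (P : R -> R -> Prop) :
  (forall d d' s, 0 < d' <= d -> P d s -> P d' s) ->
  (forall s, a <= s <= b -> exists2 d, 0 < d &
     forall r, a <= r <= b -> `|r - s| <= d -> P d r) ->
  exists2 d, 0 < d & forall s, a <= s <= b -> P d s.
Proof.
move=> Pmono H.
have /compact_near_coveringP/near_covering_withinP := @segment_compact R a b.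
move=> /(_ R 0^'+ P _)[].
  move=> s /=; rewrite in_itv/= => /H[d d0 Hd].
  near=> r d'; rewrite in_itv/= => rab.
  apply: (Pmono d).
    apply/andP; split; first by near: d'; exact: nbhs_right_gt.
    by near: d'; exact: nbhs_right_le.
  apply: Hd; first by [].
  rewrite distrC; near: r.
  by exists d => // r /= /ltW.
move=> d/= d0 HP; exists (d / 2); first by rewrite divr_gt0.
have d2 : 0 < d / 2 by rewrite divr_gt0.
move=> s sab; apply: HP; rewrite /= ?in_itv//.
rewrite sub0r normrN gtr0_norm// ltr_pdivrMr//.
by rewrite mulr2n mulrDr mulr1 ltrDl.
Unshelve. all: by end_near. Qed.

End Calculus.

(** * Uniform big-O estimates *)

Section UniformBigO.
Variables (R : realType) (T : Type).
Implicit Types (D : T -> Prop) (g h : T -> R).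

(** One constant serves on all of [D], and no filter is involved. With [T] a type of pairs of times
    and a rate such as [|x.1 - x.2|], Lipschitz bounds and Taylor remainders become instances of the
    same calculus. *)
Definition OO D m p (F : T -> 'M[R]_(m, p)) g : Prop :=
  exists2 c : R, 0 <= c & forall x, D x -> nrm (F x) <= c * g x.

Lemma OO_ext D m p (F G : T -> 'M[R]_(m, p)) g :
  (forall x, D x -> F x = G x) -> OO D G g -> OO D F g.
Proof. by move=> FG [c c0 H]; exists c => // x Dx; rewrite FG// H. Qed.

Lemma OO_le D m p (F : T -> 'M[R]_(m, p)) g h (c : R) : 0 <= c ->
  (forall x, D x -> g x <= c * h x) -> OO D F g -> OO D F h.
Proof.
move=> c0 gh [d d0 H]; exists (d * c); first exact: mulr_ge0.
by move=> x Dx; rewrite (le_trans (H x Dx))// -mulrA ler_wpM2l// gh.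
Qed.

Lemma OO_weak D m p (F : T -> 'M[R]_(m, p)) g h :
  (forall x, D x -> g x <= h x) -> OO D F g -> OO D F h.
Proof. by move=> gh; apply: (@OO_le _ _ _ _ _ _ 1) => // x /gh; rewrite mul1r. Qed.

Lemma OO_sub D D' m p (F : T -> 'M[R]_(m, p)) g :
  (forall x, D' x -> D x) -> OO D F g -> OO D' F g.
Proof. by move=> DD [c c0 H]; exists c => // x /DD; exact: H. Qed.

Lemma OO_add D m p (F G : T -> 'M[R]_(m, p)) g :
  OO D F g -> OO D G g -> OO D (fun x => F x + G x) g.
Proof.
move=> [c c0 F1] [d d0 G1]; exists (c + d); first exact: addr_ge0.
by move=> x Dx; rewrite (le_trans (nrmD _ _))// mulrDl lerD ?F1 ?G1.
Qed.

Lemma OO_opp D m p (F : T -> 'M[R]_(m, p)) g : OO D F g -> OO D (fun x => - F x) g.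
Proof. by move=> [c c0 F1]; exists c => // x Dx; rewrite nrmN F1. Qed.

Lemma OO_subr D m p (F G : T -> 'M[R]_(m, p)) g :
  OO D F g -> OO D G g -> OO D (fun x => F x - G x) g.
Proof. by move=> F1 G1; apply: OO_add => //; exact: OO_opp. Qed.

Lemma OO_mul D m p q (F : T -> 'M[R]_(m, p)) (G : T -> 'M[R]_(p, q)) g h :
  OO D F g -> OO D G h -> OO D (fun x => F x *m G x) (fun x => g x * h x).
Proof.
move=> [c c0 F1] [d d0 G1]; exists (c * d); first exact: mulr_ge0.
move=> x Dx; rewrite (le_trans (nrmM _ _))// mulrACA.
by rewrite ler_pM ?nrm_ge0 ?F1 ?G1.
Qed.

Lemma OO_bmul D m p q (F : T -> 'M[R]_(m, p)) (G : T -> 'M[R]_(p, q)) g :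
  OO D F (fun=> 1) -> OO D G g -> OO D (fun x => F x *m G x) g.
Proof.
move=> F1 G1; apply: OO_weak (OO_mul F1 G1) => x _; by rewrite mul1r.
Qed.

Lemma OO_mulb D m p q (F : T -> 'M[R]_(m, p)) (G : T -> 'M[R]_(p, q)) g :
  OO D F g -> OO D G (fun=> 1) -> OO D (fun x => F x *m G x) g.
Proof.
move=> F1 G1; apply: OO_weak (OO_mul F1 G1) => x _; by rewrite mulr1.
Qed.

Lemma OO_scale D m p (a : T -> R) (F : T -> 'M[R]_(m, p)) g :
  OO D F g -> OO D (fun x => a x *: F x) (fun x => `|a x| * g x).
Proof.
move=> [c c0 F1]; exists c => // x Dx; rewrite nrmZ mulrCA ler_wpM2l//.
exact: F1.
Qed.

End UniformBigO.

Lemma OO_comp (R : realType) (T T' : Type) (phi : T' -> T) (D : T -> Prop)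
    (D' : T' -> Prop) m p (F : T -> 'M[R]_(m, p)) g :
  (forall x, D' x -> D (phi x)) -> OO D F g ->
  OO D' (fun x => F (phi x)) (fun x => g (phi x)).
Proof. by move=> DD [c c0 H]; exists c => // x /DD; exact: H. Qed.

(** * Lipschitz families of matrices, Taylor remainders and little-o *)

Section SmoothFamilies.
Variable R : realType.

Definition in_seg (a b : R) (s : R) : Prop := a <= s <= b.

Definition in_seg2 (a b : R) (x : R * R) : Prop := in_seg a b x.1 /\ in_seg a b x.2.

Definition lip_on m p (a b : R) (g : R -> 'M[R]_(m, p)) : Prop :=
  OO (in_seg2 a b) (fun x => g x.1 - g x.2) (fun x => `|x.1 - x.2|).

Definition bnd_on m p (a b : R) (g : R -> 'M[R]_(m, p)) : Prop :=
  OO (in_seg a b) g (fun=> 1).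

Lemma lip_bnd_on m p (a b : R) (g : R -> 'M[R]_(m, p)) : a <= b ->
  lip_on a b g -> bnd_on a b g.
Proof.
move=> ab [c c0 H]; exists (nrm (g a) + c * (b - a)).
  by rewrite addr_ge0 ?nrm_ge0// mulr_ge0 ?subr_ge0.
move=> s sab; have /andP[as_ sb] := sab; rewrite mulr1 -[g s](subrK (g a)) addrC (le_trans (nrmD _ _))// lerD2l.
have sa2 : in_seg2 a b (s, a) by split=> //=; rewrite /in_seg lexx.
rewrite (le_trans (H _ sa2))//= ler_wpM2l// ger0_norm ?subr_ge0//.
by rewrite lerD2r.
Qed.

Lemma bnd_on1 m p (a b : R) (g : R -> 'M[R]_(m, p)) : bnd_on a b g ->
  OO (in_seg2 a b) (fun x => g x.1) (fun=> 1).
Proof. by apply: OO_comp => x []. Qed.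

Lemma bnd_on2 m p (a b : R) (g : R -> 'M[R]_(m, p)) : bnd_on a b g ->
  OO (in_seg2 a b) (fun x => g x.2) (fun=> 1).
Proof. by apply: OO_comp => x []. Qed.

Lemma lip_on_mul m p q (a b : R) (F : R -> 'M[R]_(m, p)) (G : R -> 'M[R]_(p, q)) :
  bnd_on a b F -> bnd_on a b G -> lip_on a b F -> lip_on a b G ->
  lip_on a b (fun t => F t *m G t).
Proof.
move=> bF bG lF lG.
apply: (@OO_ext _ _ _ _ _ _ (fun x => F x.1 *m (G x.1 - G x.2) + (F x.1 - F x.2) *m G x.2)).
  by move=> x _; rewrite mulmxBr mulmxBl addrA subrK.
apply: OO_add; first exact: OO_bmul (bnd_on1 bF) lG.
exact: OO_mulb lF (bnd_on2 bG).
Qed.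

Lemma has_deriv_lip m p (a b : R) (g dg : R -> 'M[R]_(m, p)) :
  (forall t, a <= t <= b -> has_deriv `[a, b] g t (dg t)) ->
  bnd_on a b dg -> lip_on a b g.
Proof.
move=> gd [K K0 gK]; exists ((m * p)%:R * K); first by rewrite mulr_ge0.
suff H s t : a <= s -> s <= t -> t <= b -> nrm (g t - g s) <= (m * p)%:R * K * (t - s).
  move=> [t s] [/andP[/= at_ tb] /andP[/= as_ sb]].
  have [st|ts] := leP s t; first by rewrite ger0_norm ?subr_ge0// H.
  by rewrite nrmBC ltr0_norm ?subr_lt0// opprB H// ltW.
move=> as_ st tb; rewrite -mulrA -[g t - g s]subr0 -(scaler0 _ (t - s)).
apply: (has_deriv_mean_value st (dg := dg)) => r /andP[sr rt].
  apply: (@has_deriv_subset _ _ _ `[a, b]).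
    move=> u /=; rewrite !in_itv/= => /andP[su ut].
    by rewrite (le_trans as_)//= (le_trans ut).
  by apply: gd; rewrite (le_trans as_)//= (le_trans rt).
by rewrite subr0 -[K]mulr1 gK// /in_seg (le_trans as_)//= (le_trans rt).
Qed.

Definition forward (a b : R) (x : R * R) : Prop := [/\ a <= x.1, x.1 <= x.2 & x.2 <= b].

(** A Lipschitz derivative suffices for a second-order remainder: on the segment it stays within
    [K (x.2 - x.1)] of its value at the left end. *)
Lemma has_deriv_taylor m p (a b : R) (g dg : R -> 'M[R]_(m, p)) :
  (forall t, a <= t <= b -> has_deriv `[a, b] g t (dg t)) -> lip_on a b dg ->
  OO (forward a b) (fun x => g x.2 - g x.1 - (x.2 - x.1) *: dg x.1)
    (fun x => (x.2 - x.1) ^+ 2).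
Proof.
move=> gd [K K0 gK]; exists ((m * p)%:R * K); first by rewrite mulr_ge0.
move=> [s t] [/= as_ st tb]; rewrite expr2 -mulrA mulrA -mulrA.
rewrite [K * _]mulrA.
apply: (has_deriv_mean_value st (dg := dg)) => r /andP[sr rt].
  apply: (@has_deriv_subset _ _ _ `[a, b]).
    move=> u /=; rewrite !in_itv/= => /andP[su ut].
    by rewrite (le_trans as_)//= (le_trans ut).
  by apply: gd; rewrite (le_trans as_)//= (le_trans rt).
have : in_seg2 a b (r, s).
  by split; rewrite /in_seg/= ?as_ ?(le_trans as_ sr) ?(le_trans rt tb) ?(le_trans st tb).
move=> /gK/= /le_trans; apply; rewrite ler_wpM2l// ger0_norm ?subr_ge0//.
by rewrite lerD2r.
Qed.

Lemma C1_on_bnd_deriv m p (J : set R) (a b : R) (g : R -> 'M[R]_(m, p)) :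
  `[a, b] `<=` J -> C1_on J g -> bnd_on a b (deriv_on J g).
Proof.
move=> IJ [gd gc].
have [|K HK] := @segment_bounded R a b (fun t => nrm (deriv_on J g t)).
  move=> s sab; have Js : J s by apply: IJ; rewrite /= in_itv.
  have [d d0 Hd] := within_eps_cont gc Js ltr01.
  exists (nrm (deriv_on J g s) + (m * p)%:R), d => // r rab rs.
  have Jr : J r by apply: IJ; rewrite /= in_itv.
  rewrite -[deriv_on J g r](subrK (deriv_on J g s)) addrC.
  rewrite (le_trans (nrmD _ _))// lerD2l (le_trans (nrm_le_norm _))//.
  by rewrite -[leRHS]mulr1 ler_wpM2l// Hd.
exists `|K|; rewrite ?normr_ge0// => s sab.
by rewrite mulr1 (le_trans (HK s sab))// ler_norm.
Qed.

Lemma C1_on_lip m p (J : set R) (a b : R) (g : R -> 'M[R]_(m, p)) :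
  `[a, b] `<=` J -> C1_on J g -> lip_on a b g.
Proof.
move=> IJ gC; apply: (has_deriv_lip (dg := deriv_on J g)).
  move=> t tab; apply: (has_deriv_subset IJ); apply: derivable_on_has_deriv.
  by apply: gC.1; apply: IJ; rewrite /= in_itv.
exact: C1_on_bnd_deriv.
Qed.

Lemma has_deriv_cont (W : normedModType R) (J : set R) (g : R -> W) t d :
  has_deriv J g t d -> forall e : R, 0 < e -> exists2 a : R, 0 < a &
  forall s, J s -> `|s - t| <= a -> `|g s - g t| <= e.
Proof.
move=> H e e0; have [a a0 Ha] := H 1 ltr01.
pose q := e / (1 + `|d|).
have q0 : 0 < q by rewrite divr_gt0// ltr_wpDr.
exists (Num.min a q); first by rewrite lt_min a0.
move=> s Js; rewrite le_min => /andP[sa sq].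
rewrite -[g s - g t](subrK ((s - t) *: d)) (le_trans (ler_normD _ _))//.
rewrite (le_trans (lerD (Ha s Js sa) (lexx _)))// normrZ [_ * `|d|]mulrC -mulrDl.
by rewrite mulrC -ler_pdivlMr ?ltr_wpDr.
Qed.

Lemma has_deriv_ext (W : normedModType R) (J : set R) (F G : R -> W) t d :
  J t -> (forall s, J s -> F s = G s) -> has_deriv J G t d -> has_deriv J F t d.
Proof.
move=> Jt FG H e /H[a a0 Ha]; exists a => // s Js sa.
by rewrite (FG s Js) (FG t Jt) Ha.
Qed.

Section LittleO.
Variables (J : set R) (t : R).

Definition lo m p (F : R -> 'M[R]_(m, p)) : Prop := forall e : R, 0 < e ->
  exists2 a : R, 0 < a & forall s, J s -> `|s - t| <= a -> nrm (F s) <= e * `|s - t|.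

Definition near_bnd m p (F : R -> 'M[R]_(m, p)) : Prop :=
  exists2 K : R, 0 < K & exists2 a : R, 0 < a &
  forall s, J s -> `|s - t| <= a -> nrm (F s) <= K.

Lemma has_deriv_lo m p (g : R -> 'M[R]_(m, p)) d :
  has_deriv J g t d <-> lo (fun s => g s - g t - (s - t) *: d).
Proof.
split=> H e e0.
  have k0 : 0 < (m * p)%:R + 1 :> R by rewrite ltr_wpDl.
  have [a a0 Ha] := H _ (divr_gt0 e0 k0); exists a => // s Js sa.
  rewrite (le_trans (nrm_le_norm _))//.
  rewrite (le_trans (ler_wpM2l (ler0n _ _) (Ha s Js sa)))// mulrA ler_wpM2r//.
  by rewrite mulrA ler_pdivrMr// mulrC ler_wpM2l ?(ltW e0)// lerDl.
have [a a0 Ha] := H _ e0; exists a => // s Js sa.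
exact: le_trans (nrm_ge_norm _) (Ha s Js sa).
Qed.

Lemma lo_ext m p (F G : R -> 'M[R]_(m, p)) : (forall s, J s -> F s = G s) ->
  lo G -> lo F.
Proof.
move=> FG H e /H[a a0 Ha]; exists a => // s Js sa; rewrite FG//; exact: Ha.
Qed.

Lemma lo_add m p (F G : R -> 'M[R]_(m, p)) : lo F -> lo G -> lo (fun s => F s + G s).
Proof.
move=> HF HG e e0; have e2 : 0 < e / 2 by rewrite divr_gt0.
have [a a0 Ha] := HF _ e2; have [b b0 Hb] := HG _ e2.
exists (Num.min a b); first by rewrite lt_min a0.
move=> s Js; rewrite le_min => /andP[sa sb]; rewrite (le_trans (nrmD _ _))//.
by rewrite (le_trans (lerD (Ha s Js sa) (Hb s Js sb)))// -mulrDl -splitr.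
Qed.

Lemma lo_opp m p (F : R -> 'M[R]_(m, p)) : lo F -> lo (fun s => - F s).
Proof.
move=> HF e /HF[a a0 Ha]; exists a => // s Js sa; rewrite nrmN; exact: Ha.
Qed.

Lemma lo_mull m p q (F : R -> 'M[R]_(m, p)) (G : R -> 'M[R]_(p, q)) :
  near_bnd F -> lo G -> lo (fun s => F s *m G s).
Proof.
move=> [K K0 [a a0 Ha]] HG e e0; have [b b0 Hb] := HG _ (divr_gt0 e0 K0).
exists (Num.min a b); first by rewrite lt_min a0.
move=> s Js; rewrite le_min => /andP[sa sb]; rewrite (le_trans (nrmM _ _))//.
rewrite (le_trans (ler_pM _ _ (Ha s Js sa) (Hb s Js sb))) ?nrm_ge0//.
by rewrite mulrA [K * _]mulrC divfK ?gt_eqF.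
Qed.

Lemma lo_mulr m p q (F : R -> 'M[R]_(m, p)) (G : R -> 'M[R]_(p, q)) :
  lo F -> near_bnd G -> lo (fun s => F s *m G s).
Proof.
move=> HF [K K0 [a a0 Ha]] e e0; have [b b0 Hb] := HF _ (divr_gt0 e0 K0).
exists (Num.min a b); first by rewrite lt_min a0.
move=> s Js; rewrite le_min => /andP[sa sb]; rewrite (le_trans (nrmM _ _))//.
rewrite (le_trans (ler_pM _ _ (Hb s Js sb) (Ha s Js sa))) ?nrm_ge0//.
by rewrite mulrAC divfK ?gt_eqF.
Qed.

Lemma near_bnd_cst m p (M : 'M[R]_(m, p)) : near_bnd (fun=> M).
Proof.
exists (nrm M + 1); first by rewrite ltr_wpDl ?nrm_ge0.
by exists 1 => // s _ _; rewrite lerDl.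
Qed.

Lemma lo_quad m p (F : R -> 'M[R]_(m, p)) (K a : R) : 0 < a ->
  (forall s, J s -> `|s - t| <= a -> nrm (F s) <= K * (`|s - t| * `|s - t|)) -> lo F.
Proof.
move=> a0 HF e e0.
have k0 : 0 < `|K| + 1 by rewrite ltr_wpDl.
exists (Num.min a (e / (`|K| + 1))); first by rewrite lt_min a0 divr_gt0.
move=> s Js; rewrite le_min => /andP[sa]; rewrite ler_pdivlMr// => se.
rewrite (le_trans (HF s Js sa))// mulrA ler_wpM2r// (le_trans _ se)// mulrC.
by rewrite ler_wpM2l// (le_trans (ler_norm _))// lerDl.
Qed.

End LittleO.

End SmoothFamilies.

(** * Regularity of the spectral projectors *)

(* Identities in the additive group of matrices, with products as atoms. *)
Ltac mxlin :=
  repeat (match goal with |- context [?X *m ?Y] => move: (X *m Y) => ? end);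
  apply/matrixP => ? ?; rewrite !mxE; ring.

Section SpectralPairVariation.
Variables (F : comNzRingType) (n : nat) (A B P H A' B' P' H' : 'M[F]_n).
Hypothesis pair : spectral_pair A B P H.
Hypothesis pair' : spectral_pair A' B' P' H'.

(** Put [A H + B P = 1] to the right of [P'] and [H' A' + P' B' = 1] to the left of [P]. The terms
    with [A] and [A'] complete to differences because [P' A' = 0] and [A P = 0]. *)
Lemma spectral_pair_P_diff : P' - P =
  - (P' *m (B' - B) *m P + P' *m (A' - A) *m H + H' *m (A' - A) *m P).
Proof.
have [AP _ AHBP _ _] := pair; have [_ PA' _ HAPB' _] := pair'.
have -> : P' - P = (P' *m A *m H + P' *m B *m P) - (H' *m A' *m P + P' *m B' *m P).
  by rewrite -!mulmxA -!mulmxDr AHBP mulmx1 !mulmxA -mulmxDl HAPB' mul1mx.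
rewrite !mulmxBr !mulmxBl PA' mul0mx -(mulmxA H' A P) AP mulmx0.
by mxlin.
Qed.

(** The same insertion, with [H' B' P' = 0] and [P B H = 0] subtracted. Increments of [P] appear, so
    the Lipschitz bound for [P] has to come before that for [H]. *)
Lemma spectral_pair_H_diff : H' - H =
  (H' *m (B - B') *m P + H' *m B' *m (P - P')) -
  (P' *m (B' - B) *m H + (P' - P) *m B *m H) - H' *m (A' - A) *m H.
Proof.
have [AP _ AHBP _ [_ _ PBH]] := pair.
have [_ PA' _ HAPB' [_ HBP' _]] := pair'.
have -> : H' - H = (H' *m A *m H + H' *m B *m P) - (H' *m A' *m H + P' *m B' *m H).
  by rewrite -!mulmxA -!mulmxDr AHBP mulmx1 !mulmxA -mulmxDl HAPB' mul1mx.
rewrite !mulmxBr !mulmxBl HBP' PBH.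
by mxlin.
Qed.

End SpectralPairVariation.

Lemma mulmx_increment (F : comNzRingType) m n p (X' X dX : 'M[F]_(m, n))
    (Y' Y dY : 'M[F]_(n, p)) (h : F) :
  X' *m Y' - X *m Y - h *: (dX *m Y + X *m dY) =
  (X' - X) *m (Y' - Y) + (X' - X - h *: dX) *m Y + X *m (Y' - Y - h *: dY).
Proof. by rewrite !(mulmxBl, mulmxBr) -!scalemxAr -!scalemxAl; mxlin. Qed.

Section LipschitzProduct.
Variables (R : realType) (J : set R) (a b t : R).
Hypotheses (at_ : a <= t < b) (Ja : forall s, J s -> a <= s).

Lemma near_in_seg s : J s -> `|s - t| <= b - t -> in_seg a b s.
Proof.
by move=> Js; rewrite ler_norml lerD2r => /andP[_ sb]; rewrite /in_seg Ja.
Qed.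

Lemma lo_lip_mul m p q (X : R -> 'M[R]_(m, p)) (Y : R -> 'M[R]_(p, q)) :
  lip_on a b X -> lip_on a b Y ->
  lo J t (fun s => (X s - X t) *m (Y s - Y t)).
Proof.
have /andP[at1 tb] := at_; have bt0 : 0 < b - t by rewrite subr_gt0.
move=> [c c0 lX] [d d0 lY]; apply: (lo_quad (K := c * d) bt0) => s Js st.
have st2 : in_seg2 a b (s, t).
  by split; [exact: near_in_seg|rewrite /in_seg/= at1 ltW].
rewrite (le_trans (nrmM _ _))// [leRHS]mulrACA.
by rewrite ler_pM ?nrm_ge0 ?(lX _ st2) ?(lY _ st2).
Qed.

End LipschitzProduct.

Section SpectralPairFamily.
Variables (R : realType) (n : nat) (A B P H : R -> 'M[R]_n) (a b : R).
Hypothesis pair : forall t, a <= t <= b -> spectral_pair (A t) (B t) (P t) (H t).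
Hypotheses (lA : lip_on a b A) (lB : lip_on a b B).
Hypotheses (bB : bnd_on a b B) (bP : bnd_on a b P) (bH : bnd_on a b H).

Lemma lip_on_P : lip_on a b P.
Proof.
apply: (OO_ext (G := fun x => - (P x.1 *m (B x.1 - B x.2) *m P x.2 +
    P x.1 *m (A x.1 - A x.2) *m H x.2 + H x.1 *m (A x.1 - A x.2) *m P x.2))).
  by move=> x [x1 x2]; exact: spectral_pair_P_diff (pair x2) (pair x1).
apply: OO_opp; apply: OO_add; first apply: OO_add.
- exact: OO_mulb (OO_bmul (bnd_on1 bP) lB) (bnd_on2 bP).
- exact: OO_mulb (OO_bmul (bnd_on1 bP) lA) (bnd_on2 bH).
- exact: OO_mulb (OO_bmul (bnd_on1 bH) lA) (bnd_on2 bP).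
Qed.

Lemma lip_on_H : lip_on a b H.
Proof.
have flip m p (g : R -> 'M[R]_(m, p)) : lip_on a b g ->
    OO (in_seg2 a b) (fun x => g x.2 - g x.1) (fun x => `|x.1 - x.2|).
  by move=> lg; apply: OO_ext (OO_opp lg) => x _; rewrite opprB.
apply: (OO_ext (G := fun x =>
  (H x.1 *m (B x.2 - B x.1) *m P x.2 + H x.1 *m B x.1 *m (P x.2 - P x.1)) -
  (P x.1 *m (B x.1 - B x.2) *m H x.2 + (P x.1 - P x.2) *m B x.2 *m H x.2) -
  H x.1 *m (A x.1 - A x.2) *m H x.2)).
  by move=> x [x1 x2]; exact: spectral_pair_H_diff (pair x2) (pair x1).
apply: OO_subr; first (apply: OO_subr; apply: OO_add).
- exact: OO_mulb (OO_bmul (bnd_on1 bH) (flip _ _ _ lB)) (bnd_on2 bP).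
- exact: OO_bmul (OO_bmul (bnd_on1 bH) (bnd_on1 bB)) (flip _ _ _ lip_on_P).
- exact: OO_mulb (OO_bmul (bnd_on1 bP) lB) (bnd_on2 bH).
- exact: OO_mulb (OO_mulb lip_on_P (bnd_on2 bB)) (bnd_on2 bH).
- exact: OO_mulb (OO_bmul (bnd_on1 bH) lA) (bnd_on2 bH).
Qed.

(** The linear part of [spectral_pair_P_diff] as the second time tends to the first. *)
Definition dspectral (dA dB : R -> 'M[R]_n) (t : R) : 'M[R]_n :=
  - (P t *m dB t *m P t + P t *m dA t *m H t + H t *m dA t *m P t).

Lemma lip_on_dspectral (c d : R) (dA dB : R -> 'M[R]_n) : a <= c -> d <= b ->
  bnd_on c d dA -> bnd_on c d dB -> lip_on c d dA -> lip_on c d dB ->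
  lip_on c d (dspectral dA dB).
Proof.
move=> ac db bdA bdB ldA ldB.
have sub s : in_seg c d s -> in_seg a b s.
  by move=> /andP[cs sd]; rewrite /in_seg (le_trans ac cs) (le_trans sd db).
have bP' : bnd_on c d P by apply: OO_sub bP.
have bH' : bnd_on c d H by apply: OO_sub bH.
have lP' : lip_on c d P by apply: OO_sub lip_on_P => x [/sub ? /sub].
have lH' : lip_on c d H by apply: OO_sub lip_on_H => x [/sub ? /sub].
have key (X Y Z : R -> 'M[R]_n) : bnd_on c d X -> bnd_on c d Y -> bnd_on c d Z ->
    lip_on c d X -> lip_on c d Y -> lip_on c d Z ->
    lip_on c d (fun t => X t *m Y t *m Z t).
  move=> bX bY bZ lX lY lZ; apply: lip_on_mul => //; first exact: OO_bmul bX bY.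
  exact: lip_on_mul.
apply: (OO_ext (G := fun x =>
  - ((P x.1 *m dB x.1 *m P x.1 - P x.2 *m dB x.2 *m P x.2) +
     (P x.1 *m dA x.1 *m H x.1 - P x.2 *m dA x.2 *m H x.2) +
     (H x.1 *m dA x.1 *m P x.1 - H x.2 *m dA x.2 *m P x.2)))).
  by move=> x _; rewrite /dspectral; mxlin.
apply: OO_opp; apply: OO_add; first apply: OO_add; exact: key.
Qed.

Lemma has_deriv_spectral (J : set R) (t : R) (dA dB : R -> 'M[R]_n) :
  a <= t < b -> (forall s, J s -> a <= s) ->
  has_deriv J A t (dA t) -> has_deriv J B t (dB t) ->
  has_deriv J P t (dspectral dA dB t).
Proof.
move=> /andP[at_ tb] Ja dAt dBt; apply/has_deriv_lo.
have bt0 : 0 < b - t by rewrite subr_gt0.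
have atb : a <= t < b by rewrite at_.
have tab : in_seg a b t by rewrite /in_seg at_ ltW.
have quad (X Y : R -> 'M[R]_n) (Z : 'M[R]_n) : lip_on a b X -> lip_on a b Y ->
    lo J t (fun s => (X s - X t) *m (Y s - Y t) *m Z).
  move=> lX lY; exact: lo_mulr (lo_lip_mul atb Ja lX lY) (near_bnd_cst _ _ _).
have lin (X Z : 'M[R]_n) (M : R -> 'M[R]_n) dM : has_deriv J M t dM ->
    lo J t (fun s => X *m (M s - M t - (s - t) *: dM) *m Z).
  move=> /has_deriv_lo HM.
  exact: lo_mulr (lo_mull (near_bnd_cst _ _ _) HM) (near_bnd_cst _ _ _).
(* In each term of [spectral_pair_P_diff] the left factor is split into its value at [t] and its
   increment. Products of two Lipschitz increments are of second order. *)
have H0 : lo J t (fun s => - (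
   ((P s - P t) *m (B s - B t) *m P t + P t *m (B s - B t - (s - t) *: dB t) *m P t) +
   ((P s - P t) *m (A s - A t) *m H t + P t *m (A s - A t - (s - t) *: dA t) *m H t) +
   ((H s - H t) *m (A s - A t) *m P t + H t *m (A s - A t - (s - t) *: dA t) *m P t))).
  have lP := lip_on_P; have lH := lip_on_H.
  apply: lo_opp; apply: lo_add; first apply: lo_add; apply: lo_add.
  - exact: (quad P B (P t)).
  - exact: (lin (P t) (P t) B).
  - exact: (quad P A (H t)).
  - exact: (lin (P t) (H t) A).
  - exact: (quad H A (P t)).
  - exact: (lin (H t) (P t) A).
move=> e /H0[d d0 Hd]; exists (Num.min d (b - t)); first by rewrite lt_min d0.
move=> s Js; rewrite le_min => /andP[sd sb]; apply: le_trans (Hd s Js sd).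
rewrite le_eqVlt; apply/orP; left; apply/eqP; congr nrm.
rewrite [in LHS](spectral_pair_P_diff (pair tab) (pair (near_in_seg Ja Js sb))) /dspectral.
rewrite !(mulmxBl, mulmxBr) -!scalemxAr -!scalemxAl.
by mxlin.
Qed.

Definition dprojector (dA dB : R -> 'M[R]_n) (t : R) : 'M[R]_n :=
  - (dspectral dA dB t *m B t + P t *m dB t).

Lemma has_deriv_projector (J : set R) (t : R) (dA dB : R -> 'M[R]_n) :
  a <= t < b -> (forall s, J s -> a <= s) ->
  has_deriv J A t (dA t) -> has_deriv J B t (dB t) ->
  has_deriv J (fun s => 1%:M - P s *m B s) t (dprojector dA dB t).
Proof.
move=> atb Ja dAt dBt; have dP := has_deriv_spectral atb Ja dAt dBt.
apply/has_deriv_lo.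
apply: (lo_ext (G := fun s => - ((P s - P t) *m (B s - B t) +
   (P s - P t - (s - t) *: dspectral dA dB t) *m B t +
   P t *m (B s - B t - (s - t) *: dB t)))).
  by move=> s Jss; rewrite /dprojector -mulmx_increment; mxlin.
apply: lo_opp; apply: lo_add; first apply: lo_add.
- exact: (lo_lip_mul atb Ja lip_on_P lB).
- by apply: lo_mulr; [exact/has_deriv_lo|exact: near_bnd_cst].
- by apply: lo_mull; [exact: near_bnd_cst|exact/has_deriv_lo].
Qed.

Lemma lip_on_dprojector (c d : R) (dA dB : R -> 'M[R]_n) : a <= c -> c <= d -> d <= b ->
  lip_on c d dA -> lip_on c d dB -> lip_on c d (dprojector dA dB).
Proof.
move=> ac cd db ldA ldB.
have sub s : in_seg c d s -> in_seg a b s.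
  by move=> /andP[cs sd]; rewrite /in_seg (le_trans ac cs) (le_trans sd db).
have sub2 x : in_seg2 c d x -> in_seg2 a b x by move=> [/sub ? /sub].
have bdA := lip_bnd_on cd ldA; have bdB := lip_bnd_on cd ldB.
have lD := lip_on_dspectral ac db bdA bdB ldA ldB.
have lB' : lip_on c d B by exact: OO_sub sub2 lB.
have lP' : lip_on c d P by exact: OO_sub sub2 lip_on_P.
have l1 := lip_on_mul (lip_bnd_on cd lD) (lip_bnd_on cd lB') lD lB'.
have l2 := lip_on_mul (lip_bnd_on cd lP') bdB lP' ldB.
apply: OO_ext (OO_opp (OO_add l1 l2)) => x _; rewrite /dprojector; mxlin.
Qed.

End SpectralPairFamily.

(** * Local boundedness of the coefficients and differentiability of [P1] *)

Section PencilCoefficients.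
Variables (R : realType) (n : nat) (tp : R) (A B : R -> 'M[R]_n) (C1 C2 : R -> R).
Local Notation J := (`[tp, +oo[%classic).
Local Notation normc := (@Normc.normc R).
Hypothesis A_C1 : C1_on J A.
Hypothesis B_C1 : C1_on J B.
Hypothesis C2_gt0 : forall t, J t -> 0 < C2 t.
Hypothesis C2_C1 : C1_on J C2.
Hypothesis pencil_bound : forall t (l : R[i]), J t -> C2 t <= normc l ->
  pencil A B t l \in unitmx /\ copnorm (invmx (pencil A B t l)) <= C1 t.
Local Notation P := (Pinf A B C2).
Local Notation H := (Hinf A B C2).

Let S_bound t : J t -> forall l, C2 t <= normc l -> pencil A B t l \in unitmx /\
  nrm (invmx (pencil A B t l)) <= ((n * n)%:R * C1 t)%:C%C.
Proof.
move=> Jt l /(pencil_bound Jt)[u cb]; split=> //; apply: nrm_centries_le => i j.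
exact: le_trans (normc_le_copnorm _ _ _) cb.
Qed.

Lemma in_J a b t : tp <= a -> a <= t <= b -> J t.
Proof. by move=> ta /andP[at_ _]; rewrite /= in_itv/= andbT (le_trans ta). Qed.

Lemma seg_sub_J a b : tp <= a -> `[a, b] `<=` J.
Proof. by move=> ta t; rewrite /= in_itv/= => /(in_J ta); rewrite /= in_itv. Qed.

Lemma pair_J t : J t -> spectral_pair (A t) (B t) (P t) (H t).
Proof. by move=> Jt; exact: Pinf_Hinf_spectral_pair (C2_gt0 Jt) (S_bound Jt). Qed.

Lemma P1_J t : J t -> P1 A B C2 t = H t *m A t.
Proof. by move=> Jt; exact: P1E (C2_gt0 Jt) (S_bound Jt). Qed.

Lemma P2_J t : J t -> P2 A B C2 t = P t *m B t.
Proof. by move=> Jt; exact: P2E (C2_gt0 Jt) (S_bound Jt). Qed.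

Lemma Q1_J t : J t -> Q1 A B C2 t = A t *m H t.
Proof. by move=> Jt; exact: Q1E (C2_gt0 Jt) (S_bound Jt). Qed.

Lemma Q2_J t : J t -> Q2 A B C2 t = B t *m P t.
Proof. by move=> Jt; exact: Q2E (C2_gt0 Jt) (S_bound Jt). Qed.

Lemma Ginv_J t : J t -> Ginv A B C2 t = P t + H t.
Proof. by move=> Jt; exact: GinvE (C2_gt0 Jt) (S_bound Jt). Qed.

Lemma bnd_on_P_H b : tp <= b -> bnd_on tp b P /\ bnd_on tp b H.
Proof.
move=> tb.
have [|M HM] := @segment_bounded R tp b (fun t => nrm (P t) + nrm (H t)).
  move=> s sab; have Js := in_J (lexx tp) sab.
  pose k := `|(n * n)%:R * C1 s| + 1.
  have k0 : 0 < k by rewrite ltr_wpDl.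
  have Sk l : C2 s <= normc l -> pencil A B s l \in unitmx /\
      nrm (invmx (pencil A B s l)) <= k%:C%C.
    move=> /(S_bound Js)[u Hu]; split=> //; apply: le_trans Hu _; rewrite lecR.
    by rewrite (le_trans (ler_norm _))// lerDl.
  (* The summands of the denominator weigh the increments of [C2] (against a bound of [A] near [s]),
     of [A] (against [C2 s]) and of [B]; the last [1] is slack. Their total is then at most the
     inverse of [2 k]. *)
  pose e := (2 * k)^-1 / (nrm (A s) + 1 + `|C2 s| + 1 + 1).
  have D0 : 0 < nrm (A s) + 1 + `|C2 s| + 1 + 1.
    by rewrite ltr_wpDl// !addr_ge0 ?nrm_ge0.
  have e0 : 0 < e by rewrite divr_gt0// invr_gt0 mulr_gt0.
  have e1 : 0 < Num.min 1 e by rewrite lt_min ltr01.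
  have contM (g : R -> 'M[R]_n) : C1_on J g -> exists2 d : R, 0 < d &
      forall r, J r -> `|r - s| <= d -> nrm (g r - g s) <= Num.min 1 e.
    move=> gC; have := has_deriv_cont (derivable_on_has_deriv (gC.1 _ Js)).
    have k1 : 0 < (n * n)%:R + 1 :> R by rewrite ltr_wpDl.
    move=> /(_ _ (divr_gt0 e1 k1))[d d0 Hd]; exists d => // r Jr rs.
    rewrite (le_trans (nrm_le_norm _))//.
    rewrite (le_trans (ler_wpM2l (ler0n _ _) (Hd r Jr rs)))//.
    by rewrite mulrA ler_pdivrMr// mulrC ler_wpM2l ?(ltW e1)// lerDl.
  have [dA dA0 HA] := contM A A_C1; have [dB dB0 HB] := contM B B_C1.
  have [dC dC0 HC] := has_deriv_cont (derivable_on_has_deriv (C2_C1.1 _ Js)) e1.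
  exists ((n * n)%:R * (2 * (2 * k)) + (n * n)%:R * (2 * ((C2 s + 1) * (2 * k)))).
  exists (Num.min dA (Num.min dB dC)); first by rewrite !lt_min dA0 dB0.
  move=> r rab; rewrite !le_min => /and3P[rA rB rC].
  have Jr := in_J (lexx tp) rab.
  have := HA r Jr rA; rewrite le_min => /andP[A1 Ae].
  have := HB r Jr rB; rewrite le_min => /andP[B1 Be].
  have := HC r Jr rC; rewrite le_min => /andP[C1' Ce].
  have Cr : C2 r <= C2 s + 1.
    by have := le_trans (ler_norm _) C1'; rewrite lerBlDl.
  have [|PK HK] := Pinf_Hinf_local_bound (C2_gt0 Js) (C2_gt0 Jr) Sk (S_bound Jr).
    rewrite -ler_pdivlMr// -invfM.
    apply: (@le_trans _ _ (e * (nrm (A s) + 1 + `|C2 s| + 1 + 1))); last first.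
      by rewrite /e divfK ?gt_eqF.
    have -> : C2 r *: A r - C2 s *: A s = (C2 r - C2 s) *: A r + C2 s *: (A r - A s).
      by rewrite scalerBl scalerBr addrA subrK.
    rewrite (le_trans (lerD (nrmD _ _) (lexx _)))// !nrmZ.
    have nA : nrm (A r) <= nrm (A s) + 1.
      by rewrite -[A r](subrK (A s)) addrC (le_trans (nrmD _ _))// lerD2l.
    have h1 : `|C2 r - C2 s| * nrm (A r) <= e * (nrm (A s) + 1).
      by rewrite ler_pM ?nrm_ge0.
    have h2 : `|C2 s| * nrm (A r - A s) <= e * `|C2 s|.
      by rewrite mulrC ler_wpM2r.
    have -> : e * (nrm (A s) + 1 + `|C2 s| + 1 + 1) =
      e * (nrm (A s) + 1) + e * `|C2 s| + e + e by ring.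
    by rewrite -[leLHS]addr0 lerD ?(ltW e0)// lerD// lerD.
  rewrite lerD// (le_trans HK)// ler_wpM2l// ler_wpM2l// ler_wpM2r//.
  by rewrite mulr_ge0// ltW.
split; exists `|M| => // s sab; rewrite mulr1.
  by rewrite (le_trans _ (ler_norm _))// (le_trans _ (HM s sab))// lerDl nrm_ge0.
by rewrite (le_trans _ (ler_norm _))// (le_trans _ (HM s sab))// lerDr nrm_ge0.
Qed.

(** Second-order smoothness is assumed relative to the bounded interval, whereas the scheme uses
    derivatives relative to [J]; on a nondegenerate segment the two agree, endpoints included. *)
Lemma deriv_on_sub_J m p (a b t : R) (g : R -> 'M[R]_(m, p)) : tp <= a -> a < b ->
  C1_on J g -> a <= t <= b -> deriv_on `[a, b] g t = deriv_on J g t.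
Proof.
move=> ta ab gC tab; apply: (has_deriv_on_eq ab _ tab) => //.
apply: (has_deriv_subset (seg_sub_J ta)); apply: derivable_on_has_deriv.
exact: gC.1 _ (in_J ta tab).
Qed.

Lemma C2_on_lip_deriv m p (a b : R) (g : R -> 'M[R]_(m, p)) : tp <= a -> a < b ->
  C1_on J g -> C2_on `[a, b] g -> lip_on a b (deriv_on J g).
Proof.
move=> ta ab gC [_ gC2].
have lg : lip_on a b (deriv_on `[a, b] g) by apply: C1_on_lip gC2.
by apply: OO_ext lg => x [x1 x2]; rewrite !(deriv_on_sub_J ta ab gC).
Qed.

Lemma has_deriv_P1 t : J t -> has_deriv J (P1 A B C2) t (dprojector B P H (deriv_on J A) (deriv_on J B) t).
Proof.
move=> Jt; have tt : tp <= t by move: Jt; rewrite /= in_itv/= andbT.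
(* Room to the right of [t] is needed because [J] contains times beyond [t]; any length would do. *)
have tb : tp <= t < t + 1 by rewrite tt ltrDl ltr01.
have tb1 : tp <= t + 1 by rewrite (le_trans tt)// lerDl.
have Js s : J s -> tp <= s by rewrite /= in_itv/= andbT.
have [bP bH] := bnd_on_P_H tb1.
have sub := seg_sub_J (b := t + 1) (lexx tp).
have lA := C1_on_lip sub A_C1; have lB := C1_on_lip sub B_C1.
have bB := lip_bnd_on tb1 lB.
have pair s : tp <= s <= t + 1 -> spectral_pair (A s) (B s) (P s) (H s).
  by move=> st; apply: pair_J; exact: in_J (lexx tp) st.
have lP := lip_on_P pair lA lB bP bH.
have dA := derivable_on_has_deriv (A_C1.1 _ Jt).
have dB := derivable_on_has_deriv (B_C1.1 _ Jt).
apply: (has_deriv_ext (G := fun s => 1%:M - P s *m B s)) => //.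
  by move=> s Jss; have [_ _ _ E _] := pair_J Jss; rewrite P1_J// -E addrK.
exact: (has_deriv_projector pair lA lB bB bP bH tb Js dA dB).
Qed.

End PencilCoefficients.

(** * The numerical scheme *)

Section DiscreteGronwall.
Variables (R : realType) (C L : R).
Hypothesis C_ge0 : 0 <= C.

(** Growth rate of the first sequence: [b i <= 2 C (a i) + 2 C h] in its recursion gives
    [a i.+1 <= (1 + h D) (a i) + D h^2]. *)
Let D := C + 2 * C ^+ 2.

Definition gronwall_cst : R := (1 + 2 * C) * expR (D * L) + 2 * C.

(* The invariant is [a i <= h ((1 + h D)^i - 1)] and [b i <= 2 C a i + 2 C h]. *)
Lemma discrete_gronwall (a b : nat -> R) (N : nat) (h d : R) : 0 < h ->
  N%:R * h <= L -> gronwall_cst * h <= d -> a 0%N <= 0 -> b 0%N <= 0 ->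
  (forall i, (i < N)%N -> a i <= d -> b i <= d ->
     a i.+1 <= a i + h * (C * (a i + b i)) + C * h ^+ 2) ->
  (forall i, (i < N)%N -> a i <= d -> b i <= d -> a i.+1 <= d ->
     b i.+1 <= C * a i.+1 + b i / 2 + C * h) ->
  forall i, (i <= N)%N -> a i <= gronwall_cst * h /\ b i <= gronwall_cst * h.
Proof.
move=> h0 NL Kd a0 b0 sa sb.
have h0' := ltW h0.
have D0 : 0 <= D by rewrite /D addr_ge0// mulr_ge0// sqr_ge0.
have hD : 1 <= 1 + h * D by rewrite lerDl mulr_ge0.
pose al i : R := h * ((1 + h * D) ^+ i - 1).
have al0 i : 0 <= al i by rewrite mulr_ge0// subr_ge0 exprn_ege1.
have alS i : al i.+1 = (1 + h * D) * al i + h ^+ 2 * D by rewrite /al exprS; ring.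
have alE i : (i <= N)%N -> al i <= h * expR (D * L).
  move=> iN; rewrite /al ler_wpM2l// lerBlDr.
  apply: (@le_trans _ _ (expR (D * L))); last by rewrite lerDl.
  apply: (@le_trans _ _ (expR (h * D) ^+ i)).
    by rewrite lerXn2r ?nnegrE ?expR_ge0 ?(le_trans ler01)// expR_ge1Dx.
  rewrite -expRM_natl ler_expR mulrA [leRHS]mulrC.
  rewrite ler_wpM2r// (le_trans _ NL)// ler_wpM2r// ler_nat//.
have K2 i : (i <= N)%N -> 2 * C * al i + 2 * C * h <= gronwall_cst * h.
  move=> iN; have -> : gronwall_cst * h =
      2 * C * (h * expR (D * L)) + h * expR (D * L) + 2 * C * h.
    by rewrite /gronwall_cst; ring.
  rewrite lerD2r (le_trans (ler_wpM2l _ (alE i iN))) ?mulr_ge0//.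
  by rewrite lerDl mulr_ge0// expR_ge0.
have K1 i : (i <= N)%N -> al i <= gronwall_cst * h.
  move=> iN; rewrite (le_trans (alE i iN))// /gronwall_cst.
  have -> : ((1 + 2 * C) * expR (D * L) + 2 * C) * h =
    h * expR (D * L) + (2 * C * expR (D * L) * h + 2 * C * h) by ring.
  by rewrite lerDl addr_ge0// !mulr_ge0// expR_ge0.
suff inv i : (i <= N)%N -> a i <= al i /\ b i <= 2 * C * al i + 2 * C * h.
  by move=> i iN; have [ai bi] := inv i iN; split;
    [exact: le_trans ai (K1 i iN)|exact: le_trans bi (K2 i iN)].
elim: i => [_|i IH iN].
  rewrite /al expr0 subrr mulr0 mulr0 add0r; split=> //.
  by rewrite (le_trans b0)// !mulr_ge0.
have [ai bi] := IH (ltnW iN).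
have aid : a i <= d by rewrite (le_trans ai)// (le_trans (K1 i (ltnW iN))).
have bid : b i <= d by rewrite (le_trans bi)// (le_trans (K2 i (ltnW iN))).
have aS : a i.+1 <= al i.+1.
  rewrite (le_trans (sa i iN aid bid))//.
  have : h * (C * (a i + b i)) <= h * (C * (al i + (2 * C * al i + 2 * C * h))).
    by rewrite ler_wpM2l// ler_wpM2l// lerD.
  have -> : al i.+1 = al i + h * (C * (al i + (2 * C * al i + 2 * C * h))) + C * h ^+ 2.
    by rewrite alS /D; ring.
  by move=> H; rewrite lerD2r lerD.
have aSd : a i.+1 <= d by rewrite (le_trans aS)// (le_trans (K1 _ iN)).
split=> //; rewrite (le_trans (sb i iN aid bid aSd))//.
have h1 : C * a i.+1 <= C * al i.+1 by rewrite ler_wpM2l.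
(* Halving the bound for [b i] leaves [C * al i + C * h]; since [al] increases, this joins the new
   term to restore [2 * C * al i.+1 + 2 * C * h]. *)
have h2 : C * al i <= C * al i.+1.
  rewrite ler_wpM2l// alS mulrDl mul1r -[leRHS]addrA lerDl.
  apply: addr_ge0; apply: mulr_ge0 => //; last exact: exprn_ge0.
  exact: mulr_ge0.
move: h1 h2 bi; rewrite -!mulrA.
move: (C * a i.+1) (C * al i) (C * al i.+1) (C * h) (b i) => u v w y z; lra.
Qed.

End DiscreteGronwall.

(** * Uniform continuity in a tube around the trajectory *)

Section Tube.
Variables (R : realType) (n : nat) (a b : R) (x : R -> 'cV[R]_n).
Hypothesis x_cont : {within `[a, b], continuous x}.

(** Only the time interval has to be compact: a modulus at [(s, x s)] serves for all centres
    [(r, x r)] with [r] near [s], since [x] is continuous. Both values of [Psi] are compared with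
    the one at [(s, x s)]. *)
Lemma tube_cont m p (Psi : R -> 'cV[R]_n -> 'M[R]_(m, p)) :
  {within `[a, b] `*` setT, continuous (fun q : R * 'cV[R]_n => Psi q.1 q.2)} ->
  forall e : R, 0 < e -> exists2 d : R, 0 < d & forall s r y, in_seg a b s ->
    in_seg a b r -> `|r - s| <= d -> nrm (y - x s) <= d ->
    nrm (Psi r y - Psi s (x s)) <= e.
Proof.
move=> Pc e e0.
have [||d d0 Hd] := @segment_uniform R a b (fun d s => forall r y,
    in_seg a b r -> `|r - s| <= d -> nrm (y - x s) <= d ->
    nrm (Psi r y - Psi s (x s)) <= e).
- move=> d d' s /andP[_ dd] H r y rab rs ys.
  by apply: H => //; [exact: le_trans rs dd|exact: le_trans ys dd].
- move=> s sab; have Is : `[a, b]%classic s by rewrite /= in_itv.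
  have k0 : 0 < (m * p)%:R + 1 :> R by rewrite ltr_wpDl.
  have e2 : 0 < e / 2 / ((m * p)%:R + 1) by rewrite !divr_gt0.
  have [d d0 Hd] := within_prod_eps_cont Pc (x s) Is e2.
  have Hn r y : in_seg a b r -> `|r - s| <= d -> nrm (y - x s) <= d ->
      nrm (Psi r y - Psi s (x s)) <= e / 2.
    move=> rab rs ys; have Ir : `[a, b]%classic r by rewrite /= in_itv.
    have := Hd r y Ir rs (le_trans (nrm_ge_norm _) ys).
    rewrite ler_pdivlMr// => /(le_trans _); apply.
    rewrite (le_trans (nrm_le_norm _))// mulrC ler_wpM2l// lerDl//.
  have k1 : 0 < (n * 1)%:R + 1 :> R by rewrite ltr_wpDl.
  have d2 : 0 < d / 2 / ((n * 1)%:R + 1) by rewrite !divr_gt0.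
  have [c c0 Hc] := within_eps_cont x_cont Is d2.
  have xn r : in_seg a b r -> `|r - s| <= c -> nrm (x r - x s) <= d / 2.
    move=> rab rs; have Ir : `[a, b]%classic r by rewrite /= in_itv.
    have := Hc r Ir rs; rewrite ler_pdivlMr// => /(le_trans _); apply.
    rewrite (le_trans (nrm_le_norm _))// mulrC ler_wpM2l// lerDl//.
  have half : d / 2 <= d by rewrite ler_pdivrMr// ler_pMr// ler1n.
  exists (Num.min c (d / 2)); first by rewrite lt_min c0 divr_gt0.
  move=> r rab; rewrite le_min => /andP[rc rd] q y qab.
  rewrite !le_min => /andP[_ qr] /andP[_ yr].
  have -> : Psi q y - Psi r (x r) = (Psi q y - Psi s (x s)) - (Psi r (x r) - Psi s (x s)).
    by rewrite opprB addrA subrK.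
  rewrite (le_trans (nrmB _ _))// (splitr e) lerD//; apply: Hn => //.
  + rewrite -(subrK r q) -addrA (le_trans (ler_normD _ _))// (splitr d) lerD//.
  + rewrite -(subrK (x r) y) -addrA (le_trans (nrmD _ _))// (splitr d) lerD//.
    exact: xn.
  + exact: le_trans rd half.
  + exact: le_trans (xn r rab rc) half.
by exists d => // s r y sab; exact: Hd.
Qed.

Lemma trajectory_cont : forall e : R, 0 < e -> exists2 d : R, 0 < d &
  forall s r, in_seg a b s -> in_seg a b r -> `|r - s| <= d -> nrm (x r - x s) <= e.
Proof.
move=> e e0.
have c1 : {within `[a, b] `*` setT, continuous (fun q : R * 'cV[R]_n => x q.1)}.
  apply/subspace_continuousP => -[s y] /= [Is _].
  move/subspace_continuousP : x_cont => /(_ s Is) xs.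
  apply: cvg_comp xs => /= U; rewrite /within/= => HU.
  exists ((fun s => `[a, b]%classic s -> U s), setT); first by split=> //; exact: filterT.
  by move=> [r z] /= [Hr _] [Ir _]; exact: Hr.
have [d d0 Hd] := tube_cont (Psi := fun s _ => x s) c1 e0.
exists d => // s r sab rab rs; apply: (Hd s r (x s)) => //.
by rewrite subrr nrm0 ltW.
Qed.

Lemma trajectory_bnd m p (Psi : R -> 'cV[R]_n -> 'M[R]_(m, p)) :
  {within `[a, b] `*` setT, continuous (fun q : R * 'cV[R]_n => Psi q.1 q.2)} ->
  bnd_on a b (fun s => Psi s (x s)).
Proof.
move=> Pc; have [d d0 Hd] := tube_cont Pc ltr01.
have [c c0 Hc] := trajectory_cont d0.
have [|M HM] := @segment_bounded R a b (fun s => nrm (Psi s (x s))).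
  move=> s sab; exists (nrm (Psi s (x s)) + 1), (Num.min c d); first by rewrite lt_min c0.
  move=> r rab; rewrite le_min => /andP[rc rd].
  rewrite -[Psi r _](subrK (Psi s (x s))) addrC (le_trans (nrmD _ _))// lerD2l.
  by apply: Hd => //; exact: Hc.
by exists `|M| => // s sab; rewrite mulr1 (le_trans (HM s sab))// ler_norm.
Qed.

End Tube.

Section Jacobian.
Variables (R : realType) (n : nat).

Lemma jacE (g : 'cV[R]_n -> 'cV[R]_n) (y v : 'cV[R]_n) :
  differentiable g y -> 'd g y v = jac g y *m v.
Proof.
move=> dg; have -> : v = \sum_j v j 0 *: delta_mx j 0.
  rewrite [LHS]matrix_sum_delta; apply: eq_bigr => i _.
  by rewrite big_ord_recl big_ord0 addr0 /=; congr (_ *: _).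
rewrite linear_sum mulmx_sumr; apply: eq_bigr => j _.
rewrite linearZ -scalemxAr; congr (_ *: _).
apply/matrixP => i k; rewrite (ord1 k) !mxE (bigD1 j)//= !mxE !eqxx mulr1 big1 ?addr0//.
by move=> l lj; rewrite !mxE (negPf lj) mulr0.
Qed.

Lemma has_deriv_line (g : 'cV[R]_n -> 'cV[R]_n) (y v : 'cV[R]_n) (J : set R) (c : R) :
  differentiable g (y + c *: v) ->
  has_deriv J (fun r => g (y + r *: v)) c (jac g (y + c *: v) *m v).
Proof.
move=> dg e e0; rewrite -jacE//.
have k0 : 0 < `|v| + 1 by rewrite ltr_wpDl.
have /diff_locallyP[_] := dg.
move=> /eqaddoP/(_ _ (divr_gt0 e0 k0)) /nbhs_normP[d/= d0 Hd].
exists (d / 2 / (`|v| + 1)); first by rewrite !divr_gt0.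
move=> s _ sc.
have small : `|0 - (s - c) *: v| < d.
  rewrite sub0r normrN normrZ; move: sc; rewrite ler_pdivlMr// => sc.
  apply: (@le_lt_trans _ _ (d / 2)).
    by rewrite (le_trans _ sc)// ler_wpM2l// lerDl.
  by rewrite ltr_pdivrMr// mulr2n mulrDr mulr1 ltrDl.
have H : `|g (y + s *: v) - g (y + c *: v) - (s - c) *: 'd g (y + c *: v) v| <=
    e / (`|v| + 1) * `|(s - c) *: v|.
  have := Hd ((s - c) *: v) small.
  set G := (X in `|X| <= _); set F := (X in _ -> `|X| <= _).
  suff -> : F = G by [].
  rewrite /F /G !fctE /= -linearZ/= opprD addrA.
  by congr (g _ - _ - _); rewrite scalerBl [RHS]addrCA subrK.
rewrite (le_trans H)// normrZ [leRHS]mulrC.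
rewrite mulrCA ler_wpM2l// -mulrA ler_piMr ?(ltW e0)//.
by rewrite mulrC ler_pdivrMr// mul1r lerDl.
Qed.

End Jacobian.

(** * Local estimates for the right-hand side near the trajectory *)

Section FieldEstimates.
Variables (R : realType) (n : nat) (a b : R) (x : R -> 'cV[R]_n).
Variable f : R -> 'cV[R]_n -> 'cV[R]_n.
Hypothesis x_cont : {within `[a, b], continuous x}.
Hypothesis f_C1 : C1_tx `[a, b] f.

(** Throughout a thin tube the Jacobians at a given time are nearly equal, so the Jacobian may be
    frozen at a third point [y'']. Newton's method freezes it at the iterate, not at the exact
    point. *)
Lemma f_linearization (e : R) : 0 < e -> exists2 d : R, 0 < d &
  forall t y y' y'', in_seg a b t ->
    nrm (y - x t) <= d -> nrm (y' - x t) <= d -> nrm (y'' - x t) <= d ->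
    nrm (f t y - f t y' - jac (f t) y'' *m (y - y')) <= e * nrm (y - y').
Proof.
move=> e0; have [_ _ _ [f_diff jac_cont]] := f_C1.
(* Absorbs the [n * 1] of the entrywise mean value estimate and the 2 from [jac_near]. *)
pose k : R := 2 * (n * 1)%:R + 1.
have k0 : 0 < k by rewrite ltr_wpDl.
have [d d0 Hd] := tube_cont (Psi := fun t y => jac (f t) y) x_cont jac_cont (divr_gt0 e0 k0).
exists d => // t y y' y'' tab yd y'd y''d.
have It : `[a, b]%classic t by rewrite /= in_itv.
have jac_near p : nrm (p - x t) <= d ->
    nrm (jac (f t) p - jac (f t) y'') <= 2 * (e / k).
  move=> pd; have -> : jac (f t) p - jac (f t) y'' =
      (jac (f t) p - jac (f t) (x t)) - (jac (f t) y'' - jac (f t) (x t)).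
    by rewrite opprB addrA subrK.
  rewrite (le_trans (nrmB _ _))// mulr_natl mulr2n lerD//;
    by apply: Hd => //; rewrite subrr normr0 ltW.
pose g c := f t (y' + c *: (y - y')).
have := @has_deriv_mean_value R n 1 g
  (fun c => jac (f t) (y' + c *: (y - y')) *m (y - y'))
  (jac (f t) y'' *m (y - y')) 0 1 (2 * (e / k) * nrm (y - y')) ler01 _ _.
rewrite /g scale1r scale0r addr0 [y' + _]addrC subrK subr0 scale1r mulr1.
move=> H; apply: (le_trans (H _ _)).
- by move=> c _; apply: has_deriv_line; exact: f_diff.
- move=> c /andP[c0 c1]; rewrite -mulmxBl (le_trans (nrmM _ _))//.
  rewrite ler_wpM2r ?nrm_ge0// jac_near//.
  have -> : y' + c *: (y - y') - x t = c *: (y - x t) + (1 - c) *: (y' - x t).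
    by apply/matrixP => i j; rewrite !mxE; ring.
  rewrite (le_trans (nrmD _ _))// !nrmZ !ger0_norm ?subr_ge0//.
  have -> : d = c * d + (1 - c) * d by ring.
  by rewrite lerD// ler_wpM2l// subr_ge0.
- rewrite mulrA ler_wpM2r ?nrm_ge0//.
  have -> : (n * 1)%:R * (2 * (e / k)) = e * ((2 * (n * 1)%:R) / k) :> R by ring.
  by rewrite ler_piMr ?(ltW e0)// ler_pdivrMr// mul1r lerDl.
Qed.

Lemma f_lip_time : exists2 d : R, 0 < d & exists2 K : R, 0 <= K &
  forall s r y, in_seg a b s -> in_seg a b r -> `|r - s| <= d ->
    nrm (y - x s) <= d -> nrm (f r y - f s y) <= K * `|r - s|.
Proof.
have [_ f_der der_cont _] := f_C1.
pose df r y := deriv_on `[a, b] (f ^~ y) r.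
have [d d0 Hd] := tube_cont (Psi := df) x_cont der_cont ltr01.
have [K K0 HK] := trajectory_bnd (Psi := df) x_cont der_cont.
exists d => //; exists ((n * 1)%:R * (K + 1)); first by rewrite mulr_ge0// addr_ge0.
move=> s r y sab rab rs ys.
have bnd q : in_seg a b q -> `|q - s| <= d -> nrm (df q y) <= K + 1.
  move=> qab qs; rewrite -[df q y](subrK (df s (x s))) addrC (le_trans (nrmD _ _))//.
  by rewrite lerD//; [have := HK s sab; rewrite mulr1|exact: Hd].
have key c1 c2 : c1 <= c2 -> in_seg a b c1 -> in_seg a b c2 ->
    `|c1 - s| <= d -> `|c2 - s| <= d ->
    nrm (f c2 y - f c1 y) <= (n * 1)%:R * ((K + 1) * (c2 - c1)).
  move=> c12 /andP[ac1 c1b] /andP[ac2 c2b] c1s c2s.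
  rewrite -[f c2 y - _]subr0 -(scaler0 _ (c2 - c1)).
  apply: (@has_deriv_mean_value R n 1 (f ^~ y) (df ^~ y)) => // q /andP[c1q qc2].
    apply: (@has_deriv_subset _ _ _ `[a, b]).
      move=> u /=; rewrite !in_itv/= => /andP[u1 u2].
      by rewrite (le_trans ac1)//= (le_trans u2).
    apply: derivable_on_has_deriv; apply: f_der.
    by rewrite /= in_itv/= (le_trans ac1)//= (le_trans qc2).
  rewrite subr0; apply: bnd.
    by rewrite /in_seg (le_trans ac1)//= (le_trans qc2).
  move: c1s c2s; rewrite !ler_norml => /andP[h1 _] /andP[_ h2].
  by rewrite (le_trans h1) ?lerD2r//= (le_trans _ h2)// lerD2r.
have ss : `|s - s| <= d by rewrite subrr normr0 ltW.
have [sr|rs'] := leP s r.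
  by rewrite -mulrA ger0_norm ?subr_ge0// key.
by rewrite nrmBC -mulrA ltr0_norm ?subr_lt0// opprB key// ltW.
Qed.

Lemma f_trajectory_bnd : bnd_on a b (fun t => f t (x t)).
Proof. by have [fc _ _ _] := f_C1; exact: trajectory_bnd. Qed.

Lemma jac_trajectory_bnd : bnd_on a b (fun t => jac (f t) (x t)).
Proof.
have [_ _ _ [_ jc]] := f_C1.
exact: (trajectory_bnd (Psi := fun t y => jac (f t) y) x_cont jc).
Qed.

End FieldEstimates.

(* Error equation behind both the Newton step and the Lipschitz bound on the
   algebraic component: [u] solves [u = P (fx - dA z)] at the exact point [x]. *)
Lemma newton_identity (F : comNzRingType) n (P J Pr Pc dA : 'M[F]_n)
    (z' v z u x fx fy : 'cV[F]_n) :
  Pr *m z = z -> Pc *m u = u -> x = z + u -> u = P *m (fx - dA *m z) ->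
  (1%:M - P *m J *m Pc) *m (v - u) =
  (v - P *m (fy - dA *m Pr *m z')) +
  (P *m (fy - fx - J *m (Pr *m z' + Pc *m v - x)) +
   (P *m J *m Pr *m (z' - z) - P *m dA *m Pr *m (z' - z))).
Proof.
move=> Prz Pcu xE uE.
have -> : Pr *m z' + Pc *m v - x = Pr *m (z' - z) + Pc *m (v - u).
  by rewrite !mulmxBr Prz Pcu xE; mxlin.
have uE' : u = P *m fx - P *m dA *m Pr *m z by rewrite -(mulmxA _ Pr) Prz {1}uE mulmxBr mulmxA.
rewrite mulmxBl mul1mx {1}uE' !(mulmxBr, mulmxDr, mulmxN) !mulmxA; mxlin.
Qed.

Lemma triple_product_diff (F : comNzRingType) n (X Y Z X' Y' Z' : 'M[F]_n) :
  (1%:M - X *m Y *m Z) - (1%:M - X' *m Y' *m Z') =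
  - ((X - X') *m Y *m Z + X' *m (Y - Y') *m Z + X' *m Y' *m (Z - Z')).
Proof. by rewrite !(mulmxBl, mulmxBr); mxlin. Qed.

Lemma triple_product_diff_mid (F : comNzRingType) n (X Y Z Y' : 'M[F]_n) :
  (1%:M - X *m Y *m Z) - (1%:M - X *m Y' *m Z) = X *m (Y' - Y) *m Z.
Proof. by rewrite !(mulmxBl, mulmxBr); mxlin. Qed.

(** In the limit this is [z' = P1' z + H (f - B z - A' z)]. It starts from [zt = Pt zt], writes
    [Ps zt] as [Hs At zt] minus [Hs (At - As) zt], and uses [At zt = wt], so that only increments of
    [P1], [w] and [A] remain besides those of [z]. *)
Lemma consistency_identity (F : comNzRingType) n
    (Pt Ps dP Hs As At dA B : 'M[F]_n) (zt zs wt ws fs xs : 'cV[F]_n) (h : F) :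
  Pt *m zt = zt -> Ps *m zs = zs -> Hs *m As = Ps -> At *m zt = wt ->
  Hs *m ws = zs -> Hs *m B *m xs = Hs *m B *m zs ->
  zt - zs - h *: ((dP - Hs *m (dA + B)) *m Ps *m zs + Hs *m fs) =
  (Pt - Ps - h *: dP) *m zt + (h *: (dP *m (zt - zs)) +
  (Hs *m (wt - ws - h *: (fs - B *m xs)) - (Hs *m (At - As - h *: dA) *m zt +
   h *: (Hs *m dA *m (zt - zs))))).
Proof.
move=> Ptz Psz HA Az Hw HB.
rewrite -(mulmxA _ Ps) Psz.
rewrite !(mulmxBr, mulmxBl, mulmxDr, mulmxDl, mulmxN, mulNmx) -!scalemxAr -!scalemxAl.
rewrite !(mulmxBr, mulmxBl, mulmxDr, mulmxDl, mulmxN, mulNmx) Ptz HA Hw.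
rewrite -(mulmxA Hs At) Az !mulmxA HB.
by mxlin.
Qed.

(** Closing arithmetic of [step_u_error]: [y1] and [y2] are the incoming errors, and [y3] is the
    distance from the old iterate to the new exact value. *)
Lemma absorb_half (R : realType) (q1 q2 q3 q4 q5 q6 y1 y2 y3 : R) :
  q1 <= (y1 + y3) / 2 -> y3 <= y2 + q3 ->
  0 <= q3 -> 0 <= q4 -> 0 <= q5 -> 0 <= q6 -> 0 <= y1 ->
  q1 + q2 <= y1 + q5 + q2 + y2 / 2 + q6 + q3 + q4.
Proof. by move=> h1 h2 h3 h4 h5 h6 h7; lra. Qed.

(** * Regularity of the exact solution and error analysis of the scheme *)

Section Scheme.
Variables (R : realType) (n : nat) (a b : R).
Variables (A B P H dA dPr : R -> 'M[R]_n).
Variables (f : R -> 'cV[R]_n -> 'cV[R]_n) (x : R -> 'cV[R]_n).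
Hypothesis ab : a < b.
Hypothesis pair : forall t, in_seg a b t -> spectral_pair (A t) (B t) (P t) (H t).
Hypotheses (lA : lip_on a b A) (lB : lip_on a b B) (lP : lip_on a b P).
Hypotheses (lH : lip_on a b H) (ldA : lip_on a b dA) (ldPr : lip_on a b dPr).
Let Pr t := H t *m A t.
Let Pc t := P t *m B t.
Hypothesis A_deriv : forall t, in_seg a b t -> has_deriv `[a, b] A t (dA t).
Hypothesis Pr_deriv : forall t, in_seg a b t -> has_deriv `[a, b] Pr t (dPr t).
Hypothesis f_C1 : C1_tx `[a, b] f.
Hypothesis x_cont : {within `[a, b], continuous x}.
Hypothesis w_deriv : forall t, in_seg a b t ->
  has_deriv `[a, b] (fun t => A t *m x t) t (f t (x t) - B t *m x t).
Let N t y := 1%:M - P t *m jac (f t) y *m Pc t.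
Hypothesis N_unit : forall t y, in_seg a b t -> N t y \in unitmx.

Let z t := Pr t *m x t.
Let u t := Pc t *m x t.
Let w t := A t *m x t.

Let bA := lip_bnd_on (ltW ab) lA.
Let bB := lip_bnd_on (ltW ab) lB.
Let bP := lip_bnd_on (ltW ab) lP.
Let bH := lip_bnd_on (ltW ab) lH.
Let bdA := lip_bnd_on (ltW ab) ldA.
Let bdPr := lip_bnd_on (ltW ab) ldPr.

Let lPr : lip_on a b Pr. Proof. exact: lip_on_mul. Qed.
Let lPc : lip_on a b Pc. Proof. exact: lip_on_mul. Qed.
Let bPr := lip_bnd_on (ltW ab) lPr.
Let bPc := lip_bnd_on (ltW ab) lPc.

Lemma x_bnd : bnd_on a b x.
Proof.
have [d d0 Hd] := trajectory_cont x_cont ltr01.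
have [|M HM] := @segment_bounded R a b (fun s => nrm (x s)).
  move=> s sab; exists (nrm (x s) + 1), d => // r rab rs.
  by rewrite -[x r](subrK (x s)) addrC (le_trans (nrmD _ _))// lerD2l Hd.
by exists `|M| => // s sab; rewrite mulr1 (le_trans (HM s sab))// ler_norm.
Qed.

(** For pairs at distance more than [d], boundedness by [c] already gives a difference quotient of
    at most [2 c / d]. *)
Lemma local_lip m p (g : R -> 'M[R]_(m, p)) (d K : R) : 0 < d -> 0 <= K ->
  bnd_on a b g ->
  (forall s t, in_seg a b s -> in_seg a b t -> `|t - s| <= d ->
     nrm (g t - g s) <= K * `|t - s|) -> lip_on a b g.
Proof.
move=> d0 K0 [c c0 gc] gd; exists (K + 2 * c / d).
  by rewrite addr_ge0// mulr_ge0 ?mulr_ge0// invr_ge0 ltW.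
move=> [t s] [/= tab sab]; have [ts|ts] := leP `|t - s| d.
  by rewrite (le_trans (gd s t sab tab ts))// ler_wpM2r// lerDl divr_ge0 ?mulr_ge0// ltW.
have bt := gc t tab; have bs := gc s sab; rewrite !mulr1 in bt bs.
rewrite (le_trans (nrmB _ _))// (le_trans (lerD bt bs))//.
apply: (@le_trans _ _ (2 * c / d * `|t - s|)); last by rewrite ler_wpM2r// lerDr.
have -> : c + c = 2 * c / d * d by rewrite divfK ?gt_eqF// mulr_natl mulr2n.
by rewrite ler_wpM2l ?(ltW ts)// divr_ge0 ?mulr_ge0// ltW.
Qed.

Lemma w_bnd_deriv : bnd_on a b (fun t => f t (x t) - B t *m x t).
Proof.
apply: OO_subr; first exact: f_trajectory_bnd x_cont f_C1.
exact: OO_bmul bB x_bnd.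
Qed.

Lemma w_lip : lip_on a b w.
Proof. exact: has_deriv_lip w_deriv w_bnd_deriv. Qed.

Lemma zE t : z t = H t *m w t.
Proof. by rewrite /z /Pr /w mulmxA. Qed.

(** Although [x] is only continuous, [w = A x] has a bounded derivative, and [z = H w]. *)
Lemma z_lip : lip_on a b z.
Proof.
have bw := lip_bnd_on (ltW ab) w_lip.
apply: OO_ext (lip_on_mul bH bw lH w_lip) => q _; by rewrite !zE.
Qed.

Let bz := lip_bnd_on (ltW ab) z_lip.

Section AtTime.
Variable t : R.
Hypothesis tab : in_seg a b t.

Lemma PrPc : Pr t + Pc t = 1%:M.
Proof. by have [] := pair tab. Qed.

Lemma xE : x t = z t + u t.
Proof. by rewrite /z /u -mulmxDl PrPc mul1mx. Qed.

Lemma Pc_idem : Pc t *m Pc t = Pc t.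
Proof. by have [_ _ _ _ [E _ _]] := pair tab; rewrite /Pc mulmxA E. Qed.

Lemma Pr_idem : Pr t *m Pr t = Pr t.
Proof.
have E : Pr t = 1%:M - Pc t by rewrite -PrPc addrK.
by rewrite [in LHS]E mulmxBl mul1mx mulmxBr mulmx1 Pc_idem subrr subr0.
Qed.

Lemma Prz : Pr t *m z t = z t.
Proof. by rewrite /z mulmxA Pr_idem. Qed.

Lemma Pcu : Pc t *m u t = u t.
Proof. by rewrite /u mulmxA Pc_idem. Qed.

Lemma Az : A t *m z t = w t.
Proof.
have [AP _ _ _ _] := pair tab.
by rewrite /w xE mulmxDr [A t *m u t]mulmxA [A t *m Pc t]mulmxA AP !mul0mx addr0.
Qed.

Lemma HBx : H t *m B t *m x t = H t *m B t *m z t.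
Proof.
have [_ _ _ _ [_ HBP _]] := pair tab.
by rewrite xE mulmxDr /u [X in _ + X]mulmxA [_ *m Pc t]mulmxA HBP !mul0mx addr0.
Qed.

Lemma Pz0 : P t *m w t = 0.
Proof. by have [_ PA _ _ _] := pair tab; rewrite /w mulmxA PA mul0mx. Qed.

End AtTime.

Lemma lo_linear_eq0 t m p (M : 'M[R]_(m, p)) : in_seg a b t ->
  lo `[a, b] t (fun s => (s - t) *: M) -> M = 0.
Proof.
move=> tab HM; apply: nrm0_eq0; apply/ler_addgt0Pr => e e0; rewrite add0r.
have [d d0 Hd] := HM _ e0.
have [s [sab st sd]] : exists s, [/\ in_seg a b s, s != t & `|s - t| <= d].
  have /andP[at_ tb] := tab.
  have [tb'|bt] := ltP t b.
    exists (Num.min b (t + d)).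
    have h1 : t < Num.min b (t + d) by rewrite lt_min tb' ltrDl.
    rewrite gt_eqF//; split=> //.
      by rewrite /in_seg (le_trans at_ (ltW h1)) ge_min lexx.
    by rewrite gtr0_norm ?subr_gt0// lerBlDl ge_min lexx orbT.
  exists (Num.max a (t - d)).
  have h1 : Num.max a (t - d) < t.
    by rewrite gt_max (lt_le_trans ab bt) ltrBlDr ltrDl.
  rewrite lt_eqF//; split=> //.
    by rewrite /in_seg (le_trans (ltW h1) tb) le_max lexx.
  by rewrite ltr0_norm ?subr_lt0// opprB lerBlDl -lerBlDr le_max lexx orbT.
have := Hd s; rewrite /= in_itv/= => /(_ sab sd).
by rewrite nrmZ mulrC ler_pM2r// normr_gt0 subr_eq0.
Qed.

(** Apply the fixed matrix [P t] to the first-order expansion of [w] at [t]. Since [P t] kills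
    [A t], [P t w(s)] equals [P t (A s - A t) z(s)], hence [(s - t) P A' z] up to little-o, while
    [P (f - B x) = P f - u]. Comparing the linear terms gives the claim. *)
Lemma constraint t : in_seg a b t -> u t = P t *m (f t (x t) - dA t *m z t).
Proof.
move=> tab; apply/eqP; rewrite -subr_eq0; apply/eqP; apply: (lo_linear_eq0 tab).
have Iab s : `[a, b]%classic s -> in_seg a b s by rewrite /= in_itv.
apply: (lo_ext (G := fun s =>
  P t *m (w s - w t - (s - t) *: (f t (x t) - B t *m x t)) -
  (P t *m (A s - A t - (s - t) *: dA t) *m z s +
   (s - t) *: (P t *m dA t *m (z s - z t))))).
  move=> s /Iab sab.
  have PA : P t *m A t = 0 by have [] := pair tab.
  rewrite !(mulmxBr, mulmxBl) -!scalemxAr -!scalemxAl (Pz0 tab) PA mul0mx.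
  rewrite -(mulmxA (P t) (A s)) (Az sab) /u /Pc !mulmxBr !mulmxA.
  by mxlin.
apply: lo_add.
  apply: lo_mull; first exact: near_bnd_cst.
  exact/has_deriv_lo/w_deriv.
apply: lo_opp; apply: lo_add.
  apply: lo_mulr.
    apply: lo_mull; first exact: near_bnd_cst.
    exact/has_deriv_lo/A_deriv.
  have [c c0 Hc] := bz; exists (c + 1); first by rewrite ltr_wpDl.
  by exists 1 => // s /Iab /Hc; rewrite mulr1 => /le_trans H1 _; rewrite H1// lerDl.
have [c c0 Hc] := z_lip.
apply: (@lo_quad R _ t _ _ _ (nrm (P t *m dA t) * c) 1 ltr01) => s /Iab sab _.
rewrite nrmZ mulrCA ler_wpM2l// (le_trans (nrmM _ _))// -mulrA.
by rewrite ler_wpM2l ?nrm_ge0// (Hc (s, t)).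
Qed.

Let Jx t := jac (f t) (x t).

Lemma jac_tube (e : R) : 0 < e -> exists2 d : R, 0 < d & forall s r y,
  in_seg a b s -> in_seg a b r -> `|r - s| <= d -> nrm (y - x s) <= d ->
  nrm (jac (f r) y - Jx s) <= e.
Proof.
have [_ _ _ [_ jc]] := f_C1.
by move=> e0; exact: (tube_cont (Psi := fun t y => jac (f t) y) x_cont jc e0).
Qed.

(** Pointwise invertibility becomes a locally uniform bound because [N] varies continuously along
    [x], and a uniform one by compactness. *)
Lemma N_inverse_trajectory_bnd : bnd_on a b (fun t => invmx (N t (x t))).
Proof.
have bJ : bnd_on a b Jx := jac_trajectory_bnd x_cont f_C1.
(* The Jacobian along [x] is only continuous, so its increment is kept as a separate part of the
   rate. *)
pose g (q : R * R) := `|q.1 - q.2| + nrm (Jx q.1 - Jx q.2).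
have lipg m p (F : R * R -> 'M[R]_(m, p)) :
    OO (in_seg2 a b) F (fun q => `|q.1 - q.2|) -> OO (in_seg2 a b) F g.
  by apply: OO_weak => q _; rewrite lerDl nrm_ge0.
have [c c0 Hc] : OO (in_seg2 a b) (fun q => N q.1 (x q.1) - N q.2 (x q.2)) g.
  apply: (OO_ext (G := fun q => - ((P q.1 - P q.2) *m Jx q.1 *m Pc q.1 +
     P q.2 *m (Jx q.1 - Jx q.2) *m Pc q.1 + P q.2 *m Jx q.2 *m (Pc q.1 - Pc q.2)))).
    by move=> q _; exact: triple_product_diff.
  apply: OO_opp; apply: OO_add; first apply: OO_add.
  - apply: lipg; apply: OO_mulb (bnd_on1 bPc); exact: OO_mulb lP (bnd_on1 bJ).
  - apply: OO_mulb (bnd_on1 bPc); apply: OO_bmul (bnd_on2 bP) _.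
    by exists 1 => // q _; rewrite mul1r /g lerDr.
  - apply: lipg; apply: OO_bmul _ lPc; exact: OO_bmul (bnd_on2 bP) (bnd_on2 bJ).
have [|M HM] := @segment_bounded R a b (fun s => nrm (invmx (N s (x s)))).
  move=> s sab; pose X := invmx (N s (x s)); pose k := nrm X.
  have k0 : 0 <= c * k by rewrite mulr_ge0 ?nrm_ge0.
  (* Makes [c (e + e) k] at most the 1/2 required by [nrm_inverse_perturb]; the [1] keeps the
     denominator positive. *)
  pose e := (4 * (c * k + 1))^-1.
  have e0 : 0 < e by rewrite invr_gt0 mulr_gt0// ltr_wpDl.
  have [d1 d10 Hd1] := jac_tube e0.
  have [d2 d20 Hd2] := trajectory_cont x_cont d10.
  exists (2 * k), (Num.min e (Num.min d1 d2)); first by rewrite !lt_min e0 d10.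
  move=> r rab; rewrite !le_min => /and3P[re r1 r2].
  apply: (nrm_inverse_perturb (M := N s (x s)) (N := N r (x r))).
  - by rewrite mulmxV ?N_unit.
  - by rewrite mulVmx ?N_unit.
  - have Jrs : nrm (Jx r - Jx s) <= e by apply: Hd1 => //; exact: Hd2.
    rewrite nrmBC -/k (le_trans (ler_wpM2r (nrm_ge0 _) (Hc (r, s) _)))//=.
    apply: (@le_trans _ _ (c * (e + e) * k)).
      by rewrite ler_wpM2r ?nrm_ge0// ler_wpM2l// lerD.
    have -> : c * (e + e) * k = 2 * (c * k) / (4 * (c * k + 1)) by rewrite /e; ring.
    rewrite ler_pdivrMr ?mulr_gt0// ?ltr_wpDl//.
    have -> : 2^-1 * (4 * (c * k + 1)) = 2 * (c * k) + 2 :> R by field.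
    by rewrite lerDl.
by exists `|M| => // s sab; rewrite mulr1 (le_trans (HM s sab))// ler_norm.
Qed.

Lemma N_inverse_tube_bnd : exists2 d : R, 0 < d & exists2 K : R, 0 <= K &
  forall t y, in_seg a b t -> nrm (y - x t) <= d -> nrm (invmx (N t y)) <= K.
Proof.
have [k k0 Hk] := N_inverse_trajectory_bnd.
have [p p0 Hp] := bP; have [q q0 Hq] := bPc.
pose e := (2 * (p * q * k + 1))^-1.
have D0 : 0 < 2 * (p * q * k + 1) by rewrite mulr_gt0// ltr_wpDl// !mulr_ge0.
have e0 : 0 < e by rewrite invr_gt0.
have [d d0 Hd] := jac_tube e0.
exists d => //; exists (2 * k); first by rewrite mulr_ge0.
move=> t y tab yx; have kt := Hk t tab; rewrite mulr1 in kt.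
apply: (@le_trans _ _ (2 * nrm (invmx (N t (x t))))); last by rewrite ler_wpM2l.
apply: (nrm_inverse_perturb (M := N t (x t)) (N := N t y)).
- by rewrite mulmxV ?N_unit.
- by rewrite mulVmx ?N_unit.
have -> : N t (x t) - N t y = P t *m (jac (f t) y - Jx t) *m Pc t.
  exact: triple_product_diff_mid.
have Jt : nrm (jac (f t) y - Jx t) <= e by apply: Hd => //; rewrite subrr normr0 ltW.
have pt := Hp t tab; have qt := Hq t tab; rewrite !mulr1 in pt qt.
apply: (@le_trans _ _ (p * e * q * k)).
  rewrite ler_pM ?nrm_ge0// (le_trans (nrmM _ _))// ler_pM ?nrm_ge0//.
  by rewrite (le_trans (nrmM _ _))// ler_pM ?nrm_ge0.
have -> : p * e * q * k = (p * q * k) / (2 * (p * q * k + 1)) by rewrite /e; ring.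
rewrite ler_pdivrMr// mulrA mulVf// mul1r lerDl//.
Qed.

Lemma f_local_lip : exists2 d : R, 0 < d & exists2 K : R, 0 <= K &
  forall t y, in_seg a b t -> nrm (y - x t) <= d ->
    nrm (f t y - f t (x t)) <= K * nrm (y - x t).
Proof.
have [d d0 Hd] := f_linearization x_cont f_C1 ltr01.
have [k k0 Hk] := jac_trajectory_bnd x_cont f_C1.
exists d => //; exists (1 + k); first by rewrite addr_ge0.
move=> t y tab yx; have xx : nrm (x t - x t) <= d by rewrite subrr nrm0 ltW.
rewrite -(subrK (jac (f t) (x t) *m (y - x t)) (f t y - f t (x t))).
rewrite (le_trans (nrmD _ _))// mulrDl lerD//; first exact: Hd.
rewrite (le_trans (nrmM _ _))// ler_wpM2r ?nrm_ge0//.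
by have := Hk t tab; rewrite mulr1.
Qed.

(** Take [v = u s] in [newton_identity] at time [t], with the exact [z t]. The residual is O(|t -
    s|), because it vanishes for [s = t] by [constraint] and its ingredients are Lipschitz; the
    linearization error is a small multiple of [u s - u t] and is absorbed. *)
Lemma u_lip : lip_on a b u.
Proof.
have bx := x_bnd; have bu : bnd_on a b u by exact: OO_bmul bPc bx.
have [d1 d10 [K1 K10 HK1]] := N_inverse_tube_bnd.
have [d2 d20 [K2 K20 HK2]] := f_lip_time x_cont f_C1.
have [d3 d30 [K3 K30 HK3]] := f_local_lip.
have [p p0 Hp] := bP; have [q q0 Hq] := bPc.
(* Keeps the linearization error, amplified by the inverse of [N] and by [P] and [Pc], below half of
   [nrm (u s - u t)]. *)
pose e := (2 * (K1 * p * q + 1))^-1.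
have D0 : 0 < 2 * (K1 * p * q + 1) by rewrite mulr_gt0// ltr_wpDl// !mulr_ge0.
have e0 : 0 < e by rewrite invr_gt0.
have [d4 d40 Hd4] := f_linearization x_cont f_C1 e0.
pose dm := Num.min d1 (Num.min d2 (Num.min d3 d4)).
have dm0 : 0 < dm by rewrite !lt_min d10 d20 d30.
(* [y q] is the point at which the scheme would restart at time [q.1] from the
   exact algebraic component at time [q.2] *)
pose y (q : R * R) := Pr q.1 *m z q.1 + Pc q.1 *m u q.2.
have yx1 r : in_seg2 a b r -> y r - x r.1 = Pc r.1 *m (u r.2 - u r.1).
  move=> [r1 r2]; rewrite mulmxBr Pcu// (xE r1) /y Prz//.
  by mxlin.
have [c c0 Hc] : OO (in_seg2 a b) (fun r => y r - x r.2) (fun r => `|r.1 - r.2|).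
  apply: (OO_ext (G := fun r => (z r.1 - z r.2) + (Pc r.1 - Pc r.2) *m u r.2)).
    by move=> r [r1 r2]; rewrite /y (xE r2) Prz// mulmxBl Pcu//; mxlin.
  apply: OO_add z_lip _; exact: OO_mulb lPc (bnd_on2 bu).
have [d5 d50 Hd5] : exists2 d : R, 0 < d & forall r, in_seg2 a b r ->
    `|r.1 - r.2| <= d -> nrm (y r - x r.1) <= dm /\ nrm (y r - x r.2) <= dm.
  have [dx dx0 Hdx] := trajectory_cont x_cont (divr_gt0 dm0 (ltr0n R 2)).
  exists (Num.min dx (dm / 2 / (c + 1))).
    by rewrite lt_min dx0 !divr_gt0// ltr_wpDl.
  move=> r rab; rewrite le_min ler_pdivlMr ?ltr_wpDl// => /andP[rx rc].
  have h2 : nrm (y r - x r.2) <= dm / 2.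
    rewrite (le_trans (Hc r rab))// (le_trans _ rc)// mulrC ler_wpM2l// lerDl//.
  have [r1 r2] := rab.
  split; last by rewrite (le_trans h2)// ler_pdivrMr// ler_pMr// ler1n.
  have -> : y r - x r.1 = (y r - x r.2) - (x r.1 - x r.2) by rewrite opprB addrA subrK.
  by rewrite (le_trans (nrmB _ _))// (splitr dm) lerD// Hdx.
pose d6 := Num.min d5 d2.
have d65 : d6 <= d5 by rewrite ge_min lexx.
pose D' r := in_seg2 a b r /\ `|r.1 - r.2| <= d6.
have sub r : D' r -> in_seg2 a b r by case.
(* This is the Newton residual. Its estimate needs [y r] close to the trajectory, hence the
   restriction to nearby times in [D']. *)
have [C C0 HC] : OO D' (fun r => u r.2 - P r.1 *m (f r.1 (y r) - dA r.1 *m Pr r.1 *m z r.1))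
    (fun r => `|r.1 - r.2|).
  pose fw s := f s (x s) - dA s *m z s.
  have bfw : bnd_on a b fw.
    apply: OO_subr; first exact: f_trajectory_bnd x_cont f_C1.
    exact: OO_bmul bdA bz.
  have ldAz := lip_on_mul bdA bz ldA z_lip.
  apply: (OO_ext (G := fun r => - ((P r.1 - P r.2) *m fw r.2 +
     P r.1 *m ((f r.1 (y r) - f r.2 (y r)) + (f r.2 (y r) - f r.2 (x r.2)) -
       (dA r.1 *m z r.1 - dA r.2 *m z r.2))))).
    move=> r [[r1 r2] _]; rewrite (constraint r2) -/(fw r.2).
    rewrite -(mulmxA (dA r.1)) Prz// /fw !(mulmxBr, mulmxBl, mulmxDr) !mulmxA.
    by mxlin.
  apply: OO_opp; apply: OO_add.
    by apply: OO_mulb; [exact: OO_sub sub lP|exact: OO_sub sub (bnd_on2 bfw)].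
  apply: OO_bmul; first exact: OO_sub sub (bnd_on1 bP).
  apply: OO_subr; last exact: OO_sub sub ldAz.
  apply: OO_add.
    exists K2 => // r [rab rd]; have [r1 r2] := rab.
    have [_ yr] := Hd5 r rab (le_trans rd d65).
    have h : dm <= d2 by rewrite !ge_min lexx orbT.
    apply: HK2 => //; last exact: le_trans yr h.
    by rewrite (le_trans rd)// ge_min lexx orbT.
  exists (K3 * c); first by rewrite mulr_ge0.
  move=> r [rab rd]; have [r1 r2] := rab.
  have [_ yr] := Hd5 r rab (le_trans rd d65).
  rewrite -mulrA (le_trans (HK3 _ _ r2 _)) ?ler_wpM2l ?Hc//.
  by rewrite (le_trans yr)// !ge_min lexx !orbT.
have d60 : 0 < d6 by rewrite lt_min d50.
apply: (@local_lip _ _ _ d6 (2 * (K1 * C))) => //; first by rewrite !mulr_ge0.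
move=> s t sab tab ts; pose r := (t, s).
have rab : in_seg2 a b r by [].
have [yt ys] := Hd5 r rab (le_trans ts d65).
pose J := jac (f t) (y r).
have I := @newton_identity _ _ (P t) J (Pr t) (Pc t) (dA t) (z t) (u s) (z t) (u t) (x t)
  (f t (x t)) (f t (y r)) (Prz tab) (Pcu tab) (xE tab) (constraint tab).
rewrite subrr !mulmx0 subrr addr0 -/(y r) in I.
have E : u s - u t = invmx (N t (y r)) *m (N t (y r) *m (u s - u t)).
  by rewrite mulmxA mulVmx ?N_unit// mul1mx.
pose U := nrm (u s - u t).
have U0 : 0 <= U by exact: nrm_ge0.
have pt := Hp t tab; have qt := Hq t tab; rewrite !mulr1 in pt qt.
have NE : nrm (N t (y r) *m (u s - u t)) <= C * `|t - s| + p * (e * (q * U)).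
  rewrite I (le_trans (nrmD _ _))// lerD//; first exact: (HC r).
  rewrite (le_trans (nrmM _ _))// ler_pM ?nrm_ge0//.
  have h : dm <= d4 by rewrite !ge_min lexx !orbT.
  rewrite (le_trans (Hd4 t (y r) (x t) (y r) tab _ _ _)) ?(le_trans yt h)//.
    by rewrite subrr nrm0 ltW.
  rewrite ler_wpM2l ?(ltW e0)// (yx1 r rab) (le_trans (nrmM _ _))//.
  by rewrite ler_wpM2r// nrm_ge0.
have Kt : nrm (invmx (N t (y r))) <= K1.
  by apply: HK1 => //; rewrite (le_trans yt)// ge_min lexx.
have UE : U <= K1 * (C * `|t - s| + p * (e * (q * U))).
  by rewrite {1}/U E (le_trans (nrmM _ _))// ler_pM ?nrm_ge0.
have half : K1 * (p * (e * (q * U))) <= U / 2.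
  have -> : K1 * (p * (e * (q * U))) = (K1 * p * q / (2 * (K1 * p * q + 1))) * U.
    by rewrite /e; ring.
  rewrite [leRHS]mulrC ler_wpM2r// ler_pdivrMr// mulrA mulVf// mul1r lerDl//.
rewrite nrmBC -/U; move: UE half; rewrite mulrDr -!mulrA.
move: (K1 * (C * `|t - s|)) (K1 * (p * (e * (q * U)))) => X Y; lra.
Qed.

Lemma x_lip : lip_on a b x.
Proof.
apply: OO_ext (OO_add z_lip u_lip) => q [q1 q2]; rewrite (xE q1) (xE q2).
by mxlin.
Qed.

(** The last regularity needed: it gives [w] a second-order Taylor remainder, although [x] itself is
    only known to be Lipschitz. *)
Lemma dw_lip : lip_on a b (fun t => f t (x t) - B t *m x t).
Proof.
have bx := x_bnd; have lx := x_lip.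
have lBx := lip_on_mul bB bx lB lx.
suff lf : lip_on a b (fun t => f t (x t)).
  by apply: OO_ext (OO_subr lf lBx) => q _; mxlin.
have [d2 d20 [K2 K20 HK2]] := f_lip_time x_cont f_C1.
have [d3 d30 [K3 K30 HK3]] := f_local_lip.
have [c c0 Hc] := lx.
have dm0 : 0 < Num.min d2 d3 by rewrite lt_min d20.
have [d5 d50 Hd5] := trajectory_cont x_cont dm0.
apply: (@local_lip _ _ _ (Num.min d5 d2) (K2 + K3 * c)).
- by rewrite lt_min d50.
- by rewrite addr_ge0// mulr_ge0.
- exact: f_trajectory_bnd x_cont f_C1.
move=> s t sab tab; rewrite le_min => /andP[ts5 ts2].
have := Hd5 s t sab tab ts5; rewrite le_min => /andP[x2 x3].
rewrite -(subrK (f s (x t)) (f t (x t))) -addrA (le_trans (nrmD _ _))// mulrDl.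
rewrite lerD//; first exact: HK2.
by rewrite (le_trans (HK3 _ _ sab x3))// -mulrA ler_wpM2l// (Hc (t, s)).
Qed.

Let Mz t := (dPr t - H t *m (dA t + B t)) *m Pr t.

Lemma consistency : OO (forward a b) (fun q => z q.2 - z q.1 -
    (q.2 - q.1) *: (Mz q.1 *m z q.1 + H q.1 *m f q.1 (x q.1)))
  (fun q => (q.2 - q.1) ^+ 2).
Proof.
have seg1 q : forward a b q -> in_seg a b q.1.
  by move=> [h1 h2 h3]; rewrite /in_seg h1 (le_trans h2).
have seg2 q : forward a b q -> in_seg a b q.2.
  by move=> [h1 h2 h3]; rewrite /in_seg h3 (le_trans h1).
have fwd1 m p (g : R -> 'M[R]_(m, p)) : bnd_on a b g ->
    OO (forward a b) (fun q => g q.1) (fun=> 1) by exact: OO_comp seg1.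
have fwd2 m p (g : R -> 'M[R]_(m, p)) : bnd_on a b g ->
    OO (forward a b) (fun q => g q.2) (fun=> 1) by exact: OO_comp seg2.
have lz : OO (forward a b) (fun q => z q.2 - z q.1) (fun q => q.2 - q.1).
  have [c c0 Hc] := z_lip; exists c => // q fq.
  have [_ h2 _] := fq.
  have := Hc (q.2, q.1) (conj (seg2 q fq) (seg1 q fq)) => /=.
  by rewrite ger0_norm ?subr_ge0.
have scl m p (F : R * R -> 'M[R]_(m, p)) : OO (forward a b) F (fun q => q.2 - q.1) ->
    OO (forward a b) (fun q => (q.2 - q.1) *: F q) (fun q => (q.2 - q.1) ^+ 2).
  move=> HF; apply: OO_weak (OO_scale (fun q => q.2 - q.1) HF) => q [_ h2 _].
  by rewrite ger0_norm ?subr_ge0// expr2.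
apply: (OO_ext (G := fun q => (Pr q.2 - Pr q.1 - (q.2 - q.1) *: dPr q.1) *m z q.2 +
  ((q.2 - q.1) *: (dPr q.1 *m (z q.2 - z q.1)) +
  (H q.1 *m (w q.2 - w q.1 - (q.2 - q.1) *: (f q.1 (x q.1) - B q.1 *m x q.1)) -
   (H q.1 *m (A q.2 - A q.1 - (q.2 - q.1) *: dA q.1) *m z q.2 +
    (q.2 - q.1) *: (H q.1 *m dA q.1 *m (z q.2 - z q.1))))))).
  move=> q fq; have s1 := seg1 q fq; have s2 := seg2 q fq.
  apply: consistency_identity; [exact: Prz|exact: Prz|by []|exact: Az| |exact: HBx].
  by rewrite -zE.
apply: OO_add.
  by apply: OO_mulb; [exact: has_deriv_taylor Pr_deriv ldPr|exact: fwd2].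
apply: OO_add; first by apply: scl; apply: OO_bmul lz; exact: fwd1.
apply: OO_subr.
  apply: OO_bmul; first exact: fwd1.
  exact: has_deriv_taylor w_deriv dw_lip.
apply: OO_add.
  apply: OO_mulb; last exact: fwd2.
  apply: OO_bmul; first exact: fwd1.
  exact: has_deriv_taylor A_deriv ldA.
apply: scl; apply: OO_bmul lz; apply: OO_bmul; exact: fwd1.
Qed.

Definition step_z (h s : R) (zi xi : 'cV[R]_n) : 'cV[R]_n :=
  (1%:M + h *: Mz s) *m zi + h *: (H s *m f s xi).

Definition step_u (t : R) (z' v : 'cV[R]_n) : 'cV[R]_n :=
  let y := Pr t *m z' + Pc t *m v in
  v - invmx (N t y) *m (v - P t *m (f t y - dA t *m Pr t *m z')).

Lemma x_error t (zi ui : 'cV[R]_n) : in_seg a b t ->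
  Pr t *m zi + Pc t *m ui - x t = Pr t *m (zi - z t) + Pc t *m (ui - u t).
Proof.
by move=> tab; rewrite !mulmxBr (Prz tab) (Pcu tab) (xE tab); mxlin.
Qed.

Lemma x_error_bound : exists2 k : R, 0 < k & forall t zi ui, in_seg a b t ->
  nrm (Pr t *m zi + Pc t *m ui - x t) <= k * (nrm (zi - z t) + nrm (ui - u t)).
Proof.
have [p p0 Hp] := bPr; have [q q0 Hq] := bPc.
exists (p + q + 1); first by rewrite ltr_wpDl// addr_ge0.
move=> t zi ui tab; rewrite x_error// (le_trans (nrmD _ _))// mulrDr.
have pt := Hp t tab; have qt := Hq t tab; rewrite !mulr1 in pt qt.
rewrite lerD// (le_trans (nrmM _ _))// ler_wpM2r ?nrm_ge0//.
  by rewrite (le_trans pt)// -addrA lerDl addr_ge0.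
by rewrite (le_trans qt)// addrAC addrC lerDl addr_ge0.
Qed.

Lemma step_z_error : exists2 d : R, 0 < d & exists2 C : R, 0 <= C &
  forall s t zi ui, a <= s -> s <= t -> t <= b ->
    nrm (zi - z s) <= d -> nrm (ui - u s) <= d ->
    nrm (step_z (t - s) s zi (Pr s *m zi + Pc s *m ui) - z t) <=
    nrm (zi - z s) + (t - s) * (C * (nrm (zi - z s) + nrm (ui - u s))) + C * (t - s) ^+ 2.
Proof.
have [d3 d30 [K3 K30 HK3]] := f_local_lip.
have [k k0 Hk] := x_error_bound.
have [c c0 Hc] := consistency.
have [m m0 Hm] : bnd_on a b Mz.
  apply: OO_bmul bPr; apply: OO_subr => //; apply: OO_bmul => //; exact: OO_add.
have [hh hh0 Hh] := bH.
(* Two errors of this size, multiplied by [k], keep the recombined point within distance [d3] of the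
   trajectory. *)
exists (d3 / (2 * k)); first by rewrite divr_gt0// mulr_gt0.
exists (m + hh * (K3 * k) + c); first by rewrite !addr_ge0// !mulr_ge0// ltW.
move=> s t zi ui as_ st tb zs us.
have sab : in_seg a b s by rewrite /in_seg as_ (le_trans st).
have h0 : 0 <= t - s by rewrite subr_ge0.
set xi := Pr s *m zi + Pc s *m ui.
set e1 := nrm (zi - z s) in zs *; set e2 := nrm (ui - u s) in us *.
have e10 : 0 <= e1 by exact: nrm_ge0.
have e20 : 0 <= e2 by exact: nrm_ge0.
have xe : nrm (xi - x s) <= k * (e1 + e2) by exact: Hk.
have xd : nrm (xi - x s) <= d3.
  rewrite (le_trans xe)//; move: zs us; rewrite !ler_pdivlMr ?mulr_gt0// => zs us.
  have -> : k * (e1 + e2) = (e1 * (2 * k) + e2 * (2 * k)) / 2 by field.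
  by rewrite ler_pdivrMr// mulr_natr mulr2n lerD.
have fe := HK3 s xi sab xd.
(* Old error, its propagation through the step, and the local error of the exact solution. *)
have -> : step_z (t - s) s zi xi - z t = (zi - z s) +
   (t - s) *: (Mz s *m (zi - z s) + H s *m (f s xi - f s (x s))) -
   (z t - z s - (t - s) *: (Mz s *m z s + H s *m f s (x s))).
  rewrite /step_z mulmxDl mul1mx -scalemxAl !mulmxBr; mxlin.
have ms := Hm s sab; have hs := Hh s sab; rewrite !mulr1 in ms hs.
rewrite (le_trans (nrmB _ _))//.
have h2 : nrm ((t - s) *: (Mz s *m (zi - z s) + H s *m (f s xi - f s (x s)))) <=
    (t - s) * ((m + hh * (K3 * k)) * (e1 + e2)).
  rewrite nrmZ ger0_norm// ler_wpM2l// (le_trans (nrmD _ _))// mulrDl lerD//.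
    rewrite (le_trans (nrmM _ _))// ler_pM ?nrm_ge0// -/e1.
    by rewrite lerDl.
  rewrite (le_trans (nrmM _ _))// -!mulrA ler_pM ?nrm_ge0//.
  by rewrite (le_trans fe)// ler_wpM2l.
have h3 := Hc (s, t) (And3 as_ st tb); rewrite /= in h3.
rewrite (le_trans (lerD (nrmD _ _) h3))// -/e1 -addrA -[leRHS]addrA lerD2l lerD//.
  by rewrite (le_trans h2)// ler_wpM2l// ler_wpM2r ?addr_ge0// lerDl.
by rewrite ler_wpM2r ?exprn_ge0// lerDr addr_ge0// !mulr_ge0// ltW.
Qed.

(** Only linear contraction of Newton's method is used. The starting value approximates [u s], not
    [u t], which costs the Lipschitz term in [t - s]; the tube is so thin that the linearization
    error is at most half of the initial distance plus half of the error in [z]. *)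
Lemma step_u_error : exists2 d : R, 0 < d & exists2 C : R, 0 <= C &
  forall s t z' v, a <= s -> s <= t -> t <= b -> t - s <= d ->
    nrm (z' - z t) <= d -> nrm (v - u s) <= d ->
    nrm (step_u t z' v - u t) <= C * nrm (z' - z t) + nrm (v - u s) / 2 + C * (t - s).
Proof.
have [d1 d10 [K1 K10 HK1]] := N_inverse_tube_bnd.
have [k k0 Hk] := x_error_bound.
have [cu cu0 Hcu] := u_lip.
have [p p0 Hp] := bP; have [r r0 Hr] := bPr; have [g g0 Hg] := bdA.
have [kJ kJ0 HJ] := jac_trajectory_bnd x_cont f_C1.
have [dj dj0 Hdj] := jac_tube ltr01.
pose e := (2 * (K1 * p * k + 1))^-1.
have Kpk : 0 <= K1 * p * k by rewrite !mulr_ge0// ltW.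
have D0 : 0 < 2 * (K1 * p * k + 1) by rewrite mulr_gt0// ltr_wpDl.
have e0 : 0 < e by rewrite invr_gt0.
have [d4 d40 Hd4] := f_linearization x_cont f_C1 e0.
pose dm := Num.min d1 (Num.min dj d4).
have dm0 : 0 < dm by rewrite !lt_min d10 dj0.
have k2 : 0 < k * (2 + cu) by rewrite mulr_gt0// ltr_pwDl.
pose M := K1 * (p * (kJ + 1) * r + p * g * r).
have M0 : 0 <= M by rewrite mulr_ge0// addr_ge0// !mulr_ge0// addr_ge0.
(* The two errors and the step are each at most this number, so [e1 + V] is at most [2 + cu] times
   it and [y] stays within [dm] of [x t]. *)
exists (dm / (k * (2 + cu))); first by rewrite divr_gt0.
exists (1 + cu + M); first by rewrite !addr_ge0.
move=> s t z' v as_ st tb hd zd vd.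
have sab : in_seg a b s by rewrite /in_seg as_ (le_trans st).
have tab : in_seg a b t by rewrite /in_seg tb (le_trans as_).
pose y := Pr t *m z' + Pc t *m v; pose J := jac (f t) y.
set e1 := nrm (z' - z t) in zd *; set e2 := nrm (v - u s) in vd *.
pose V := nrm (v - u t).
have VE : V <= e2 + cu * (t - s).
  rewrite /V -(subrK (u s) v) -addrA (le_trans (nrmD _ _))// lerD2l nrmBC.
  by have := Hcu (t, s) (conj tab sab); rewrite /= ger0_norm ?subr_ge0.
have YE : nrm (y - x t) <= k * (e1 + V) by exact: Hk.
have Yd : nrm (y - x t) <= dm.
  rewrite (le_trans YE)//.
  apply: (@le_trans _ _ (k * (2 + cu) * (dm / (k * (2 + cu))))); last first.
    by rewrite mulrC divfK// gt_eqF.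
  rewrite -mulrA ler_wpM2l ?(ltW k0)//.
  have h1 : cu * (t - s) <= cu * (dm / (k * (2 + cu))) by rewrite ler_wpM2l.
  move: zd vd VE h1; move: (dm / _) => q; lra.
have Y1 : nrm (y - x t) <= d1 by rewrite (le_trans Yd)// ge_min lexx.
have Yj : nrm (y - x t) <= dj by rewrite (le_trans Yd)// !ge_min lexx orbT.
have Y4 : nrm (y - x t) <= d4 by rewrite (le_trans Yd)// !ge_min lexx !orbT.
have I := @newton_identity _ _ (P t) J (Pr t) (Pc t) (dA t) z' v (z t) (u t) (x t)
  (f t (x t)) (f t y) (Prz tab) (Pcu tab) (xE tab) (constraint tab).
pose E := P t *m (f t y - f t (x t) - J *m (y - x t)) +
  (P t *m J *m Pr t *m (z' - z t) - P t *m dA t *m Pr t *m (z' - z t)).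
(* [newton_identity] writes [N (v - u t)] as the Newton residual plus [E]; the Newton correction
   removes exactly the residual. *)
have -> : step_u t z' v - u t = invmx (N t y) *m E.
  have -> : E = N t y *m (v - u t) - (v - P t *m (f t y - dA t *m Pr t *m z')).
    by rewrite [N t y *m _]I [RHS]addrC addKr.
  rewrite mulmxBr mulmxA mulVmx ?N_unit// mul1mx /step_u -/y.
  by rewrite addrAC.
have pt := Hp t tab; have rt := Hr t tab; have gt := Hg t tab.
have jt := HJ t tab; rewrite !mulr1 in pt rt gt jt.
have Jb : nrm J <= kJ + 1.
  rewrite -(subrK (Jx t) J) addrC (le_trans (nrmD _ _))// lerD//.
  by apply: Hdj => //; rewrite subrr normr0 ltW.
have Eb : nrm E <= p * (e * (k * (e1 + V))) + (p * (kJ + 1) * r + p * g * r) * e1.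
  rewrite (le_trans (nrmD _ _))// lerD//.
    rewrite (le_trans (nrmM _ _))// ler_pM ?nrm_ge0//.
    rewrite (le_trans (Hd4 t y (x t) y tab _ _ _))//; first by rewrite subrr nrm0 ltW.
    by rewrite ler_wpM2l// ltW.
  rewrite (le_trans (nrmB _ _))// mulrDl lerD//; rewrite (le_trans (nrmM _ _))//;
    rewrite ler_wpM2r ?nrm_ge0// (le_trans (nrmM _ _))// ler_pM ?nrm_ge0//;
    by rewrite (le_trans (nrmM _ _))// ler_pM ?nrm_ge0.
have Kt : nrm (invmx (N t y)) <= K1 by exact: HK1.
rewrite (le_trans (nrmM _ _))// (le_trans (ler_pM _ _ Kt Eb)) ?nrm_ge0//.
have V0 : 0 <= V by exact: nrm_ge0.
have e10 : 0 <= e1 by exact: nrm_ge0.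
have half : K1 * (p * (e * (k * (e1 + V)))) <= (e1 + V) / 2.
  have -> : K1 * (p * (e * (k * (e1 + V)))) =
      (K1 * p * k / (2 * (K1 * p * k + 1))) * (e1 + V) by rewrite /e; ring.
  rewrite [leRHS]mulrC ler_wpM2r ?addr_ge0// ler_pdivrMr// mulrA mulVf// mul1r lerDl//.
rewrite mulrDr [X in _ + X]mulrA -/M.
have cut : 0 <= cu * (t - s) by rewrite mulr_ge0// subr_ge0.
have Mt : 0 <= M * (t - s) by rewrite mulr_ge0// subr_ge0.
have cue : 0 <= cu * e1 by rewrite mulr_ge0.
have ts0 : 0 <= t - s by rewrite subr_ge0.
have -> : (1 + cu + M) * e1 + e2 / 2 + (1 + cu + M) * (t - s) =
  e1 + cu * e1 + M * e1 + e2 / 2 + (t - s) + cu * (t - s) + M * (t - s) by ring.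
exact: (absorb_half _ half VE cut Mt cue ts0 e10).
Qed.

Lemma scheme_convergence : exists2 K : R, 0 <= K & exists2 h0 : R, 0 < h0 &
  forall (N : nat) (Z V : nat -> 'cV[R]_n) (h := (b - a) / N%:R)
    (node := fun i : nat => a + i%:R * h),
  (0 < N)%N -> h <= h0 -> Z 0%N = z a -> V 0%N = u a ->
  (forall i, (i < N)%N -> Z i.+1 = step_z h (node i) (Z i)
     (Pr (node i) *m Z i + Pc (node i) *m V i)) ->
  (forall i, (i < N)%N -> V i.+1 = step_u (node i.+1) (Z i.+1) (V i)) ->
  forall i, (i <= N)%N ->
    nrm (x (node i) - (Pr (node i) *m Z i + Pc (node i) *m V i)) <= K * h.
Proof.
have [k k0 Hk] := x_error_bound.
have [d1 d10 [C1 C10 H1]] := step_z_error.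
have [d2 d20 [C2 C20 H2]] := step_u_error.
pose C := C1 + C2; have C0 : 0 <= C by rewrite addr_ge0.
pose K := gronwall_cst C (b - a).
have K0 : 0 <= K by rewrite addr_ge0 ?mulr_ge0 ?addr_ge0 ?mulr_ge0 ?expR_ge0.
pose d := Num.min d1 d2; have d0 : 0 < d by rewrite lt_min d10.
exists (k * (2 * K)); first by rewrite !mulr_ge0// ltW.
(* The first bound is the step restriction of [step_u_error]; the second gives [K * h <= d], so the
   induction never leaves the tube. *)
exists (Num.min d2 (d / (K + 1))).
  by rewrite lt_min d20 divr_gt0// ltr_wpDl.
move=> M Z V h node M0; rewrite le_min ler_pdivlMr ?ltr_wpDl// => /andP[hd2 hK].
move=> Z0 V0 ZS VS.
have M0' : 0 < M%:R :> R by rewrite ltr0n.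
have h0 : 0 < h by rewrite divr_gt0// subr_gt0.
have Mh : M%:R * h = b - a by rewrite mulrC divfK// gt_eqF.
have nodeS i : node i.+1 - node i = h by rewrite /node -natr1; ring.
have node_a i : a <= node i by rewrite lerDl mulr_ge0// ltW.
have node_b i : (i <= M)%N -> node i <= b.
  by move=> iM; rewrite -lerBrDl -Mh ler_wpM2r ?ler_nat// ltW.
have node_le i : node i <= node i.+1 by rewrite -subr_ge0 nodeS ltW.
have node_in i : (i <= M)%N -> in_seg a b (node i).
  by move=> iM; rewrite /in_seg node_a node_b.
have node0 : node 0%N = a by rewrite /node mul0r addr0.
have Kh : K * h <= d by rewrite (le_trans _ hK)// mulrC ler_wpM2l ?(ltW h0)// lerDl.
have dd1 : d <= d1 by rewrite ge_min lexx.
have dd2 : d <= d2 by rewrite ge_min lexx orbT.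
have err i : (i <= M)%N ->
    nrm (Z i - z (node i)) <= K * h /\ nrm (V i - u (node i)) <= K * h.
  move: i; apply: (@discrete_gronwall R C (b - a) C0
    (fun i => nrm (Z i - z (node i))) (fun i => nrm (V i - u (node i))) M h d h0 _ Kh);
    rewrite ?Mh ?node0 ?Z0 ?V0 ?subrr ?nrm0//.
  - move=> i iM zi vi.
    have := H1 (node i) (node i.+1) (Z i) (V i) (node_a i) (node_le i) (node_b _ iM)
      (le_trans zi dd1) (le_trans vi dd1).
    rewrite nodeS -(ZS i iM) => /le_trans; apply.
    have CC : C1 <= C by rewrite lerDl.
    rewrite lerD ?ler_wpM2r ?exprn_ge0 ?(ltW h0)// lerD2l ler_wpM2l ?(ltW h0)//.
    by rewrite ler_wpM2r// addr_ge0 ?nrm_ge0.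
  - move=> i iM zi vi zS.
    have hd : node i.+1 - node i <= d2 by rewrite nodeS.
    have := H2 (node i) (node i.+1) (Z i.+1) (V i) (node_a i) (node_le i) (node_b _ iM) hd
      (le_trans zS dd2) (le_trans vi dd2).
    rewrite -(VS i iM) nodeS => /le_trans; apply.
    have CC : C2 <= C by rewrite lerDr.
    by rewrite !lerD// ler_wpM2r ?nrm_ge0// ltW.
move=> i iM; have [ai bi] := err i iM.
rewrite nrmBC (le_trans (Hk _ _ _ (node_in i iM)))// -!mulrA ler_wpM2l ?(ltW k0)//.
by rewrite mulr_natl mulr2n lerD.
Qed.

End Scheme.

(** * From the operator [Phi] to the Newton matrix *)

Section ConstraintJacobian.
Variables (R : realType) (n : nat).

Lemma mulmx_continuous (M : 'M[R]_n) : continuous (mulmx M : 'cV[R]_n -> 'cV[R]_n).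
Proof.
move=> v; apply/(@cvgrPdist_le _ _ _ (nbhs v)) => e e0.
have k0 : 0 < nrm M * (n * 1)%:R + 1 by rewrite ltr_wpDl// mulr_ge0// nrm_ge0.
apply: (iffRL (@nbhs_normP _ 'cV[R]_n v _)); exists (e / (nrm M * (n * 1)%:R + 1)); first by rewrite /= divr_gt0.
move=> w /= /ltW; rewrite ler_pdivlMr// => vw.
rewrite -mulmxBr (le_trans (nrm_ge_norm _))// (le_trans (nrmM _ _))//.
rewrite (le_trans (ler_wpM2l (nrm_ge0 _) (nrm_le_norm _)))// mulrA.
by rewrite (le_trans _ vw)// mulrC ler_wpM2l// lerDl.
Qed.

Lemma jac_mulmx (M : 'M[R]_n) (g : 'cV[R]_n -> 'cV[R]_n) (y : 'cV[R]_n) :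
  differentiable g y -> jac (fun p => M *m g p) y = M *m jac g y.
Proof.
move=> dg; have cM := @mulmx_continuous M.
have dM : differentiable (mulmx M : 'cV[R]_n -> 'cV[R]_n) (g y).
  exact: linear_differentiable.
have E v : 'd (mulmx M \o g) y v = M *m 'd g y v.
  have /(congr1 (fun h : 'cV[R]_n -> 'cV[R]_n => h v)) := diff_comp dg dM.
  have /(congr1 (fun h : 'cV[R]_n -> 'cV[R]_n => h ('d g y v))) := diff_lin (g y) cM.
  by move=> /= <-.
rewrite -[fun p => _]/(mulmx M \o g).
apply/matrixP => i j; rewrite mxE E !mxE.
by apply: eq_bigr => k _; congr (_ * _); rewrite mxE.
Qed.

Lemma unitmx_of_injective (M : 'M[R]_n) :
  (forall v : 'cV[R]_n, M *m v = 0 -> v = 0) -> M \in unitmx.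
Proof.
move=> Minj; rewrite unitmxE unitfE -det_tr; apply/det0P => -[v v0 vM].
case/negP: v0; rewrite -(trmxK v) (Minj v^T) ?trmx0//.
by rewrite -[LHS]trmxK trmx_mul trmxK vM trmx0.
Qed.

Lemma enorm_le_nrm (v : 'cV[R]_n) : enorm v <= nrm v.
Proof.
rewrite /enorm -[leRHS]ger0_norm ?nrm_ge0// -sqrtr_sqr ler_wsqrtr//.
rewrite /inner expr2 {1}/nrm mulr_suml ler_sum// => i _.
rewrite big_ord_recl big_ord0 addr0 (le_trans (ler_norm _))// normrM.
by rewrite ler_wpM2l// nrm_entry.
Qed.

End ConstraintJacobian.

(** A kernel vector satisfies [v = P J P2 v], with [J] the Jacobian, so it lies in [X2] because
    [P = P B P]. Multiplying by [B] gives [(Q2 J - B) v = 0], and injectivity of [Phi] on [X2]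
    yields [v = 0]. *)
Lemma newton_unit (R : realType) n (A B P H : 'M[R]_n) (g : 'cV[R]_n -> 'cV[R]_n) y :
  spectral_pair A B P H -> differentiable g y ->
  set_inj (range_mx (P *m B))
    (fun v : 'cV[R]_n => (jac (fun p => B *m P *m g p) y - B) *m (P *m B) *m v) ->
  1%:M - P *m jac g y *m (P *m B) \in unitmx.
Proof.
move=> [_ _ _ _ [PBP _ _]] dg inj; apply: unitmx_of_injective => v.
rewrite mulmxBl mul1mx => /eqP; rewrite subr_eq0 => /eqP vE.
have PBv : P *m B *m v = v by rewrite [in LHS]vE !mulmxA PBP [RHS]vE !mulmxA.
apply: (inj).
- by rewrite inE; exists v.
- by rewrite inE; exists 0; rewrite // mulmx0.
rewrite mulmx0 -mulmxA PBv mulmxBl jac_mulmx//.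
apply/eqP; rewrite subr_eq0; apply/eqP.
by rewrite [in RHS]vE -(mulmxA _ (P *m B) v) PBv !mulmxA.
Qed.

(* [method_step] with its coefficient matrices as arguments, so that they can be
   replaced without unfolding the contour integrals that define them. *)
Definition generic_step (R : realType) n (h : R) (D g p p' q' g' a a' b : 'M[R]_n)
    (ft ft' : 'cV[R]_n -> 'cV[R]_n) (zux : 'cV[R]_n * 'cV[R]_n * 'cV[R]_n) :=
  let: (z, u, x) := zux in
  let z' := (1%:M + h *: ((D - g *m (a + b)) *m p)) *m z + h *: (g *m ft x) in
  let y := p' *m z' + q' *m u in
  let u' := u - invmx (1%:M - g' *m jac ft' y *m q') *m
    (u - g' *m (ft' y - a' *m p' *m z')) in
  (z', u', p' *m z' + q' *m u').

Lemma generic_step_congr (R : realType) n (h : R)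
    (D g g1 p p1 p' p1' q' q1' g' g1' a a' b : 'M[R]_n) ft ft' zux :
  g = g1 -> g' = g1' -> p = p1 -> p' = p1' -> q' = q1' ->
  generic_step h D g p p' q' g' a a' b ft ft' zux =
  generic_step h D g1 p1 p1' q1' g1' a a' b ft ft' zux.
Proof. by do 5![move=> ->]. Qed.

Lemma method_stepE (R : realType) n (tp : R) (A B P H : R -> 'M[R]_n) (C2 : R -> R)
    (f : R -> 'cV[R]_n -> 'cV[R]_n) (h t t' : R) (zux : 'cV[R]_n * 'cV[R]_n * 'cV[R]_n)
    (z' := step_z A B H (dA A tp) (dP1 A B C2 tp) f h t zux.1.1 zux.2)
    (u' := step_u A B P H (dA A tp) f t' z' zux.1.2) :
  Ginv A B C2 t *m Q1 A B C2 t = H t -> Ginv A B C2 t' *m Q2 A B C2 t' = P t' ->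
  P1 A B C2 t = H t *m A t -> P1 A B C2 t' = H t' *m A t' ->
  P2 A B C2 t' = P t' *m B t' ->
  method_step A B C2 tp f h t t' zux =
  (z', u', H t' *m A t' *m z' + P t' *m B t' *m u').
Proof.
rewrite /u' /z' => GQ GQ' PE PE' PE2; case: zux {z' u'} => -[z u] x.
exact: (@generic_step_congr R n h (dP1 A B C2 tp t) _ _ _ _ _ _ _ _ _ _
  (dA A tp t) (dA A tp t') (B t) (f t) (f t') (z, u, x) GQ GQ' PE PE' PE2).
Qed.

(** The contour integrals are traded for [Pinf] and [Hinf], whose Lipschitz bounds on [[t0, T]] feed
    [scheme_convergence]; derivatives given on unbounded intervals are restricted to [[t0, T]]. *)
Theorem theorem3p1 (R : realType) (n : nat) (tp : R)
    (f : R -> 'cV[R]_n -> 'cV[R]_n) (A B : R -> 'M[R]_n) (C1 C2 : R -> R)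
    (J := `[tp, +oo[%classic)
    (P1 := P1 A B C2) (P2 := P2 A B C2) (Q1 := Q1 A B C2)
    (X1 := X1 A B C2) (X2 := X2 A B C2) (Y2 := Y2 A B C2)
    (Ginv := Ginv A B C2) (dA := dA A tp) (dP1 := dP1 A B C2 tp)
    (L := Lmanifold A B C2 tp f) (Phi := Phi A B C2 f) :
  0 <= tp ->
  {within J `*` setT, continuous (fun p : R * 'cV[R]_n => f p.1 p.2)} ->
  has_jac_on J f ->
  C1_on J A -> C1_on J B ->
  (forall t, J t -> regular_pencil A B t) ->
  (forall t, J t -> 0 < C1 t) ->
  (forall t, J t -> 0 < C2 t) ->
  C1_on J C2 ->
  (forall t (lambda : R[i]), J t -> C2 t <= Normc.normc lambda ->
     pencil A B t lambda \in unitmx /\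
     copnorm (invmx (pencil A B t lambda)) <= C1 t) ->
  ((forall t xp1, J t -> X1 t xp1 ->
      exists! xp2, X2 t xp2 /\ L (t, xp1 + xp2)) /\
   (forall t xp1 xp2, J t -> X1 t xp1 -> X2 t xp2 -> L (t, xp1 + xp2) ->
      invertible_between (X2 t) (Y2 t) (Phi t xp1 xp2))
   \/
   (forall t xp1, J t -> X1 t xp1 ->
      exists xp2, X2 t xp2 /\ L (t, xp1 + xp2)) /\
   (forall t xp1 y1 y2, J t -> X1 t xp1 -> X2 t y1 -> X2 t y2 ->
      L (t, xp1 + y1) -> L (t, xp1 + y2) ->
      basis_invertible (\rank (P2 t)) (X2 t) (Y2 t) (Phi t xp1)
        (segment y1 y2))) ->
  (exists (k U : R -> R) (r : R) (V : R -> 'cV[R]_n -> R),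
     let D := [set z : 'cV[R]_n | r <= enorm z] in
     [/\ {within J, continuous k},
         {within `]0, +oo[, continuous U} /\ (forall v, 0 < v -> 0 < U v),
         0 < r &
         C1_tz J D V] /\
     [/\ exists W : 'cV[R]_n -> R,
           [/\ {within D, continuous W}, forall z, D z -> 0 < W z &
               forall t z, J t -> D z -> W z <= V t z],
         exists v0 : R, 0 < v0 /\
           (\int[lebesgue_measure]_(v in `[v0, +oo[) ((U v)^-1)%:E)%E = +oo%E,
         forall a b : R, tp <= a -> a < b -> forall M : R, exists rho : R,
           forall t z, a <= t < b -> D z -> rho <= enorm z -> M <= V t z &
         forall t xp1 xp2, J t -> X1 t xp1 -> X2 t xp2 ->
           L (t, xp1 + xp2) -> r <= enorm xp1 ->
           deriv_on J (V ^~ xp1) t +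
           inner (grad_on D (V t) xp1)
             ((dP1 t - Ginv t *m Q1 t *m (dA t + B t)) *m xp1 +
              Ginv t *m Q1 t *m f t (xp1 + xp2))
           <= k t * U (V t xp1)]) ->
  forall (t0 T : R) (x0 : 'cV[R]_n),
  tp <= t0 -> t0 < T ->
  (forall t z u, t0 <= t <= T ->
     invertible_between (X2 t) (Y2 t) (Phi t (P1 t *m z) (P2 t *m u))) ->
  C2_on `[t0, T] A -> C2_on `[t0, T] B -> C2_on `[t0, T] C2 ->
  C1_tx `[t0, T] f ->
  L (t0, x0) ->
  forall x : R -> 'cV[R]_n,
  solves_IVP A B f `[t0, +oo[ t0 x0 x ->
  (fun N : nat => \big[Num.max/0]_(1 <= i < N.+1)
     enorm (x (node t0 T N i) - approx_sol A B C2 tp f t0 T x0 N i))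
  =O_\oo (fun N : nat => stepsize t0 T N).
Proof.
move=> tp0 f_cont f_jac A_C1 B_C1 _ C1_gt0 C2_gt0 C2_C1 pencil_bound _ _.
move=> t0 T x0 tt0 t0T Phi_inv A_C2 B_C2 _ f_C1 _ x [x_cont w_C1 x_eq x_init].
have tpT : tp <= T by rewrite (le_trans tt0)// ltW.
pose P := Pinf A B C2; pose H := Hinf A B C2.
have inJ t : in_seg t0 T t -> J t by exact: in_J.
have pairJ := pair_J C2_gt0 pencil_bound.
have P1E := P1_J C2_gt0 pencil_bound; have P2E := P2_J C2_gt0 pencil_bound.
have Q1E := Q1_J C2_gt0 pencil_bound; have Q2E := Q2_J C2_gt0 pencil_bound.
have GE := Ginv_J C2_gt0 pencil_bound.
have subJ : `[tp, T] `<=` J by exact: seg_sub_J.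
have subT s : in_seg t0 T s -> in_seg tp T s.
  by move=> /andP[ts sT]; rewrite /in_seg sT (le_trans tt0).
have subT2 q : in_seg2 t0 T q -> in_seg2 tp T q by move=> [/subT ? /subT].
have [bP bH] := bnd_on_P_H A_C1 B_C1 C2_gt0 C2_C1 pencil_bound tpT.
have lA := C1_on_lip subJ A_C1; have lB := C1_on_lip subJ B_C1.
have bB := lip_bnd_on tpT lB.
have pairT t : in_seg tp T t -> spectral_pair (A t) (B t) (P t) (H t).
  by move=> tT; apply: pairJ; exact: in_J (lexx tp) tT.
have lP := lip_on_P pairT lA lB bP bH.
have lH := lip_on_H pairT lA lB bB bP bH.
have ldA := C2_on_lip_deriv tt0 t0T A_C1 A_C2.
have ldB := C2_on_lip_deriv tt0 t0T B_C1 B_C2.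
(* The segment [[t, t + 1]] lies in [J] and makes the defining limit unique, also at [t = tp]. *)
have dP1E t : J t -> dP1 t = dprojector B P H dA (deriv_on J B) t.
  move=> Jt; have tpt : tp <= t by move: Jt; rewrite /J/= in_itv/= andbT.
  have t1 : t < t + 1 by rewrite ltrDl.
  apply: (has_deriv_on_eq t1 (seg_sub_J tpt)); first by rewrite lexx ltW.
  exact: (has_deriv_P1 A_C1 B_C1 C2_gt0 C2_C1 pencil_bound Jt).
have ldP1 : lip_on t0 T dP1.
  have := lip_on_dprojector pairT lA lB bB bP bH tt0 (ltW t0T) (lexx T) ldA ldB.
  by apply: OO_ext => q [/inJ q1 /inJ q2]; rewrite !dP1E.
have sub0J : `[t0, T] `<=` J by exact: seg_sub_J.
have A_deriv t : in_seg t0 T t -> has_deriv `[t0, T] A t (dA t).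
  move=> /inJ Jt; apply: (has_deriv_subset sub0J).
  by apply: derivable_on_has_deriv; exact: A_C1.1.
have P1_deriv t : in_seg t0 T t ->
    has_deriv `[t0, T] (fun s => H s *m A s) t (dP1 t).
  move=> tT; rewrite (dP1E t (inJ t tT)); apply: (has_deriv_ext (G := P1)).
  - by rewrite /= in_itv.
  - by move=> s /sub0J Js; rewrite /P1 P1E.
  - apply: (has_deriv_subset sub0J).
    exact: (has_deriv_P1 A_C1 B_C1 C2_gt0 C2_C1 pencil_bound (inJ t tT)).
have subI : `[t0, T] `<=` `[t0, +oo[.
  by move=> t /=; rewrite !in_itv/= => /andP[->].
have x_contT : {within `[t0, T], continuous x} by exact: continuous_subspaceW x_cont.
have w_deriv t : in_seg t0 T t ->
    has_deriv `[t0, T] (fun s => A s *m x s) t (f t (x t) - B t *m x t).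
  move=> tT; have It : `[t0, +oo[%classic t by apply: subI; rewrite /= in_itv.
  apply: (has_deriv_subset subI); rewrite -(x_eq t It) addrK.
  by apply: derivable_on_has_deriv; exact: w_C1.1.
have N_unit t y : in_seg t0 T t ->
    1%:M - P t *m jac (f t) y *m (P t *m B t) \in unitmx.
  move=> tT; have Jt := inJ t tT.
  have [df _] : has_jac_on `[t0, T] f by case: f_C1.
  apply: (newton_unit (pairJ t Jt)); first by apply: df; rewrite /= in_itv.
  (* With [z = u = y] the hypothesis on [Phi] reaches an arbitrary point [y]. *)
  have Ey : P1 t *m y + P2 t *m y = y.
    by rewrite -mulmxDl /P2 /Defs.P2 addrC subrK mul1mx.
  have [_ inj _] := Phi_inv t y y tT; move: inj.
  by rewrite /X2 /Defs.X2 /Phi /Defs.Phi Ey (P2E t Jt) (Q2E t Jt).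
have [K K0 [h0 h00 conv]] := scheme_convergence t0T (fun t tT => pairJ t (inJ t tT))
  (OO_sub subT2 lA) (OO_sub subT2 lB) (OO_sub subT2 lP) (OO_sub subT2 lH) ldA ldP1
  A_deriv P1_deriv f_C1 x_contT w_deriv N_unit.
have P12 t : in_seg t0 T t -> P1 t *m (P1 t *m x t) + P2 t *m (P2 t *m x t) = x t.
  move=> tT; have pt s : in_seg t0 T s -> spectral_pair (A s) (B s) (P s) (H s).
    by move=> sT; exact: pairJ (inJ s sT).
  have Jt := inJ t tT; rewrite /P1 /P2 (P1E t Jt) (P2E t Jt).
  by rewrite (Prz x pt tT) (Pcu x pt tT) -(xE x pt tT).
have GQ1 t : in_seg t0 T t -> Ginv t *m Q1 t = H t.
  move=> /inJ Jt; have [_ PA AHBP _ [_ HBP _]] := pairJ t Jt.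
  rewrite /Ginv /Q1 (GE t Jt) (Q1E t Jt) mulmxDl mulmxA PA mul0mx add0r.
  by rewrite -[RHS]mulmx1 -AHBP mulmxDr [X in _ = _ + X]mulmxA HBP addr0.
have GQ2 t : in_seg t0 T t -> Ginv t *m Q2 A B C2 t = P t.
  move=> /inJ Jt; have [_ _ _ _ [PBP HBP _]] := pairJ t Jt.
  by rewrite /Ginv (GE t Jt) (Q2E t Jt) mulmxDl !mulmxA PBP HBP addr0.
have node_in N i : (0 < N)%N -> (i <= N)%N -> in_seg t0 T (node t0 T N i).
  move=> N0 iN; have N0' : 0 < N%:R :> R by rewrite ltr0n.
  have s0 : 0 <= stepsize t0 T N by rewrite divr_ge0// subr_ge0 ltW.
  rewrite /in_seg /node lerDl mulr_ge0//= -lerBrDl.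
  have -> : T - t0 = N%:R * stepsize t0 T N by rewrite mulrC divfK// gt_eqF.
  by rewrite ler_wpM2r// ler_nat.
have node0 N : node t0 T N 0 = t0 by rewrite /node mul0r addr0.
have t0in : in_seg t0 T t0 by rewrite /in_seg lexx ltW.
have step N i : (0 < N)%N -> (i < N)%N ->
    let m := method A B C2 tp f t0 T x0 N in
    m i.+1 = method_step A B C2 tp f (stepsize t0 T N) (node t0 T N i) (node t0 T N i.+1) (m i) by [].
have estimate N : (0 < N)%N -> stepsize t0 T N <= h0 -> forall i, (i <= N)%N ->
    enorm (x (node t0 T N i) - approx_sol A B C2 tp f t0 T x0 N i) <= K * stepsize t0 T N.
  move=> N0 Nh; set m := method A B C2 tp f t0 T x0 N.
  have mS i (iN : (i < N)%N) := etrans (step N i N0 iN) (method_stepE tp f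
      (stepsize t0 T N) (m i) (GQ1 _ (node_in N i N0 (ltnW iN)))
      (GQ2 _ (node_in N i.+1 N0 iN)) (P1E _ (inJ _ (node_in N i N0 (ltnW iN))))
      (P1E _ (inJ _ (node_in N i.+1 N0 iN))) (P2E _ (inJ _ (node_in N i.+1 N0 iN)))).
  have mx i : (i <= N)%N -> (m i).2 =
      H (node t0 T N i) *m A (node t0 T N i) *m (m i).1.1 +
      P (node t0 T N i) *m B (node t0 T N i) *m (m i).1.2.
    (* At [i = 0] the stored point is [x0] itself, which must be recombined from its two
       projections. *)
    case: i => [_|i iN]; last by rewrite [m i.+1](mS i iN).
    rewrite node0 /m /= -/P1 -/P2 -x_init -[LHS](P12 t0 t0in).
    by rewrite /P1 /P2 (P1E t0 (inJ t0 t0in)) (P2E t0 (inJ t0 t0in)).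
  have err := conv N (fun i => (m i).1.1) (fun i => (m i).1.2) N0 Nh _ _ _ _.
  move=> i iN; rewrite (le_trans (enorm_le_nrm _))// /approx_sol -/m mx//.
  apply: err => //.
  - by rewrite /m /= -x_init (P1E t0 (inJ t0 t0in)).
  - by rewrite /m /= -x_init (P2E t0 (inJ t0 t0in)).
  - by move=> j jN; rewrite [m j.+1](mS j jN)/= mx// ltnW.
  - by move=> j jN; rewrite [m j.+1](mS j jN).
(* The constant must be positive, hence [K + 1]. The threshold for [N] makes the step at most
   [h0]. *)
apply/eqO_exP; exists (K + 1); first by rewrite ltr_wpDl.
exists (Num.truncn ((T - t0) / h0)).+1 => // N /= NN.
have N0 : (0 < N)%N by apply: leq_trans NN.
have N0' : 0 < N%:R :> R by rewrite ltr0n.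
have Nh : stepsize t0 T N <= h0.
  rewrite /stepsize ler_pdivrMr// mulrC -ler_pdivrMr//.
  by rewrite ltW// (lt_le_trans (truncnS_gt _))// ler_nat.
have s0 : 0 <= stepsize t0 T N by rewrite divr_ge0// subr_ge0 ltW.
rewrite (ger0_norm s0).
have Ks : 0 <= K * stepsize t0 T N by rewrite mulr_ge0.
(* The maximum starts from 0, so nonnegativity is carried along; it also removes the norm around the
   maximum. *)
have /andP[b0 bK] : 0 <= \big[Num.max/0]_(1 <= i < N.+1)
    enorm (x (node t0 T N i) - approx_sol A B C2 tp f t0 T x0 N i) <= K * stepsize t0 T N.
  rewrite big_nat_cond.
  apply: (big_ind (fun v => 0 <= v <= K * stepsize t0 T N)).
  - by rewrite lexx.
  - move=> v w /andP[v0 vK] /andP[w0 wK]; rewrite le_max v0/=.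
    by rewrite ge_max vK.
  - move=> i /andP[/andP[_ iN] _]; rewrite estimate// andbT.
    by rewrite /enorm sqrtr_ge0.
by rewrite ger0_norm// (le_trans bK)// ler_wpM2r// lerDl.
Qed.
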